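(* $\mathbb{C}^2$ admits a one-parameter family of complete $\mathrm{U}(1)\times\mathrm{U}(1)$-invariant steady gradient Kähler--Ricci solitons, including the Taub-NUT Ricci-flat Kähler metric.
   Context: A steady gradient Kähler--Ricci soliton (steady GKRS) is a Kähler manifold $(M,J,g,\omega)$, with $\omega(Y,Z)=g(JY,Z)$, together with a real holomorphic vector field $X$ such that the Ricci form $\rho$ of $\omega$ satisfies $\rho=-\frac12\mathcal{L}_{JX}\omega$ and $X=-\omega^{-1}(df)$ for a smooth function $f$ (i.e. $\iota_X\omega=-df$, $X=J\nabla f$); equivalently $\rho=\frac12dd^cf$. The case $X=0$ (Ricci-flat Kähler metrics) is included. ''On $\mathbb{C}^2$'' refers to the standard complex structure, and $\mathrm{U}(1)\times\mathrm{U}(1)$ acts diagonally on $\mathbb{C}^2$. The Taub-NUT metric on $\mathbb{C}^2$ is (up to scale) the complete Ricci-flat Kähler metric $\omega=dd^cH$ with $H=\frac12\big((\xi_1-1)^2+\xi_2^2\big)$, where $\xi_1\in(-\infty,0]$ and $\xi_2\in[1,\infty)$ are implicitly defined as functions of $(z_1,z_2)\in\mathbb{C}^2$ by $|z_1|^2=-e^{2}e^{-(\xi_1+\xi_2)}\xi_1$ and $|z_2|^2=e^{\xi_1+\xi_2}(\xi_2-1)$ (LeBrun's description). *)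

(* Defs.v *)
From HB Require Import structures.
From mathcomp Require Import all_boot all_order all_algebra.
From mathcomp Require Import all_classical all_reals all_analysis.
Import Order.TTheory GRing.Theory Num.Theory numFieldNormedType.Exports.

Set Implicit Arguments.
Unset Strict Implicit.
Unset Printing Implicit Defensive.

Local Open Scope classical_set_scope.
Local Open Scope ring_scope.

(* C^2 is the real vector space R^4 of row vectors (x1, y1, x2, y2), with
   z1 = x1 + i y1 and z2 = x2 + i y2.  Tensor fields are given by their
   components in these global coordinates: a vector field is a map to row
   vectors, and a (0,2)-tensor B is a map to matrices, with
   B(Y, Z) = Y *m B *m Z^T. *)

Section Calculus.
Variable R : realType.
Implicit Types (f : 'rV[R]_4 -> R) (x : 'rV[R]_4).

Definition partial (i : 'I_4) f : 'rV[R]_4 -> R :=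
  fun x => 'D_(delta_mx 0 i) f x.

Definition partials (s : seq 'I_4) f : 'rV[R]_4 -> R := foldr partial f s.

Definition smooth f : Prop :=
  forall (s : seq 'I_4),
    continuous (partials s f) /\
    forall (i : 'I_4) x, derivable (partials s f) x (delta_mx 0 i).

Definition smooth_map (F : 'rV[R]_4 -> 'rV[R]_4) : Prop :=
  forall j, smooth (fun x => F x 0 j).

(* With this convention the differential of F at x is Y |-> Y *m jac F x. *)
Definition jac (F : 'rV[R]_4 -> 'rV[R]_4) x : 'M[R]_4 :=
  \matrix_(i, j) partial i (fun y => F y 0 j) x.

End Calculus.

Section Kahler.
Variable R : realType.
Implicit Types (g W : 'rV[R]_4 -> 'M[R]_4) (X V : 'rV[R]_4 -> 'rV[R]_4).
Implicit Types (f : 'rV[R]_4 -> R) (x : 'rV[R]_4).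

(* J Y = Y *m Jmx, so that J (d/dx_k) = d/dy_k and J (d/dy_k) = - d/dx_k. *)
Definition Jmx : 'M[R]_4 := \matrix_(i, j)
  (if odd i then - (j.+1 == i :> nat)%:R else (j == i.+1 :> nat)%:R).

Definition riemannian g : Prop :=
  [/\ forall i j, smooth (fun x => g x i j),
      forall x, (g x)^T = g x &
      forall x (Y : 'rV[R]_4), Y != 0 -> 0 < (Y *m g x *m Y^T) 0 0].

(* omega(Y, Z) = g(J Y, Z) *)
Definition kform g x : 'M[R]_4 := Jmx *m g x.

Definition closed2 W : Prop := forall x i j k,
  partial i (fun y => W y j k) x + partial j (fun y => W y k i) x
  + partial k (fun y => W y i j) x = 0.

Definition kahler g : Prop :=
  [/\ riemannian g,
      forall x, Jmx *m g x *m Jmx^T = g x &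
      closed2 (kform g)].

(* Gamma^k_(i j) of the Levi-Civita connection *)
Definition christoffel g (k i j : 'I_4) x : R :=
  2^-1 * \sum_l invmx (g x) k l *
    (partial i (fun y => g y j l) x + partial j (fun y => g y i l) x
     - partial l (fun y => g y i j) x).

Definition ricci g x : 'M[R]_4 := \matrix_(j, k)
  (\sum_i (partial i (christoffel g i j k) x
           - partial j (christoffel g i i k) x)
   + \sum_i \sum_p
       (christoffel g i i p x * christoffel g p j k x
        - christoffel g i j p x * christoffel g p i k x)).

(* rho(Y, Z) = Ric(J Y, Z) *)
Definition ricci_form g x : 'M[R]_4 := Jmx *m ricci g x.

Definition lie2 V W x : 'M[R]_4 := \matrix_(j, k)
  \sum_l (V x 0 l * partial l (fun y => W y j k) x
          + partial j (fun y => V y 0 l) x * W x l k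
          + partial k (fun y => V y 0 l) x * W x j l).

(* L_X J = 0 *)
Definition real_holomorphic X : Prop :=
  smooth_map X /\ forall x, jac X x *m Jmx = Jmx *m jac X x.

Definition hamiltonian g X f : Prop :=
  smooth f /\ forall x k, (X x *m kform g x) 0 k = - partial k f x.

Definition steady_gkrs g X : Prop :=
  [/\ kahler g,
      real_holomorphic X,
      exists f, hamiltonian g X f &
      forall x, ricci_form g x =
        - 2^-1 *: lie2 (fun y => X y *m Jmx) (kform g) x].

(* d^c f = - df o J, so that dd^c = 2 i del delbar. *)
Definition dc f (k : 'I_4) x : R := - \sum_l Jmx k l * partial l f x.

Definition ddc f x : 'M[R]_4 := \matrix_(j, k)
  (partial j (dc f k) x - partial k (dc f j) x).

End Kahler.
Arguments Jmx {R}.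

Section Completeness.
Variable R : realType.
Implicit Types (g : 'rV[R]_4 -> 'M[R]_4) (c : R -> 'rV[R]_4).

(* A C^1 curve on [0, 1] always extends to a C^1 curve on R. *)
Definition C1_curve c : Prop :=
  (forall t, derivable c t 1) /\ continuous (derive1 c).

Definition curve_length g c : R :=
  Rintegral lebesgue_measure `[0, 1]%classic
    (fun t => Num.sqrt ((derive1 c t *m g (c t) *m (derive1 c t)^T) 0 0)).

(* piecewise_C1 g x y L: some piecewise C^1 curve from x to y, given as a
   finite chain of C^1 curves parametrised by [0, 1], has g-length L. *)
Inductive piecewise_C1 g : 'rV[R]_4 -> 'rV[R]_4 -> R -> Prop :=
| piecewise_nil x : piecewise_C1 g x x 0
| piecewise_cons c y L : C1_curve c -> piecewise_C1 g (c 1) y L ->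
    piecewise_C1 g (c 0) y (curve_length g c + L).

Definition rdist g (x y : 'rV[R]_4) : R := inf [set L | piecewise_C1 g x y L].

Definition complete_metric g : Prop :=
  forall u : nat -> 'rV[R]_4,
    (forall e : R, 0 < e -> exists N : nat, forall m n : nat,
        (N <= m)%N -> (N <= n)%N -> rdist g (u m) (u n) < e) ->
    exists l, rdist g (u n) l @[n --> \oo] --> (0 : R).

End Completeness.

Section Families.
Variable R : realType.
Implicit Types (g h : 'rV[R]_4 -> 'M[R]_4) (X : 'rV[R]_4 -> 'rV[R]_4).

(* (z1, z2) |-> ((c1 + i s1) z1, (c2 + i s2) z2) is x |-> x *m rotmx. *)
Definition rotmx (c1 s1 c2 s2 : R) : 'M[R]_4 :=
  diag_mx (\row_(j < 4) if (j < 2)%N then c1 else c2)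
  + diag_mx (\row_(j < 4) if (j < 2)%N then s1 else s2) *m Jmx.

Definition torus_invariant g X : Prop :=
  forall c1 s1 c2 s2 : R, c1 ^+ 2 + s1 ^+ 2 = 1 -> c2 ^+ 2 + s2 ^+ 2 = 1 ->
  forall x, let A := rotmx c1 s1 c2 s2 in
    A *m g (x *m A) *m A^T = g x /\ X (x *m A) = X x *m A.

(* Continuity in the parameter, for the topology of uniform convergence of all
   derivatives on compact sets. *)
Definition continuous_family (I : set R) (F : R -> 'rV[R]_4 -> R) : Prop :=
  forall s : seq 'I_4,
    {within [set p : R * 'rV[R]_4 | I p.1],
      continuous (fun p : R * 'rV[R]_4 => partials s (F p.1) p.2)}.

(* phi is a biholomorphism of C^2 with phi^* h = a g: its inverse is
   automatically smooth because its differential is invertible. *)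
Definition kahler_homothetic g h : Prop :=
  exists (phi : 'rV[R]_4 -> 'rV[R]_4) (a : R),
    [/\ 0 < a, smooth_map phi, bijective phi,
        forall x, jac phi x *m Jmx = Jmx *m jac phi x &
        forall x, jac phi x *m h (phi x) *m (jac phi x)^T = a *: g x].

Definition taub_nut_coordinates (xi1 xi2 : 'rV[R]_4 -> R) : Prop :=
  forall x : 'rV[R]_4,
    [/\ xi1 x <= 0, 1 <= xi2 x,
        x 0 (inord 0) ^+ 2 + x 0 (inord 1) ^+ 2
          = - expR 2 * expR (- (xi1 x + xi2 x)) * xi1 x &
        x 0 (inord 2) ^+ 2 + x 0 (inord 3) ^+ 2
          = expR (xi1 x + xi2 x) * (xi2 x - 1)].

Definition taub_nut_potential (xi1 xi2 : 'rV[R]_4 -> R) (x : 'rV[R]_4) : R :=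
  2^-1 * ((xi1 x - 1) ^+ 2 + xi2 x ^+ 2).

Definition taub_nut g : Prop :=
  exists (a : R) (xi1 xi2 : 'rV[R]_4 -> R),
    [/\ 0 < a, taub_nut_coordinates xi1 xi2,
        smooth (taub_nut_potential xi1 xi2) &
        forall x, kform g x = a *: ddc (taub_nut_potential xi1 xi2) x].

End Families.

(* Main.v *)
Require Import Defs.
From HB Require Import structures.
From mathcomp Require Import all_boot all_order all_algebra.
From mathcomp Require Import all_classical all_reals all_analysis.
From mathcomp Require Import ring lra.
Import Order.TTheory GRing.Theory Num.Theory numFieldNormedType.Exports.

Set Implicit Arguments.
Unset Strict Implicit.
Unset Printing Implicit Defensive.

Local Open Scope classical_set_scope.
Local Open Scope ring_scope.

(** Let u, v >= 0 stand for - xi1 and xi2 - 1 in the description of Taub-NUT.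
    For c >= 0 put k = 1 / (1 + c), and let p (profile) and P (prim) be the
    functions of v >= 0 with v p = 1 + v - exp(- c v), P' = 1 / p and P(0) = 0.
    The equations
      u exp(u) = |z1|^2 exp(P - 1),
      v p exp(P + c v) = (1 + c) |z2|^2 exp((1 + c) u - 1)
    determine u and v as functions of |z1|^2 and |z2|^2, and for c = 0 they are
    LeBrun's equations, because then p = 1 and P = v. They say that
    u = e1 |z1|^2 and v = e2 |z2|^2 with e1, e2 > 0 explicit in u and v (quot1E,
    quot2E), so nothing degenerates on the axes z1 = 0 and z2 = 0. The metric is
    the one with Kahler form (1/2) d((1 + v) e1 eta1 + k (1 + u) e2 eta2), where
    eta_i = x_i dy_i - y_i dx_i; it is explicit in u, v, c and the coordinates.

    Existence and uniqueness of the solution are monotonicity: the first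
    equation gives u from v by the Lambert function, and the remaining equation
    is increasing in v (balance_lt). The solution depends continuously on
    (c, z) (root_cvg) and implicit differentiation (is_derive_sol) expresses
    du and dv by elementary functions of c, u, v, so an algebra of functions
    of (c, z) is stable under partial derivatives. This gives smoothness of
    each metric and continuity of all derivatives in (c, z) at once
    (generated_smooth).

    Soliton equation. The Ricci form of a Kahler metric is - (1/2) dd^c log D
    with D the determinant of its Hermitian matrix (ricci_form_kahler). Here
    D = k exp(- 2) exp(- f) with f = c (v - u) (metric_det). Moreover f is
    a Hamiltonian of the holomorphic field 2c ((1 + c) K2 - K1), where K_i
    rotates z_i, and the Lie derivative of the Kahler form along J X is then
    - dd^c f by Cartan's formula (lie2_hamiltonian).

    Completeness. With w = 1 + u + v the metric is
    (1/w) (e1 |A|^2 + p e2 |B|^2) for two (1,0)-forms A, B, and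
    du = (2/w) Re(e1 conj(z1) A), dv = (2/w) p Re(e2 conj(z2) B). As u <= w and
    v p <= w, the function (u + v) / 4 has differential of norm at most 1
    (exhaustion_slope), and it is proper; a metric with such a function is
    complete (complete_of_proper).

    Distinctness. A holomorphic homothety phi between the metrics for c and c'
    changes log D by a constant and by the pluriharmonic function
    log |det dphi|^2, so it pulls dd^c f' back to dd^c f (ham_pullback). The
    eigenvalues of dd^c f relative to the metric have ratio - (1 + c w), which
    forces c' w'(phi x) = c w(x) for all x. Since w >= 1, with equality at the
    origin, c = c' (metric_not_homothetic). *)

(** * Calculus of partial derivatives *)

Section DirectionalDerivatives.
Variable R : realType.
Implicit Types (V : normedModType R).

Lemma is_derive_line V (f : V -> R) (p v : V) (s d : R) :
  is_derive (s *: v + p) v f d <-> is_derive s 1 (fun t : R => f (t *: v + p)) d.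
Proof.
have E : (fun h : R => h^-1 *: ((f \o shift (s *: v + p)) (h *: v) - f (s *: v + p)))
  = (fun h : R => h^-1 *: (((fun t : R => f (t *: v + p)) \o shift s) (h *: (1 : R))
       - f (s *: v + p))).
  by apply/funext => h /=; rewrite /= [h *: 1]mulr1 scalerDl addrA.
split => -[Hd He]; apply: DeriveDef.
- by move: Hd; rewrite /derivable E.
- by rewrite -He /derive E.
- by move: Hd; rewrite /derivable -E.
- by rewrite -He /derive -E.
Qed.

Lemma is_derive_line0 V (f : V -> R) (p v : V) (d : R) :
  is_derive p v f d <-> is_derive (0 : R) 1 (fun t : R => f (t *: v + p)) d.
Proof. by rewrite -is_derive_line scale0r add0r. Qed.

Lemma is_derive_chain V (f : R -> R) (g : V -> R) (x v : V) (a b : R) :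
  is_derive (g x) 1 f a -> is_derive x v g b -> is_derive x v (fun y => f (g y)) (a * b).
Proof.
move=> Hf /is_derive_line0 Hg; apply/is_derive_line0.
by apply: (@is_derive1_comp _ f (fun t : R => g (t *: v + x))) => //=; rewrite scale0r add0r.
Qed.

Lemma is_derive_derivable (V W : normedModType R) (f : V -> W) (x v : V) d :
  is_derive x v f d -> derivable f x v.
Proof. by move=> H; exact: @ex_derive _ _ _ _ _ _ _ H. Qed.

Lemma is_derive_exp V (g : V -> R) (x v : V) (b : R) :
  is_derive x v g b -> is_derive x v (fun y => expR (g y)) (expR (g x) * b).
Proof. exact: is_derive_chain (is_derive_expR (g x)). Qed.

Lemma is_derive_inv V (g : V -> R) (x v : V) (b : R) : g x != 0 ->
  is_derive x v g b -> is_derive x v (fun y => (g y)^-1) (- (g x) ^- 2 * b).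
Proof.
move=> g0 [dg <-]; apply: DeriveDef.
  exact: derivableV.
by rewrite (deriveV g0 dg).
Qed.

(** These rules are stated for pointwise expressions, the form in which explicit
    functions are given. *)
Lemma is_derive_mul V (f g : V -> R) (x v : V) (a b : R) :
  is_derive x v f a -> is_derive x v g b ->
  is_derive x v (fun y => f y * g y) (f x * b + a * g x).
Proof.
move=> Hf Hg; have := is_deriveM Hf Hg; rewrite [g x *: a]mulrC; exact.
Qed.

Lemma is_derive_add V (f g : V -> R) (x v : V) (a b : R) :
  is_derive x v f a -> is_derive x v g b ->
  is_derive x v (fun y => f y + g y) (a + b).
Proof. by move=> Hf Hg; exact: is_deriveD. Qed.

Lemma is_derive_opp V (f : V -> R) (x v : V) (a : R) :
  is_derive x v f a -> is_derive x v (fun y => - f y) (- a).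
Proof. by move=> Hf; exact: is_deriveN. Qed.

Lemma is_derive_sub V (f g : V -> R) (x v : V) (a b : R) :
  is_derive x v f a -> is_derive x v g b ->
  is_derive x v (fun y => f y - g y) (a - b).
Proof. by move=> Hf Hg; exact: is_deriveB. Qed.

Lemma is_derive_bigsum V n (f : 'I_n -> V -> R) (x v : V) (a : 'I_n -> R) :
  (forall i, is_derive x v (f i) (a i)) ->
  is_derive x v (fun y => \sum_i f i y) (\sum_i a i).
Proof.
move=> H; have := is_derive_sum H.
by rewrite (_ : \sum_i f i = fun y => \sum_i f i y) // funeqE => y; rewrite fct_sumE.
Qed.

Lemma cvg_bigsum (T : Type) (F : set_system T) (FF : Filter F) n (f : 'I_n -> T -> R) (a : 'I_n -> R) :
  (forall i, f i t @[t --> F] --> a i) ->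
  (\sum_i f i t) @[t --> F] --> \sum_i a i.
Proof.
elim: n f a => [|n IH] f a H.
  by under eq_cvg do rewrite big_ord0; rewrite big_ord0; exact: cvg_cst.
under eq_cvg do rewrite big_ord_recl; rewrite big_ord_recl.
by apply: cvgD; [exact: H | apply: IH].
Qed.

Lemma is_derive_cvg (V W : normedModType R) (f : V -> W) (x v : V) d :
  (h^-1 *: (f (h *: v + x) - f x)) @[h --> 0^'] --> d -> is_derive x v f d.
Proof.
move=> H; apply: DeriveDef; last by apply: cvg_lim.
by apply/cvg_ex; exists d.
Qed.

End DirectionalDerivatives.

Section PartialDerivatives.
Variable R : realType.
Notation V := 'rV[R]_4.
Implicit Types (f g : V -> R) (x y p : V) (i j k : 'I_4).

Lemma row_norm_le x (a : R) : 0 <= a -> (forall j, `|x 0 j| <= a) -> `|x| <= a.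
Proof.
move=> a0 H; have -> : `|x| = mx_norm x by [].
rewrite mx_normrE; by apply: bigmax_le => // -[i j] _ /=; rewrite (ord1 i).
Qed.

Lemma le_row_norm x j : `|x 0 j| <= `|x|.
Proof.
have -> : `|x| = mx_norm x by [].
rewrite mx_normrE.
exact: (@le_bigmax _ R _ 0 (fun i : 'I_1 * 'I_4 => `|x i.1 i.2|) (0, j)).
Qed.

Lemma partial_is_derive i f x d :
  is_derive x (delta_mx 0 i) f d -> partial i f x = d.
Proof. by case. Qed.

Lemma derivable_is_derive i f x : derivable f x (delta_mx 0 i) ->
  is_derive x (delta_mx 0 i) f (partial i f x).
Proof. by move=> H; apply: DeriveDef. Qed.

Lemma partial_mvt i f p (a : R) : (forall x, derivable f x (delta_mx 0 i)) ->
  exists2 s : R, `|s| <= `|a| &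
    f (a *: delta_mx 0 i + p) - f p = a * partial i f (s *: delta_mx 0 i + p).
Proof.
move=> Df; set v := delta_mx 0 i.
pose G (s : R) := f (s *: v + p); pose G' s := partial i f (s *: v + p).
have HG s : is_derive s (1 : R) G (G' s).
  exact: (iffLR (is_derive_line f p v s _) (derivable_is_derive (Df _))).
have cG (s : R) : {for s, continuous G}.
  by apply: differentiable_continuous; apply/derivable1_diffP; case: (HG s).
have cGw (A : set R) : {within A, continuous G}.
  by apply: continuous_subspaceT => s; exact: cG.
have G0 : G 0 = f p by rewrite /G scale0r add0r.
have [a0|a0] := leP 0 a.
  have [s] := MVT_segment a0 (fun s _ => HG s) (cGw _).
  rewrite in_itv /= => /andP[s0 sa] E; exists s.
    by rewrite !ger0_norm.
  by rewrite -G0 -[f _]/(G a) E subr0 mulrC.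
have [s] := MVT_segment (ltW a0) (fun s _ => HG s) (cGw _).
rewrite in_itv /= => /andP[sa s0] E; exists s.
  by rewrite !ler0_norm ?lerN2 // ltW.
by rewrite -G0 -[f _]/(G a) -opprB E sub0r mulrN opprK mulrC.
Qed.

(** Changing the coordinates one at a time reduces the increment of a function
    of four variables to four mean value theorems. *)
Lemma telescoping_mvt f x y : (forall i z, derivable f z (delta_mx 0 i)) ->
  exists xi : 'I_4 -> V,
    (forall k, `|xi k - x| <= `|y - x|) /\
    f y - f x = \sum_k partial k f (xi k) * (y 0 k - x 0 k).
Proof.
move=> Df.
pose p (m : nat) : V := \row_j (if (j < m)%N then y 0 j else x 0 j).
have pS (k : 'I_4) : p k.+1 = (y 0 k - x 0 k) *: delta_mx 0 k + p k.
  apply/rowP => j; rewrite !mxE eqxx /= ltnS leq_eqVlt.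
  case: (eqVneq j k) => [->|jk] /=; first by rewrite eqxx ltnn mulr1 subrK.
  by rewrite (negbTE jk : (j == k :> nat) = false) mulr0 add0r.
have H k : exists z : V, `|z - x| <= `|y - x| /\
    f (p k.+1) - f (p k) = partial k f z * (y 0 k - x 0 k).
  rewrite pS; have [s sa E] := partial_mvt (p k) (y 0 k - x 0 k) (Df k).
  exists (s *: delta_mx 0 k + p k); split; last by rewrite E mulrC.
  apply: row_norm_le => // j; rewrite !mxE eqxx /=.
  have N : `|y 0 j - x 0 j| <= `|y - x|.
    by have := le_row_norm (y - x) j; rewrite !mxE.
  case: (eqVneq j k) => [jk|jk] /=.
    subst j; rewrite ltnn mulr1 addrK (le_trans sa) //.
  rewrite mulr0 add0r; case: ifP => _ //.
  by rewrite subrr normr0.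
have [xi Hxi] := choice H; exists xi; split; first by move=> k; case: (Hxi k).
have -> : y = p 4 by apply/rowP => j; rewrite mxE ltn_ord.
rewrite -{1}(_ : p 0 = x); last by apply/rowP => j; rewrite mxE.
under eq_bigr => k _.
  rewrite [p 4 0 k](_ : _ = y 0 k); last by rewrite mxE ltn_ord.
  rewrite -(Hxi k).2; over.
by rewrite -(big_mkord xpredT (fun k : nat => f (p k.+1) - f (p k))) telescope_sumr.
Qed.

Definition C1 f := (forall i z, derivable f z (delta_mx 0 i)) /\
  (forall i, continuous (partial i f)).

(** The intermediate points of telescoping_mvt converge to the base point, where
    the partial derivatives are continuous. *)
Lemma is_derive_curve f (c : R -> V) (t : R) : C1 f -> derivable c t 1 ->
  is_derive t 1 (fun s => f (c s))
    (\sum_k partial k f (c t) * (derive1 c t) 0 k).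
Proof.
move=> [Df Cf] Dc.
have /choice[xi Hxi] := fun h : R => telescoping_mvt (c t) (c (h *: (1:R) + t)) Df.
have cc : c (h *: (1:R) + t) @[h --> (0:R)] --> c t.
  have := differentiable_continuous ((derivable1_diffP _ _).1 Dc).
  move=> ct; suff E : (h *: (1 : R) + t) @[h --> (0:R)] --> t by exact: cvg_comp E ct.
  rewrite -[X in _ --> X](_ : (0 : R) *: (1 : R) + t = t); last by rewrite scale0r add0r.
  by apply: cvgD; [apply: cvgZr_tmp; exact: cvg_id | exact: cvg_cst].
have xic k : xi h k @[h --> (0:R)^'] --> c t.
  apply/cvgrPdist_le => e e0.
  have /cvgrPdist_le/(_ e e0) := cc.
  move=> /(nbhs_dnbhs) H; near=> h.
  rewrite distrC (le_trans ((Hxi h).1 k)) // distrC.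
  by near: h.
apply: is_derive_cvg.
under eq_cvg do rewrite (Hxi _).2 scaler_sumr.
apply: cvg_bigsum => k.
under eq_cvg do rewrite [_ *: _]mulrCA.
apply: cvgM; first by apply: (cvg_comp _ _ (xic k)); exact: Cf.
have Hk := (derivable_mxP c t 1).1 Dc 0 k.
rewrite derive1E derive_mx // mxE; exact: Hk.
Unshelve. all: by end_near.
Qed.

Lemma row_norm_delta i (s : R) : `|s *: delta_mx 0 i : V| <= `|s|.
Proof.
apply: row_norm_le => // j; rewrite !mxE eqxx /= normrM.
by case: eqP => _; rewrite ?normr1 ?normr0 ?mulr1 ?mulr0.
Qed.

(** Two mean value theorems express the second difference quotient by either
    mixed derivative at a nearby point. *)
Lemma schwarz f i j x :
  (forall z, derivable f z (delta_mx 0 i)) ->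
  (forall z, derivable f z (delta_mx 0 j)) ->
  (forall z, derivable (partial i f) z (delta_mx 0 j)) ->
  (forall z, derivable (partial j f) z (delta_mx 0 i)) ->
  continuous (partial i (partial j f)) -> continuous (partial j (partial i f)) ->
  partial i (partial j f) x = partial j (partial i f) x.
Proof.
pose S a b (h : R) := f (h *: delta_mx 0 a + (h *: delta_mx 0 b + x))
  - f (h *: delta_mx 0 a + x) - f (h *: delta_mx 0 b + x) + f x.
have S_sym a b h : S a b h = S b a h by rewrite /S addrCA [_ - _ - _]addrAC.
have key a b : (forall z, derivable f z (delta_mx 0 a)) ->
    (forall z, derivable (partial a f) z (delta_mx 0 b)) ->
    forall h : R, exists2 z, `|z - x| <= `|h| + `|h| &
      S a b h = h * h * partial b (partial a f) z.
  move=> Da Dba h.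
  pose G z := f (h *: delta_mx 0 b + z) - f z.
  have HG z : is_derive z (delta_mx 0 a) G
      (partial a f (h *: delta_mx 0 b + z) - partial a f z).
    apply: is_derive_sub; last exact: derivable_is_derive.
    have := derivable_is_derive (Da (h *: delta_mx 0 b + z)).
    by move/is_derive_line0 => H; apply/is_derive_line0; move: H; under [X in is_derive _ _ X _]funext do rewrite addrCA.
  have [s sh E] := partial_mvt x h (fun z => is_derive_derivable (HG z)).
  have [s' sh' E'] := partial_mvt (s *: delta_mx 0 a + x) h Dba.
  exists (s' *: delta_mx 0 b + (s *: delta_mx 0 a + x)).
    rewrite addrA addrK (le_trans (ler_normD _ _)) // lerD //.
      by rewrite (le_trans (row_norm_delta _ _)).
    by rewrite (le_trans (row_norm_delta _ _)).
  move: E; rewrite (partial_is_derive (HG _)) E' mulrA => <-.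
  rewrite /G addrCA /S; move: (f _) (f _) (f _) (f _) => a1 a2 a3 a4; ring.
move=> Di Dj Dij Dji Cij Cji.
apply/eqP; rewrite -subr_eq0 -normr_le0; apply/ler_addgt0Pr => e e0; rewrite add0r.
have e2 : 0 < e / 2 by rewrite divr_gt0.
have /cvgrPdist_le/(_ _ e2)/nbhs_ballP[d1 /= d10 H1] := Cij x.
have /cvgrPdist_le/(_ _ e2)/nbhs_ballP[d2 /= d20 H2] := Cji x.
pose d := Num.min d1 d2; have d0 : 0 < d by rewrite lt_min d10.
pose h := d / 4; have h0 : 0 < h by rewrite divr_gt0.
have hd : `|h| + `|h| < d.
  by rewrite gtr0_norm // /h; lra.
have [z1 Z1 E1] := key i j Di Dij h.
have [z2 Z2 E2] := key j i Dj Dji h.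
have E : partial j (partial i f) z1 = partial i (partial j f) z2.
  have hh : h * h != 0 by rewrite mulf_neq0 ?gt_eqF.
  exact: (mulfI hh) (etrans (esym E1) (etrans (S_sym i j h) E2)).
have Z1' : ball x d2 z1.
  rewrite -ball_normE /ball_ /= distrC; apply: le_lt_trans Z1 _.
  by apply: lt_le_trans hd _; rewrite ge_min lexx orbT.
have Z2' : ball x d1 z2.
  rewrite -ball_normE /ball_ /= distrC; apply: le_lt_trans Z2 _.
  by apply: lt_le_trans hd _; rewrite ge_min lexx.
have := H2 _ Z1'; have := H1 _ Z2'; rewrite /= E.
move: (partial i _ x) (partial j _ x) (partial i _ z2) => a b z B1 B2.
rewrite (_ : a - b = (a - z) - (b - z)); last by ring.
apply: le_trans (ler_normB _ _) _; rewrite [leRHS]splitr; exact: lerD.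
Qed.

End PartialDerivatives.

(** * Smooth functions and smooth families *)

Lemma cvg_to_within (T U : Type) (F : set_system T) {FF : Filter F} (G : set_system U)
  (D : set U) (f : T -> U) : f @ F --> G -> F (f @^-1` D) -> f @ F --> within D G.
Proof.
move=> H FD A GA; have := H _ GA; rewrite /= /fmap /=.
by apply: filterS2 FD => t Dft; apply.
Qed.

Section SmoothFamilies.
Variable R : realType.
Notation V := 'rV[R]_4.
Implicit Types (I : set R) (F G : R -> V -> R) (S : set (R -> V -> R)).

Definition jointly_continuous I F :=
  {within [set p : R * V | I p.1], continuous (fun p : R * V => F p.1 p.2)}.

Definition smooth_family I F := forall s : seq 'I_4,
  jointly_continuous I (fun t => partials s (F t)) /\
  forall i t x, I t -> derivable (partials s (F t)) x (delta_mx 0 i).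

Lemma jointly_continuousP I F : jointly_continuous I F <->
  forall t x, I t -> F p.1 p.2 @[p --> within [set p : R * V | I p.1] (nbhs (t, x))] --> F t x.
Proof.
rewrite /jointly_continuous; split.
  by move=> /subspace_continuousP H t x It; apply: (H (t, x)).
by move=> H; apply/subspace_continuousP => -[t x] It; apply: H.
Qed.

Lemma eq_jointly_continuous I F G : (forall t x, I t -> F t x = G t x) ->
  jointly_continuous I F -> jointly_continuous I G.
Proof.
move=> E /jointly_continuousP H; apply/jointly_continuousP => t x It.
rewrite -E //; apply: cvg_trans (H t x It); apply: near_eq_cvg.
by rewrite near_withinE; near=> p => Ip; rewrite E.
Unshelve. all: by end_near.
Qed.

Lemma jointly_continuous_slice I F t : I t -> jointly_continuous I F -> continuous (F t).
Proof.
move=> It /jointly_continuousP H x.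
have E : (t, y) @[y --> x] --> within [set p : R * V | I p.1] (nbhs (t, x)).
  have FF := nbhs_filter x; apply: cvg_to_within; last exact: (filterE FF).
  move=> A [[B C] /= [B1 C1] sub]; rewrite /fmap /=.
  by apply: filterS C1 => y Cy; apply: sub; split => //=; exact: nbhs_singleton.
exact: cvg_comp E (H t x It).
Qed.

(** This class is stable under partial derivatives as soon as it contains the
    partial derivatives of its generators. *)
Inductive generated I S : (R -> V -> R) -> Prop :=
| generated_gen F : S F -> generated I S F
| generated_cst (a : R -> R) : {within I, continuous a} -> generated I S (fun t _ => a t)
| generated_add F G : generated I S F -> generated I S G ->
    generated I S (fun t x => F t x + G t x)
| generated_mul F G : generated I S F -> generated I S G ->
    generated I S (fun t x => F t x * G t x)
| generated_exp F : generated I S F -> generated I S (fun t x => expR (F t x))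
| generated_inv F : generated I S F -> (forall t x, I t -> F t x != 0) ->
    generated I S (fun t x => (F t x)^-1).

Section Closure.
Variables (I : set R) (S : set (R -> V -> R)).
Hypothesis SC : forall F, S F -> jointly_continuous I F.
Hypothesis SD : forall F i, S F -> exists2 G, generated I S G &
  forall t x, I t -> is_derive x (delta_mx 0 i) (F t) (G t x).

Lemma generated_continuous F : generated I S F -> jointly_continuous I F.
Proof.
elim=> {F} [F /SC//|a ca|F G _ HF _ HG|F G _ HF _ HG|F _ HF|F _ HF F0].
- apply/jointly_continuousP => t x It.
  have := (iffLR (subspace_continuousP I a) ca) t It.
  suff E : p.1 @[p --> within [set p : R * V | I p.1] (nbhs (t, x))] --> within I (nbhs t).
    exact: cvg_comp E.
  apply: cvg_to_within; first by apply: cvg_within_filter; exact: cvg_fst.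
  by have FF := nbhs_filter (t, x); rewrite /within /=; apply: (filterE FF).
all: apply/jointly_continuousP => t x It.
- by apply: cvgD; [move/jointly_continuousP: HF|move/jointly_continuousP: HG]; apply.
- by apply: cvgM; [move/jointly_continuousP: HF|move/jointly_continuousP: HG]; apply.
- move/jointly_continuousP: HF => /(_ t x It) H.
  exact: (cvg_comp _ _ H (@continuous_expR _ _)).
- by apply: cvgV; [exact: F0 | move/jointly_continuousP: HF; apply].
Qed.

Lemma generated_derive F i : generated I S F -> exists2 G, generated I S G &
  forall t x, I t -> is_derive x (delta_mx 0 i) (F t) (G t x).
Proof.
elim=> {F} [F /SD//|a ca|F G HF [F' F'1 F'2] HG [G' G'1 G'2]|
  F G HF [F' F'1 F'2] HG [G' G'1 G'2]|F HF [F' F'1 F'2]|F HF [F' F'1 F'2] F0].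
- exists (fun t _ => (fun=> 0) t); last by move=> t x _; exact: is_derive_cst.
  by apply: generated_cst; apply: continuous_subspaceT => t; exact: cvg_cst.
- exists (fun t x => F' t x + G' t x); first exact: generated_add.
  by move=> t x It; apply: is_derive_add; [apply: F'2|apply: G'2].
- exists (fun t x => F t x * G' t x + F' t x * G t x).
    by apply: generated_add; apply: generated_mul.
  by move=> t x It; apply: is_derive_mul; [apply: F'2|apply: G'2].
- exists (fun t x => expR (F t x) * F' t x).
    by apply: generated_mul => //; exact: generated_exp.
  move=> t x It; exact: (is_derive_chain (is_derive_expR _) (F'2 _ _ It)).
- exists (fun t x => (fun=> -1) t * ((F t x)^-1 * (F t x)^-1) * F' t x).
    apply: generated_mul => //; apply: generated_mul.
      by apply: generated_cst; apply: continuous_subspaceT => t; exact: cvg_cst.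
    by apply: generated_mul; apply: generated_inv.
  move=> t x It; rewrite mulN1r -invfM -expr2; apply: is_derive_inv; [exact: F0|exact: F'2].
Qed.

(** Since the class of generated functions is stable under partial
    derivatives, its members can be differentiated indefinitely. *)
Lemma generated_smooth F : generated I S F -> smooth_family I F.
Proof.
move=> HF s.
suff [G HG E] : exists2 G, generated I S G & forall t, I t -> partials s (F t) = G t.
  split.
    apply: eq_jointly_continuous (generated_continuous HG) => t x It.
    by rewrite E.
  move=> i t x It; rewrite E //.
  have [G' _ H] := generated_derive i HG; exact: is_derive_derivable (H t x It).
elim: s => [|i s [G HG E]]; first by exists F.
have [G' HG' H] := generated_derive i HG; exists G' => // t It.
rewrite /= E //; apply/funext => x; exact: partial_is_derive (H t x It).
Qed.

End Closure.

Lemma smooth_familyW I F t : I t -> smooth_family I F -> smooth (F t).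
Proof.
move=> It H s; have [C D] := H s; split; last by move=> i x; exact: D.
exact: (@jointly_continuous_slice I (fun t => partials s (F t))).
Qed.

Lemma smooth_family_continuous I F : smooth_family I F -> continuous_family I F.
Proof. by move=> H s; have [C _] := H s. Qed.

End SmoothFamilies.

Section SmoothFunctions.
Variable R : realType.
Notation V := 'rV[R]_4.
Implicit Types (f g : V -> R) (i j : 'I_4).

Lemma smooth_derivable f i x : smooth f -> derivable f x (delta_mx 0 i).
Proof. by move=> H; have [_ D] := H [::]; exact: D. Qed.

Lemma smooth_is_derive f i x : smooth f -> is_derive x (delta_mx 0 i) f (partial i f x).
Proof. by move=> sf; apply: derivable_is_derive; exact: smooth_derivable sf. Qed.

Lemma smooth_continuous f : smooth f -> continuous f.
Proof. by move=> H; have [C _] := H [::]. Qed.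

Lemma smooth_partial f i : smooth f -> smooth (partial i f).
Proof. by move=> H s; have := H (rcons s i); rewrite /partials foldr_rcons. Qed.

Lemma smooth_C1 f : smooth f -> C1 f.
Proof.
move=> H; split=> [i z|i]; first exact: smooth_derivable.
exact: smooth_continuous (smooth_partial i H).
Qed.

Lemma partialC f i j x : smooth f -> partial i (partial j f) x = partial j (partial i f) x.
Proof.
move=> H; have S k := smooth_partial k H; have SS k l := smooth_partial k (S l).
have D k : forall z, derivable f z (delta_mx 0 k) by move=> z; exact: smooth_derivable.
have DD k l : forall z, derivable (partial k f) z (delta_mx 0 l).
  by move=> z; exact: smooth_derivable (S k).
have C k l : continuous (partial k (partial l f)) by exact: smooth_continuous (SS k l).
exact: (@schwarz R f i j x (D i) (D j) (DD i j) (DD j i) (C i j) (C j i)).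
Qed.

(** Single functions are treated as families that do not depend on the
    parameter, so that closure of smoothness under ring operations is a case
    of closure for generated families. *)
Definition smooth_gen : set (R -> V -> R) := [set F | exists2 f, smooth f & F = fun=> f].

Lemma smooth_generated F t : generated setT smooth_gen F -> smooth (F t).
Proof.
move=> H; apply: (@smooth_familyW _ setT) => //; apply: generated_smooth H.
  move=> _ [f sf ->]; apply/jointly_continuousP => s x _.
  suff E : p.2 @[p --> within [set p : R * V | setT p.1] (nbhs (s, x))] --> x.
    exact: cvg_comp E (@smooth_continuous _ sf x).
  by apply: cvg_within_filter; exact: cvg_snd.
move=> _ i [f sf ->]; exists (fun=> partial i f).
  by apply: generated_gen; exists (partial i f); [exact: smooth_partial sf|].
by move=> s x _; apply: derivable_is_derive; exact: smooth_derivable.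
Qed.

Lemma generated_smooth_gen f : smooth f -> generated setT smooth_gen (fun=> f).
Proof. by move=> sf; apply: generated_gen; exists f. Qed.

Lemma smooth_cst (a : R) : smooth (fun _ : V => a).
Proof.
apply: (@smooth_generated (fun _ _ => (fun=> a) (0 : R)) 0); apply: generated_cst.
by apply: continuous_subspaceT => t; exact: cvg_cst.
Qed.

Lemma smoothD f g : smooth f -> smooth g -> smooth (fun x => f x + g x).
Proof.
move=> sf sg; apply: (@smooth_generated (fun _ x => f x + g x) 0).
exact: generated_add (generated_smooth_gen sf) (generated_smooth_gen sg).
Qed.

Lemma smoothM f g : smooth f -> smooth g -> smooth (fun x => f x * g x).
Proof.
move=> sf sg; apply: (@smooth_generated (fun _ x => f x * g x) 0).
exact: generated_mul (generated_smooth_gen sf) (generated_smooth_gen sg).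
Qed.

Lemma smoothN f : smooth f -> smooth (fun x => - f x).
Proof.
move=> sf; rewrite (_ : (fun _ => _) = fun x => -1 * f x).
  exact: smoothM (smooth_cst _) sf.
by apply/funext => x; rewrite mulN1r.
Qed.

Lemma smoothB f g : smooth f -> smooth g -> smooth (fun x => f x - g x).
Proof. by move=> sf sg; exact: smoothD sf (smoothN sg). Qed.

Lemma smooth_sum n (f : 'I_n -> V -> R) : (forall k, smooth (f k)) ->
  smooth (fun x => \sum_i f i x).
Proof.
elim: n f => [|n IH] f H.
  rewrite (_ : (fun _ => _) = fun=> 0); first exact: smooth_cst.
  by apply/funext => x; rewrite big_ord0.
rewrite (_ : (fun _ => _) = fun x => f ord0 x + \sum_(i < n) f (lift ord0 i) x).
  by apply: smoothD (H _) (IH _ _) => k; exact: H.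
by apply/funext => x; rewrite big_ord_recl.
Qed.

Lemma partialD f g i x : smooth f -> smooth g ->
  partial i (fun y => f y + g y) x = partial i f x + partial i g x.
Proof.
move=> sf sg; apply: partial_is_derive.
exact: is_derive_add (smooth_is_derive _ _ sf) (smooth_is_derive _ _ sg).
Qed.

Lemma partialN f i x : smooth f -> partial i (fun y => - f y) x = - partial i f x.
Proof.
move=> sf; apply: partial_is_derive; exact: is_derive_opp (smooth_is_derive _ _ sf).
Qed.

Lemma partialB f g i x : smooth f -> smooth g ->
  partial i (fun y => f y - g y) x = partial i f x - partial i g x.
Proof. by move=> sf sg; rewrite (partialD _ _ sf (smoothN sg)) partialN. Qed.

Lemma partialM f g i x : smooth f -> smooth g ->
  partial i (fun y => f y * g y) x = f x * partial i g x + partial i f x * g x.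
Proof.
move=> sf sg; apply: partial_is_derive.
exact: is_derive_mul (smooth_is_derive _ _ sf) (smooth_is_derive _ _ sg).
Qed.

Lemma partial_cst (a : R) i x : partial i (fun _ : V => a) x = 0.
Proof. by apply: partial_is_derive; exact: is_derive_cst. Qed.

Lemma partialZ (a : R) f i x : smooth f ->
  partial i (fun y => a * f y) x = a * partial i f x.
Proof. by move=> sf; rewrite (partialM _ _ (smooth_cst a) sf) partial_cst mul0r addr0. Qed.

Lemma partial_sum n (f : 'I_n -> V -> R) i x : (forall k, smooth (f k)) ->
  partial i (fun y => \sum_k f k y) x = \sum_k partial i (f k) x.
Proof.
move=> sf; apply: partial_is_derive; apply: is_derive_bigsum => k.
exact: smooth_is_derive.
Qed.

Lemma is_derive_coord i j x : is_derive x (delta_mx 0 i) (fun y : V => y 0 j) ((i == j)%:R : R).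
Proof.
apply: is_derive_cvg.
apply: (@cvg_trans _ (fmap (fun=> (i == j)%:R) (nbhs (0 : R)^'))); last exact: cvg_cst.
apply: near_eq_cvg; near=> h.
rewrite !mxE addrK eqxx eq_sym /= [_ *: _]mulrA mulVf ?mul1r //.
near: h; exact: nbhs_dnbhs_neq.
Unshelve. all: by end_near.
Qed.

Lemma partial_coord i j x : partial i (fun y : V => y 0 j) x = (i == j)%:R :> R.
Proof. exact: partial_is_derive (is_derive_coord i j x). Qed.

Lemma smooth_coord j : smooth (fun y : V => y 0 j).
Proof.
suff H s : (partials s (fun y : V => y 0 j) = fun y => y 0 j) \/
    exists a : R, partials s (fun y : V => y 0 j) = fun=> a.
  move=> s; have [->|[a ->]] := H s.
    split; first by move=> x; exact: coord_continuous.
    by move=> i x; exact: is_derive_derivable (is_derive_coord i j x).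
  by split=> [|i x]; [move=> x; exact: cst_continuous|exact: derivable_cst].
elim: s => [|i s [E|[a E]]].
- by left; rewrite /partials.
- right; exists (i == j)%:R; rewrite /= E; apply/funext => x; exact: partial_coord.
- right; exists 0; rewrite /= E; apply/funext => x; exact: partial_cst.
Qed.

End SmoothFunctions.

(** * Complex structure and matrix fields *)

Section ComplexStructure.
Variable R : realType.
Notation J := (@Jmx R).

Lemma JmxT : J^T = - J.
Proof.
apply/matrixP => -[[|[|[|[|i]]]] Hi] // -[[|[|[|[|j]]]] Hj] //;
  rewrite !mxE /=; rewrite ?oppr0 ?opprK //.
Qed.

Lemma JmxJ : J *m J = - 1%:M.
Proof.
apply/matrixP => -[[|[|[|[|i]]]] Hi] // -[[|[|[|[|j]]]] Hj] //;
  rewrite !mxE !big_ord_recl big_ord0 !mxE /= ?mulr0n; ring.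
Qed.

Lemma JmxJA m (M : 'M[R]_(m, 4)) : M *m J *m J = - M.
Proof. by rewrite -mulmxA JmxJ mulmxN mulmx1. Qed.

Lemma JmxAJ m (M : 'M[R]_(4, m)) : J *m (J *m M) = - M.
Proof. by rewrite mulmxA JmxJ mulNmx mul1mx. Qed.

Lemma Jmx_invariant_comm (M : 'M[R]_4) : J *m M *m J^T = M -> J *m M = M *m J.
Proof. by rewrite JmxT mulmxN => {2}<-; rewrite mulNmx JmxJA opprK. Qed.

End ComplexStructure.

Section MatrixFields.
Variable R : realType.
Notation V := 'rV[R]_4.
Implicit Types (M N : V -> 'M[R]_4) (a b x : V) (i j k : 'I_4).

Definition smooth_mx M := forall j k, smooth (fun x => M x j k).

Definition partial_mx i M x : 'M[R]_4 := \matrix_(j, k) partial i (fun y => M y j k) x.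

Definition derive_mxv a M x : 'M[R]_4 := \sum_i a 0 i *: partial_mx i M x.

Lemma smooth_mx_cst (A : 'M[R]_4) : smooth_mx (fun=> A).
Proof. by move=> j k; exact: smooth_cst. Qed.

Lemma smooth_mxM M N : smooth_mx M -> smooth_mx N -> smooth_mx (fun x => M x *m N x).
Proof.
move=> sM sN j k; rewrite (_ : (fun _ => _) = fun x => \sum_l M x j l * N x l k).
  by apply: smooth_sum => l; exact: smoothM (sM j l) (sN l k).
by apply/funext => x; rewrite mxE.
Qed.

Lemma smooth_mxD M N : smooth_mx M -> smooth_mx N -> smooth_mx (fun x => M x + N x).
Proof.
move=> sM sN j k; rewrite (_ : (fun _ => _) = fun x => M x j k + N x j k).
  exact: smoothD (sM j k) (sN j k).
by apply/funext => x; rewrite mxE.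
Qed.

Lemma smooth_mxZ (r : R) M : smooth_mx M -> smooth_mx (fun x => r *: M x).
Proof.
move=> sM j k; rewrite (_ : (fun _ => _) = fun x => r * M x j k).
  exact: smoothM (smooth_cst r) (sM j k).
by apply/funext => x; rewrite mxE.
Qed.

Lemma partial_mx_entry i M x k l : partial_mx i M x k l = partial i (fun y => M y k l) x.
Proof. by rewrite mxE. Qed.

Lemma partial_mxE i M k l : (fun y => partial_mx i M y k l) = partial i (fun y => M y k l).
Proof. by apply/funext => y; rewrite mxE. Qed.

Lemma smooth_partial_mx i M : smooth_mx M -> smooth_mx (partial_mx i M).
Proof.
by move=> sM j k; rewrite partial_mxE; exact: smooth_partial (sM j k).
Qed.

Lemma smooth_mx_sum n (F : 'I_n -> V -> 'M[R]_4) : (forall l, smooth_mx (F l)) ->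
  smooth_mx (fun x => \sum_l F l x).
Proof.
move=> sF j k; rewrite (_ : (fun _ => _) = fun x => \sum_l F l x j k).
  by apply: smooth_sum => l; exact: sF.
by apply/funext => x; rewrite summxE.
Qed.

Lemma smooth_derive_mxv a M : smooth_mx M -> smooth_mx (derive_mxv a M).
Proof.
by move=> sM; apply: smooth_mx_sum => i; apply: smooth_mxZ; exact: smooth_partial_mx.
Qed.

Lemma partial_mxD i M N x : smooth_mx M -> smooth_mx N ->
  partial_mx i (fun y => M y + N y) x = partial_mx i M x + partial_mx i N x.
Proof.
move=> sM sN; apply/matrixP => j k; rewrite !mxE.
rewrite (_ : (fun _ => _) = fun y => M y j k + N y j k).
  exact: partialD (sM j k) (sN j k).
by apply/funext => y; rewrite mxE.
Qed.

Lemma partial_mxZ i (r : R) M x : smooth_mx M ->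
  partial_mx i (fun y => r *: M y) x = r *: partial_mx i M x.
Proof.
move=> sM; apply/matrixP => j k; rewrite !mxE.
rewrite (_ : (fun _ => _) = fun y => r * M y j k).
  exact: partialZ _ _ _ (sM j k).
by apply/funext => y; rewrite mxE.
Qed.

Lemma partial_mxM i M N x : smooth_mx M -> smooth_mx N ->
  partial_mx i (fun y => M y *m N y) x = partial_mx i M x *m N x + M x *m partial_mx i N x.
Proof.
move=> sM sN; apply/matrixP => j k; rewrite !mxE.
rewrite (_ : (fun _ => _) = fun y => \sum_l M y j l * N y l k); last first.
  by apply/funext => y; rewrite mxE.
rewrite partial_sum; last by move=> l; exact: smoothM (sM j l) (sN l k).
rewrite -big_split; apply: eq_bigr => l _; rewrite /= !mxE.
by rewrite (partialM _ _ (sM j l) (sN l k)) addrC.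
Qed.

Lemma partial_mx_cst i (A : 'M[R]_4) x : partial_mx i (fun=> A) x = 0.
Proof. by apply/matrixP => j k; rewrite !mxE partial_cst. Qed.

Lemma partial_mx_sum n i (F : 'I_n -> V -> 'M[R]_4) x : (forall l, smooth_mx (F l)) ->
  partial_mx i (fun y => \sum_l F l y) x = \sum_l partial_mx i (F l) x.
Proof.
move=> sF; apply/matrixP => j k; rewrite mxE summxE.
rewrite (_ : (fun _ => _) = fun y => \sum_l F l y j k); last first.
  by apply/funext => y; rewrite summxE.
rewrite partial_sum => [|l]; last exact: sF.
by apply: eq_bigr => l _; rewrite mxE.
Qed.

Lemma partial_mxC i j M x : smooth_mx M ->
  partial_mx i (partial_mx j M) x = partial_mx j (partial_mx i M) x.
Proof.
move=> sM; apply/matrixP => k l.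
apply: etrans (partial_mx_entry i (partial_mx j M) x k l) _.
apply: etrans _ (esym (partial_mx_entry j (partial_mx i M) x k l)).
rewrite (partial_mxE j M) (partial_mxE i M); exact: partialC (sM k l).
Qed.

Lemma derive_mxvE a M x j k :
  derive_mxv a M x j k = \sum_i a 0 i * partial i (fun y => M y j k) x.
Proof. by rewrite summxE; apply: eq_bigr => i _; rewrite mxE partial_mx_entry. Qed.

Lemma derive_mxv_delta i M x : derive_mxv (delta_mx 0 i) M x = partial_mx i M x.
Proof.
rewrite /derive_mxv (bigD1 i) //= mxE !eqxx scale1r big1 ?addr0 // => j ji.
by rewrite mxE (negbTE ji) andbF scale0r.
Qed.

Lemma derive_mxvD a M N x : smooth_mx M -> smooth_mx N ->
  derive_mxv a (fun y => M y + N y) x = derive_mxv a M x + derive_mxv a N x.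
Proof.
move=> sM sN; rewrite /derive_mxv -big_split; apply: eq_bigr => i _.
by rewrite partial_mxD // scalerDr.
Qed.

Lemma derive_mxvZ a (r : R) M x : smooth_mx M ->
  derive_mxv a (fun y => r *: M y) x = r *: derive_mxv a M x.
Proof.
move=> sM; rewrite /derive_mxv scaler_sumr; apply: eq_bigr => i _.
by rewrite partial_mxZ // !scalerA mulrC.
Qed.

Lemma derive_mxvM a M N x : smooth_mx M -> smooth_mx N ->
  derive_mxv a (fun y => M y *m N y) x = derive_mxv a M x *m N x + M x *m derive_mxv a N x.
Proof.
move=> sM sN; rewrite /derive_mxv mulmx_suml mulmx_sumr -big_split; apply: eq_bigr => i _.
by rewrite partial_mxM // scalerDr -scalemxAl -scalemxAr.
Qed.

Lemma derive_mxv_cstM a (A : 'M[R]_4) M x : smooth_mx M ->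
  derive_mxv a (fun y => A *m M y) x = A *m derive_mxv a M x.
Proof.
move=> sM; rewrite (derive_mxvM a x (smooth_mx_cst A) sM).
rewrite [derive_mxv a (fun=> A) x]big1 ?mul0mx ?add0r // => i _.
by rewrite partial_mx_cst scaler0.
Qed.

Lemma derive_mxvMcst a (A : 'M[R]_4) M x : smooth_mx M ->
  derive_mxv a (fun y => M y *m A) x = derive_mxv a M x *m A.
Proof.
move=> sM; rewrite (derive_mxvM a x sM (smooth_mx_cst A)).
rewrite [derive_mxv a (fun=> A) x]big1 ?mulmx0 ?addr0 // => i _.
by rewrite partial_mx_cst scaler0.
Qed.

Lemma derive_mxvC a b M x : smooth_mx M ->
  derive_mxv a (derive_mxv b M) x = derive_mxv b (derive_mxv a M) x.
Proof.
move=> sM; rewrite /derive_mxv.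
under eq_bigr => i _.
  rewrite partial_mx_sum => [|j]; last by apply: smooth_mxZ; exact: smooth_partial_mx.
  rewrite scaler_sumr.
  under eq_bigr => j _ do rewrite (partial_mxZ i (b 0 j) x (smooth_partial_mx j sM)) scalerA.
  over.
rewrite exchange_big; apply: eq_bigr => j _.
rewrite partial_mx_sum => [|i]; last by apply: smooth_mxZ; exact: smooth_partial_mx.
rewrite scaler_sumr; apply: eq_bigr => i _.
by rewrite (partial_mxZ j (a 0 i) x (smooth_partial_mx i sM)) scalerA mulrC (partial_mxC i j x sM).
Qed.

Lemma eq_derive_mxv a M N x : (forall y, M y = N y) -> derive_mxv a M x = derive_mxv a N x.
Proof. by move=> E; rewrite (_ : M = N) //; apply/funext. Qed.

End MatrixFields.

(** * The Ricci form of a Kahler metric *)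

Section KahlerRicci.
Variable R : realType.
Notation V := 'rV[R]_4.
Notation J := (@Jmx R).
Notation e i := (delta_mx 0 i : V).
Notation D := (@derive_mxv R).
Implicit Types (M N : V -> 'M[R]_4) (a b x : V) (i j k l : 'I_4).

Lemma mulmxZr (r : R) (A B : 'M[R]_4) : A *m (r *: B) = r *: (A *m B).
Proof. by rewrite -scalemxAr. Qed.

Lemma mulmxZl (r : R) (A B : 'M[R]_4) : (r *: A) *m B = r *: (A *m B).
Proof. by rewrite -scalemxAl. Qed.

Lemma del_swap (K X Y Z W : 'M[R]_4) :
  2^-1 *: (X - K *m Y) - K *m (2^-1 *: (Z - K *m W)) =
  2^-1 *: (X - K *m Z) - K *m (2^-1 *: (Y - K *m W)).
Proof.
rewrite !mulmxZr -!scalerBr !mulmxBr; congr (_ *: _).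
by rewrite !opprB addrACA [RHS]addrACA; congr (_ + _); exact: addrC.
Qed.

Lemma cancel_conn (A N B G H : 'M[R]_4) : G *m H = 1%:M ->
  (A *m G + N *m B) *m H - N *m (B *m H) = A.
Proof. by move=> GH; rewrite mulmxDl -!mulmxA GH mulmx1 addrK. Qed.

Lemma subr_swap (A B C : 'M[R]_4) : (A - B) - (A - C) = C - B.
Proof. by rewrite opprB addrC addrA subrK. Qed.

Lemma add_swap (P Q S T : 'M[R]_4) : (P + Q) - (S + T) + (S - P) = Q - T.
Proof. by apply/matrixP => i j; rewrite !mxE; ring. Qed.

Lemma submxE (P Q : 'M[R]_4) i j : (P - Q) i j = P i j - Q i j.
Proof. by rewrite !mxE. Qed.

(** The form with matrix J B is antisymmetric and the inverse metric H is
    symmetric. *)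
Lemma trace_Jsym (B H : 'M[R]_4) : B^T = B -> H^T = H ->
  J *m B = B *m J -> J *m H = H *m J -> \tr (J *m (B *m H)) = 0.
Proof.
move=> BT HT BJ HJ; have E : \tr (J *m (B *m H)) = - \tr (J *m (B *m H)).
  rewrite -[in LHS]mxtrace_tr !trmx_mul BT HT JmxT mulmxN raddfN /=.
  by rewrite -mulmxA -BJ mxtrace_mulC mulmxA.
by move: E; set t := \tr _; lra.
Qed.

Lemma Jmx_sumJ j (F : 'I_4 -> R) : \sum_a J j a * (\sum_l J a l * F l) = - F j.
Proof.
have := JmxAJ (\col_l F l) => /matrixP/(_ j 0).
rewrite mxE [in RHS]mxE [in RHS]mxE => <-; apply: eq_bigr => a _; congr (_ * _).
by rewrite [RHS]mxE; apply: eq_bigr => l _; congr (_ * _); rewrite mxE.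
Qed.

Lemma ddcE (f : V -> R) x j k : smooth f -> ddc f x j k =
  \sum_l J j l * partial k (partial l f) x - \sum_l J k l * partial j (partial l f) x.
Proof.
move=> sf; have E p q : partial p (dc f q) x = - \sum_l J q l * partial p (partial l f) x.
  have sl l : smooth (fun y => J q l * partial l f y).
    exact: smoothM (smooth_cst _) (smooth_partial l sf).
  rewrite /dc (partialN _ _ (smooth_sum sl)) (partial_sum _ _ sl); congr (- _).
  by apply: eq_bigr => l _; rewrite (partialZ _ _ _ (smooth_partial l sf)).
by rewrite mxE !E opprK addrC.
Qed.

Opaque Jmx partial partial_mx derive_mxv smooth smooth_mx.

Lemma smooth_mx_cstM (A : 'M[R]_4) M : smooth_mx M -> smooth_mx (fun x => A *m M x).
Proof. exact: smooth_mxM (smooth_mx_cst A). Qed.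

(** The parts of the derivative of a matrix field that are complex linear and
    complex antilinear in the direction a, for the complex structure on
    matrices given by left multiplication by J. *)
Definition del a M x : 'M[R]_4 := 2^-1 *: (D a M x - J *m D (a *m J) M x).
Definition delbar a M x : 'M[R]_4 := 2^-1 *: (D a M x + J *m D (a *m J) M x).

Lemma delE a M x : del a M x = 2^-1 *: (D a M x - J *m D (a *m J) M x).
Proof. by []. Qed.

Lemma del_delbar a M x : del a M x + delbar a M x = D a M x.
Proof.
rewrite /del /delbar -scalerDr addrACA addNr addr0 scalerDr -scalerDl.
by rewrite (_ : 2^-1 + 2^-1 = 1) ?scale1r //; field.
Qed.

Lemma smooth_del a M : smooth_mx M -> smooth_mx (del a M).
Proof.
move=> sM; have sD b := smooth_derive_mxv b sM.
rewrite (_ : del a M = fun x => 2^-1 *: (D a M x + (- J) *m D (a *m J) M x)).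
  exact: smooth_mxZ (smooth_mxD (sD _) (smooth_mx_cstM _ (sD _))).
by apply/funext => x; rewrite /del mulNmx.
Qed.

Definition Jcommuting M := forall x, J *m M x = M x *m J.

Lemma Jcommuting_derive a M x : smooth_mx M -> Jcommuting M ->
  J *m D a M x = D a M x *m J.
Proof.
move=> sM cM; rewrite -(derive_mxv_cstM a J x sM) -(derive_mxvMcst a J x sM).
exact: eq_derive_mxv.
Qed.

Lemma Jcommuting_del a M : smooth_mx M -> Jcommuting M -> Jcommuting (del a M).
Proof.
move=> sM cM x; rewrite /del mulmxZr mulmxZl mulmxBr mulmxBl.
by rewrite -mulmxA -!Jcommuting_derive.
Qed.

Lemma delM a M N x : smooth_mx M -> smooth_mx N -> Jcommuting M ->
  del a (fun y => M y *m N y) x = del a M x *m N x + M x *m del a N x.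
Proof.
move=> sM sN cM; rewrite /del !derive_mxvM // mulmxZl mulmxZr -scalerDr.
congr (_ *: _); rewrite mulmxBl mulmxBr mulmxDr !mulmxA cM opprD !addrA.
by congr (_ + _); rewrite -!addrA; congr (_ + _); rewrite addrC.
Qed.

Lemma delbar_entry a M x i l :
  delbar a M x i l = 2^-1 * (D a M x i l + (J *m D (a *m J) M x) i l).
Proof. by rewrite mxE; congr (_ * _); rewrite mxE. Qed.

Opaque del delbar.

Lemma delC a b M x : smooth_mx M -> del a (del b M) x = del b (del a M) x.
Proof.
move=> sM; have sD c := smooth_derive_mxv c sM.
have E c d : D c (del d M) x = 2^-1 *: (D c (D d M) x - J *m D c (D (d *m J) M) x).
  rewrite (eq_derive_mxv c (N := fun x => 2^-1 *: (D d M x + (- J) *m D (d *m J) M x))).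
    have sJ := smooth_mx_cstM (- J) (sD (d *m J)).
    rewrite (derive_mxvZ _ _ _ (smooth_mxD (sD d) sJ)) (derive_mxvD _ _ (sD d) sJ).
    by rewrite (derive_mxv_cstM _ _ _ (sD (d *m J))) mulNmx.
  by move=> y; rewrite delE mulNmx.
rewrite (delE a (del b M)).
rewrite (delE b (del a M)).
rewrite (E a b) (E b a).
rewrite (E (a *m J) b).
rewrite (E (b *m J) a).
rewrite (derive_mxvC a b x sM) (derive_mxvC (a *m J) (b *m J) x sM).
rewrite (derive_mxvC a (b *m J) x sM) (derive_mxvC (a *m J) b x sM).
apply: congr1; exact: del_swap.
Qed.

Section Metric.
Variables (g h : V -> 'M[R]_4).
Hypotheses (sg : smooth_mx g) (sh : smooth_mx h).
Hypothesis gh : forall x, g x *m h x = 1%:M.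
Hypothesis gT : forall x, (g x)^T = g x.
Hypothesis gJ : forall x, J *m g x *m J^T = g x.
Hypothesis g_closed : closed2 (kform g).

Lemma metric_inverse x : h x *m g x = 1%:M.
Proof. exact: mulmx1C (gh x). Qed.

Lemma invmx_metric x : invmx (g x) = h x.
Proof.
have gU : g x \in unitmx by have [] := mulmx1_unit (gh x).
by rewrite -[RHS]mul1mx -(mulVmx gU) -mulmxA gh mulmx1.
Qed.

Lemma inverse_sym x : (h x)^T = h x.
Proof. by rewrite -invmx_metric trmx_inv gT. Qed.

Lemma Jcommuting_metric : Jcommuting g.
Proof. by move=> x; exact: Jmx_invariant_comm. Qed.

Lemma Jcommuting_inverse : Jcommuting h.
Proof.
move=> x; have E : g x *m (J *m h x) = J.
  by rewrite mulmxA -Jcommuting_metric -mulmxA gh mulmx1.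
by rewrite -[LHS]mul1mx -(metric_inverse x) -mulmxA E.
Qed.

(** The connection matrix of the Chern connection in the direction a, which for
    a closed Kahler form is the one of the Levi-Civita connection. *)
Definition conn a x := del a g x *m h x.

Lemma smooth_conn a : smooth_mx (conn a).
Proof. exact: smooth_mxM (smooth_del a sg) sh. Qed.

Lemma Jcommuting_conn a : Jcommuting (conn a).
Proof.
move=> x; rewrite /conn mulmxA (Jcommuting_del a sg Jcommuting_metric) -!mulmxA.
by rewrite Jcommuting_inverse.
Qed.

(** Closedness of the Kahler form, with one index contracted with J. *)
Lemma partial_metric_antisym i j l x :
  partial i (fun y => g y j l) x - partial l (fun y => g y i j) x
    = - (J *m D (e j *m J) g x) i l.
Proof.
have sk : smooth_mx (kform g) by exact: smooth_mx_cstM sg.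
have -> : (J *m D (e j *m J) g x) i l = \sum_m J j m * partial m (fun y => kform g y i l) x.
  rewrite -(derive_mxv_cstM _ J x sg) derive_mxvE; apply: eq_bigr => m _.
  by rewrite -rowE mxE.
have pull p (F : 'I_4 -> V -> R) : (forall m, smooth (F m)) ->
    \sum_m J j m * partial p (F m) x = partial p (fun y => \sum_m J j m * F m y) x.
  move=> sF; rewrite partial_sum; last first.
    by move=> m; apply: smoothM (sF m); exact: smooth_cst.
  by apply: eq_bigr => m _; rewrite partialZ //; exact: sF.
have E1 : \sum_m J j m * partial i (fun y => kform g y l m) x = partial i (fun y => g y j l) x.
  rewrite (pull i (fun m y => kform g y l m)); last by move=> m; exact: sk.
  congr (partial i _ x); apply/funext => y; rewrite -[in RHS](gJ y) -mulmxA [RHS]mxE.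
  by apply: eq_bigr => m _; rewrite -[in RHS]gT -trmx_mul [_^T _ _]mxE.
have E2 : \sum_m J j m * partial l (fun y => kform g y m i) x = - partial l (fun y => g y i j) x.
  rewrite (pull l (fun m y => kform g y m i)); last by move=> m; exact: sk.
  rewrite -partialN; last exact: sg.
  congr (partial l _ x); apply/funext => y.
  have -> : \sum_m J j m * kform g y m i = (J *m (J *m g y)) j i by rewrite [RHS]mxE.
  by rewrite JmxAJ mxE -[in LHS]gT mxE.
have := g_closed x; move=> H.
have : \sum_m J j m * (partial m (fun y => kform g y i l) x
   + partial i (fun y => kform g y l m) x + partial l (fun y => kform g y m i) x) = 0.
  by apply: big1 => m _; rewrite H mulr0.
under eq_bigr do rewrite !mulrDr.
rewrite !big_split /= E1 E2 => /eqP; rewrite -addrA addr_eq0 => /eqP ->.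
by rewrite opprK.
Qed.

Lemma del_entry a M x i l : del a M x i l = 2^-1 * (D a M x i l - (J *m D (a *m J) M x) i l).
Proof. by rewrite delE mxE; congr (_ * _); rewrite mxE; congr (_ + _); rewrite mxE. Qed.

Lemma christoffel_conn i j k x : christoffel g k i j x = conn (e j) x i k.
Proof.
rewrite /christoffel [RHS]mxE mulr_sumr; apply: eq_bigr => l _.
rewrite -[partial i _ x + _ - _]addrA addrCA partial_metric_antisym invmx_metric.
rewrite del_entry derive_mxv_delta partial_mx_entry -[in LHS]inverse_sym [_^T _ _]mxE.
by rewrite mulrCA mulrC.
Qed.

Lemma christoffel_sym i j k x : christoffel g k i j x = christoffel g k j i x.
Proof.
rewrite /christoffel; congr (_ * _); apply: eq_bigr => l _; congr (_ * _).
rewrite [partial i _ x + _]addrC; congr (_ - partial l _ x).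
by apply/funext => y; rewrite -[in LHS]gT mxE.
Qed.

(** The curvature of the Chern connection has no (2,0) part: its connection
    matrix is (del g) g^-1, and the del derivatives commute. *)
Lemma conn_flat a b x : del a (conn b) x - del b (conn a) x
  = conn a x *m conn b x - conn b x *m conn a x.
Proof.
have E c d : del c (conn d) x = del c (del d g) x *m h x - conn d x *m conn c x.
  have Eg y : conn d y *m g y = del d g y by rewrite /conn -mulmxA metric_inverse mulmx1.
  have := delM c x (smooth_conn d) sg (@Jcommuting_conn d).
  rewrite (_ : (fun y => _) = del d g); last exact/funext.
  by move=> ->; rewrite (cancel_conn _ _ _ (gh x)).
by rewrite (E a b) (E b a) (delC a b x sg) subr_swap.
Qed.

Lemma ricci_conn j k x : ricci g x j k =
  \sum_i (delbar (e i) (conn (e j)) x - delbar (e j) (conn (e i)) x) k i.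
Proof.
have E i : delbar (e i) (conn (e j)) x - delbar (e j) (conn (e i)) x =
   partial_mx i (conn (e j)) x - partial_mx j (conn (e i)) x
   + (conn (e j) x *m conn (e i) x - conn (e i) x *m conn (e j) x).
  rewrite -!derive_mxv_delta -!del_delbar -conn_flat.
  by rewrite add_swap.
under [RHS]eq_bigr do rewrite E mxE.
rewrite big_split /= /ricci mxE; congr (_ + _).
  apply: eq_bigr => i _; apply: etrans _ (esym (submxE _ _ _ _)).
  congr (_ - _); apply: etrans _ (esym (partial_mx_entry _ _ _ _ _)).
    by congr (partial _ _ x); apply/funext => y; rewrite christoffel_sym christoffel_conn.
  by congr (partial _ _ x); apply/funext => y; rewrite christoffel_sym christoffel_conn.
apply: eq_bigr => i _; apply: etrans _ (esym (submxE _ _ _ _)).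
rewrite [X in _ = X - _]mxE [X in _ = _ - X]mxE -sumrB.
apply: eq_bigr => p _; rewrite -!christoffel_conn.
rewrite (christoffel_sym k j) (christoffel_sym k i) (christoffel_sym p i) (christoffel_sym p j).
by congr (_ - _); exact: mulrC.
Qed.

(** In the sum over i of delbar (e i) M the terms with J cancel against the
    terms without it, since J commutes with M and J J = -1. *)
Lemma delbar_trace M k x : smooth_mx M -> Jcommuting M ->
  \sum_i delbar (e i) M x k i = 0.
Proof.
move=> sM cM.
under eq_bigr do rewrite delbar_entry derive_mxv_delta Jcommuting_derive //.
rewrite -mulr_sumr big_split /= [X in _ + X](_ : _ = - \sum_i partial_mx i M x k i).
  by rewrite addrN mulr0.
under eq_bigr => i _ do rewrite mxE.
rewrite exchange_big /= -sumrN; apply: eq_bigr => m _.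
rewrite partial_mx_entry -(Jmx_sumJ m (fun l => partial l (fun y => M y k m) x)).
apply: eq_bigr => i _; rewrite derive_mxvE [RHS]mulrC; congr (_ * _).
by apply: eq_bigr => l _; rewrite -rowE mxE.
Qed.

Lemma delbar_conn_trace j k x (gam : 'I_4 -> V -> R) : (forall l, smooth (gam l)) ->
  (forall l y, \sum_i conn (e i) y l i = gam l y) ->
  \sum_i delbar (e j) (conn (e i)) x k i
    = 2^-1 * (partial j (gam k) x + \sum_m \sum_l J k m * (J j l * partial l (gam m) x)).
Proof.
move=> sgam Hgam.
under eq_bigr do rewrite delbar_entry derive_mxv_delta.
rewrite -mulr_sumr big_split /=.
have E p q : \sum_i partial p (fun y => conn (e i) y q i) x = partial p (gam q) x.
  rewrite -partial_sum; last by move=> i; exact: smooth_conn.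
  by congr (partial p _ x); apply/funext => y; exact: Hgam.
congr (_ * (_ + _)).
  by rewrite -E; apply: eq_bigr => i _; exact: partial_mx_entry.
under eq_bigr => i _ do rewrite mxE.
rewrite exchange_big /=; apply: eq_bigr => m _.
rewrite -!mulr_sumr; congr (_ * _).
under eq_bigr => i _ do rewrite derive_mxvE.
rewrite exchange_big /=; apply: eq_bigr => l _.
by rewrite -mulr_sumr E -rowE mxE.
Qed.

Lemma conn_sum k x : \sum_i conn (e i) x k i = 2^-1 * \tr (partial_mx k g x *m h x).
Proof.
transitivity (\tr (conn (e k) x)).
  apply: eq_bigr => i _; rewrite -!christoffel_conn; exact: christoffel_sym.
have -> : conn (e k) x = 2^-1 *: (partial_mx k g x *m h x - J *m (D (e k *m J) g x *m h x)).
  by rewrite /conn delE derive_mxv_delta mulmxZl mulmxBl mulmxA.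
rewrite mxtraceZ raddfB /= [X in _ - X](_ : _ = 0) ?subr0 //.
have [BT BJ] : (D (e k *m J) g x)^T = D (e k *m J) g x /\
    J *m D (e k *m J) g x = D (e k *m J) g x *m J.
  split; last by exact: Jcommuting_derive sg Jcommuting_metric.
  apply/matrixP => p q; rewrite mxE !derive_mxvE; apply: eq_bigr => m _; congr (_ * partial m _ x).
  by apply/funext => y; rewrite -[in LHS]gT mxE.
exact: trace_Jsym BT (inverse_sym x) BJ (Jcommuting_inverse x).
Qed.

(** Since the (2,0) part of the curvature vanishes, only the (0,1) derivatives
    of the connection matrices contribute. One of the two contractions is zero,
    and the other one involves only the trace of the connection, which is dL,
    where L is the logarithm of the determinant of the Hermitian matrix. *)
Lemma ricci_kahler (L : V -> R) x j k : smooth L ->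
  (forall l y, \tr (partial_mx l g y *m h y) = 2 * partial l L y) ->
  ricci g x j k = - (2^-1 * (partial j (partial k L) x
     + \sum_m \sum_l J k m * (J j l * partial l (partial m L) x))).
Proof.
move=> sL HL; rewrite ricci_conn.
transitivity (\sum_i delbar (e i) (conn (e j)) x k i - \sum_i delbar (e j) (conn (e i)) x k i).
  by rewrite -sumrB; apply: eq_bigr => i _; exact: submxE.
have T1 := delbar_trace k x (smooth_conn (e j)) (@Jcommuting_conn (e j)).
have sgam l := smooth_partial l sL.
have Hgam l y : \sum_i conn (e i) y l i = partial l L y.
  by rewrite conn_sum HL mulKf // pnatr_eq0.
have T2 := delbar_conn_trace j k x sgam Hgam.
exact: etrans (congr2 (fun s t => s - t) T1 T2) (sub0r _).
Qed.

(** The formula of ricci_kahler contracted with J: the two terms become the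
    two terms of dd^c L. *)
Lemma ricci_form_kahler (L : V -> R) x : smooth L ->
  (forall l y, \tr (partial_mx l g y *m h y) = 2 * partial l L y) ->
  ricci_form g x = - 2^-1 *: ddc L x.
Proof.
move=> sL HL; apply/matrixP => j k.
rewrite [RHS]mxE [LHS]mxE.
under eq_bigr do rewrite (ricci_kahler _ _ _ sL HL) mulrN mulrCA.
rewrite sumrN -mulr_sumr mulNr; congr (- (_ * _)).
rewrite (ddcE _ _ _ sL).
under eq_bigr => a _ do rewrite mulrDr.
rewrite big_split /=; apply: (congr2 (fun s t : R => s + t)).
  by apply: eq_bigr => l _; rewrite (partialC _ _ _ sL).
under eq_bigr => a _ do rewrite mulr_sumr.
rewrite exchange_big /= -sumrN; apply: eq_bigr => m _.
rewrite -[X in _ = - (_ * X)]opprK -(Jmx_sumJ j (fun l => partial l (partial m L) x)) mulrN opprK mulr_sumr.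
apply: eq_bigr => a _; rewrite -mulr_sumr; ring.
Qed.

End Metric.
End KahlerRicci.

(** * Lie derivatives, holomorphic maps and dd^c *)

Section ExteriorCalculus.
Variable R : realType.
Notation V := 'rV[R]_4.
Notation J := (@Jmx R).
Implicit Types (f p q : V -> R) (x y : V) (i j k l : 'I_4).

Opaque Jmx partial smooth.

Lemma JmxTE i j : J j i = - J i j.
Proof. by transitivity (J^T i j); [rewrite [RHS]mxE|rewrite JmxT [LHS]mxE]. Qed.

(** Cartan's formula: the contraction of Y with dW drops out. *)
Lemma lie2_closed (W : V -> 'M[R]_4) (Y : V -> V) x j k :
  smooth_mx W -> smooth_map Y -> closed2 W -> (forall y, (W y)^T = - W y) ->
  lie2 Y W x j k = partial j (fun y => (Y y *m W y) 0 k) x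
                 - partial k (fun y => (Y y *m W y) 0 j) x.
Proof.
move=> sW sY cW WT.
have E (p q : 'I_4) : partial p (fun y => (Y y *m W y) 0 q) x =
    \sum_l (Y x 0 l * partial p (fun y => W y l q) x + partial p (fun y => Y y 0 l) x * W x l q).
  rewrite (_ : (fun _ => _) = fun y => \sum_l Y y 0 l * W y l q); last first.
    by apply/funext => y; rewrite mxE.
  rewrite partial_sum => [|l]; last exact: smoothM (sY l) (sW l q).
  by apply: eq_bigr => l _; exact: partialM (sY l) (sW l q).
have WTE y (p q : 'I_4) : W y p q = - W y q p by have /matrixP/(_ q p) := WT y; rewrite !mxE.
have DW (p q r : 'I_4) : partial p (fun y => W y q r) x = - partial p (fun y => W y r q) x.
  by rewrite -(partialN p x (sW r q)); congr (partial p _ x); apply/funext => y; exact: WTE.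
rewrite !E mxE -sumrB; apply: eq_bigr => l _.
have := cW x l j k; rewrite (DW j k l) (DW k l j) (WTE x l j).
move: (partial l _ x) (partial j (fun y => W y l k) x) (partial k (fun y => W y j l) x) => a b c H.
have -> : a = b + c by apply/eqP; rewrite -subr_eq0 opprD addrA; apply/eqP.
ring.
Qed.

(** If X contracts the Kahler form to - df, then J X contracts it to - d^c f. *)
Lemma lie2_hamiltonian (g : V -> 'M[R]_4) (X : V -> V) f x :
  smooth_mx g -> (forall y, (g y)^T = g y) -> (forall y, J *m g y *m J^T = g y) ->
  closed2 (kform g) -> smooth_map X -> hamiltonian g X f ->
  lie2 (fun y => X y *m J) (kform g) x = - ddc f x.
Proof.
move=> sg gT gJ cg sX [sf Hf].
have sk : smooth_mx (kform g) by exact: smooth_mx_cstM sg.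
have sXJ : smooth_map (fun y => X y *m J).
  move=> j; rewrite (_ : (fun _ => _) = fun y => \sum_l X y 0 l * J l j).
    by apply: smooth_sum => l; exact: smoothM (sX l) (smooth_cst _).
  by apply/funext => y; rewrite mxE.
have kT y : (kform g y)^T = - kform g y.
  by rewrite /kform trmx_mul gT JmxT mulmxN (Jmx_invariant_comm (gJ y)).
have E (q : 'I_4) y : (X y *m J *m kform g y) 0 q = - dc f q y.
  rewrite /kform (Jmx_invariant_comm (gJ y)) mulmxA -[X y *m J *m g y]mulmxA [LHS]mxE.
  rewrite /dc opprK; apply: eq_bigr => l _; rewrite Hf.
  by rewrite (JmxTE q l) mulrNN mulrC.
apply/matrixP => j k; rewrite (lie2_closed x j k sk sXJ cg kT).
have -> : (- ddc f x) j k = - (partial j (dc f k) x - partial k (dc f j) x).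
  by rewrite [LHS]mxE; congr (- _); rewrite mxE.
have sdc (q : 'I_4) : smooth (dc f q).
  apply: smoothN; apply: smooth_sum => l; exact: smoothM (smooth_cst _) (smooth_partial l sf).
have EE (q : 'I_4) : (fun y => (X y *m J *m kform g y) 0 q) = fun y => - dc f q y.
  by apply/funext => y; exact: E.
by rewrite !EE (partialN j x (sdc k)) (partialN k x (sdc j)) opprD.
Qed.

Lemma ddcZ (r : R) f x : smooth f -> ddc (fun y => r * f y) x = r *: ddc f x.
Proof.
move=> sf; have sr : smooth (fun y => r * f y) by exact: smoothM (smooth_cst r) sf.
have E l : partial l (fun y => r * f y) = fun y => r * partial l f y.
  by apply/funext => y; exact: partialZ.
have A (p q : 'I_4) : \sum_l J p l * partial q (partial l (fun y => r * f y)) x =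
    r * \sum_l J p l * partial q (partial l f) x.
  rewrite big_distrr; apply: eq_bigr => l _; rewrite E (partialZ _ _ _ (smooth_partial l sf)).
  exact: mulrCA.
apply/matrixP => j k; apply: etrans (ddcE x j k sr) _.
have Er : (r *: ddc f x) j k = r * ddc f x j k by rewrite [LHS]mxE.
apply: etrans _ (esym (etrans Er (congr1 (fun t => r * t) (ddcE x j k sf)))).
exact: etrans (congr2 (fun s t => s - t) (A j k) (A k j)) (esym (mulrBr _ _ _)).
Qed.

Lemma ddcN f x : smooth f -> ddc (fun y => - f y) x = - ddc f x.
Proof.
move=> sf; rewrite (_ : (fun y => - f y) = fun y => -1 * f y).
  by rewrite ddcZ // scaleN1r.
by apply/funext => y; rewrite mulN1r.
Qed.

Lemma ddcD f f' x : smooth f -> smooth f' -> ddc (fun y => f y + f' y) x = ddc f x + ddc f' x.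
Proof.
move=> sf sf'; have ss := smoothD sf sf'.
have E l : partial l (fun y => f y + f' y) = fun y => partial l f y + partial l f' y.
  by apply/funext => y; exact: partialD.
have A (p q : 'I_4) : \sum_l J p l * partial q (partial l (fun y => f y + f' y)) x =
    \sum_l J p l * partial q (partial l f) x + \sum_l J p l * partial q (partial l f') x.
  rewrite -big_split; apply: eq_bigr => l _.
  rewrite E (partialD _ _ (smooth_partial l sf) (smooth_partial l sf')); exact: mulrDr.
have swap (s t s' t' : R) : s + t - (s' + t') = s - s' + (t - t') by rewrite opprD addrACA.
apply/matrixP => j k; apply: etrans (ddcE x j k ss) _.
have Er : (ddc f x + ddc f' x) j k = ddc f x j k + ddc f' x j k by rewrite [LHS]mxE.
apply: etrans _ (esym (etrans Er (congr2 (fun s t => s + t) (ddcE x j k sf) (ddcE x j k sf')))).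
exact: etrans (congr2 (fun s t => s - t) (A j k) (A k j)) (swap _ _ _ _).
Qed.

Lemma partial_comp (F : V -> R) (phi : V -> V) k x : smooth F -> smooth_map phi ->
  is_derive x (delta_mx 0 k) (fun y => F (phi y)) (\sum_m jac phi x k m * partial m F (phi x)).
Proof.
move=> sF sphi; apply: (iffRL (is_derive_line0 (fun y => F (phi y)) x (delta_mx 0 k) _)).
pose c (t : R) := phi (t *: delta_mx 0 k + x).
have Dc j : is_derive (0 : R) 1 (fun t => c t 0 j) (partial k (fun y => phi y 0 j) x).
  exact: (iffLR (is_derive_line0 (fun y => phi y 0 j) x (delta_mx 0 k) _)
    (smooth_is_derive k x (sphi j))).
have dc0 : derivable c 0 1.
  apply/derivable_mxP => i j; rewrite (ord1 i); exact: is_derive_derivable (Dc j).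
have := is_derive_curve (smooth_C1 sF) dc0.
rewrite /c scale0r add0r; congr (is_derive _ _ _ _); apply: eq_bigr => m _.
rewrite mulrC derive1E derive_mx // !mxE; congr (_ * _); exact: @derive_val _ _ _ _ _ _ _ (Dc m).
Qed.

(** Since dphi commutes with J, pullback by phi commutes with d^c; in the exterior
    derivative, the second derivatives of phi cancel by symmetry. *)
Lemma ddc_pullback (F : V -> R) (phi : V -> V) x : smooth F -> smooth_map phi ->
  (forall y, jac phi y *m J = J *m jac phi y) ->
  ddc (fun y => F (phi y)) x = jac phi x *m ddc F (phi x) *m (jac phi x)^T.
Proof.
move=> sF sphi phiJ.
have sdc (q : 'I_4) : smooth (dc F q).
  apply: smoothN; apply: smooth_sum => l; exact: smoothM (smooth_cst _) (smooth_partial l sF).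
have dcE k y : dc (fun z => F (phi z)) k y = \sum_m jac phi y k m * dc F m (phi y).
  rewrite /dc.
  under eq_bigr => l _ do rewrite (partial_is_derive (partial_comp l y sF sphi)) mulr_sumr.
  rewrite exchange_big -sumrN /=.
  under [RHS]eq_bigr => m _ do rewrite mulrN mulr_sumr.
  rewrite [RHS]sumrN exchange_big /= -sumrN; apply: eq_bigr => m _; congr (- _).
  under eq_bigr => l _ do rewrite mulrA.
  under [RHS]eq_bigr => l _ do rewrite mulrA.
  rewrite -!mulr_suml; congr (_ * _).
  by have /matrixP/(_ k m) := phiJ y; rewrite mxE [RHS]mxE.
have jE k m : (fun y => jac phi y k m) = partial k (fun y => phi y 0 m).
  by apply/funext => y; rewrite mxE.
have E j k : partial j (dc (fun z => F (phi z)) k) x =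
   \sum_m (partial j (partial k (fun y => phi y 0 m)) x * dc F m (phi x) +
     jac phi x k m * \sum_n jac phi x j n * partial n (dc F m) (phi x)).
  apply: partial_is_derive.
  rewrite (_ : dc _ k = fun y => \sum_m jac phi y k m * dc F m (phi y)); last exact/funext.
  apply: is_derive_bigsum => m; rewrite addrC.
  apply: is_derive_mul; last exact: (partial_comp j x (sdc m) sphi).
  have := smooth_is_derive j x (smooth_partial k (sphi m)); rewrite -{1}jE; exact.
pose S j k := \sum_m partial j (partial k (fun y => phi y 0 m)) x * dc F m (phi x).
pose T j k := \sum_m \sum_n jac phi x k m * (jac phi x j n * partial n (dc F m) (phi x)).
have SC j k : S j k = S k j.
  apply: eq_bigr => m _; apply: (congr1 (fun t => t * _)); exact: partialC (sphi m).
have {}E j k : partial j (dc (fun z => F (phi z)) k) x = S j k + T j k.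
  rewrite E big_split /=; apply: (congr1 (fun t => _ + t)).
  by apply: eq_bigr => m _; rewrite mulr_sumr.
apply/matrixP => j k; rewrite [LHS]mxE (E j k) (E k j) (SC k j) opprD addrACA addrN add0r.
have -> : T k j = \sum_m \sum_n jac phi x k m * (jac phi x j n * partial m (dc F n) (phi x)).
  rewrite /T exchange_big; apply: eq_bigr => m _; apply: eq_bigr => n _; exact: mulrCA.
rewrite /T -sumrB [RHS]mxE; apply: eq_bigr => m _.
rewrite -sumrB [X in _ = X * _]mxE mulr_suml; apply: eq_bigr => n _.
have -> : ddc F (phi x) n m = partial n (dc F m) (phi x) - partial m (dc F n) (phi x) by rewrite mxE.
have -> : (jac phi x)^T m k = jac phi x k m by rewrite mxE.
ring.
Qed.

Lemma smooth_of_partial f : continuous f ->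
  (forall k x, derivable f x (delta_mx 0 k)) -> (forall k, smooth (partial k f)) -> smooth f.
Proof.
move=> cf df sf s; case/lastP: s => [|s k]; first by [].
by have := sf k s; rewrite /partials foldr_rcons.
Qed.

(** Cauchy-Riemann equations for p + i q. *)
Definition holomorphic_pair p q := forall k x,
  \sum_l J k l * partial l p x = - partial k q x /\
  \sum_l J k l * partial l q x = partial k p x.

Lemma holomorphic_pair_partial p q i : smooth p -> smooth q ->
  holomorphic_pair p q -> holomorphic_pair (partial i p) (partial i q).
Proof.
move=> sp sq H k x.
have E f : smooth f -> \sum_l J k l * partial l (partial i f) x
    = partial i (fun y => \sum_l J k l * partial l f y) x.
  move=> sf; rewrite partial_sum => [|l]; last exact: smoothM (smooth_cst _) (smooth_partial l sf).
  apply: eq_bigr => l _; rewrite (partialZ (J k l) i x (smooth_partial l sf)).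
  by rewrite (partialC l i x sf).
split; rewrite E //.
  rewrite (_ : (fun _ => _) = fun y => - partial k q y); last by apply/funext => y; have [] := H k y.
  by rewrite (partialN i x (smooth_partial k sq)) (partialC i k x sq).
rewrite (_ : (fun _ => _) = partial k p); last by apply/funext => y; have [] := H k y.
exact: partialC sp.
Qed.

Lemma holomorphic_pairB p q p' q' : smooth p -> smooth q -> smooth p' -> smooth q' ->
  holomorphic_pair p q -> holomorphic_pair p' q' ->
  holomorphic_pair (fun x => p x - p' x) (fun x => q x - q' x).
Proof.
move=> sp sq sp' sq' H H' k x; have [H1 H2] := H k x; have [H3 H4] := H' k x.
split; under eq_bigr => l _.
- by rewrite (partialB l x sp sp') mulrBr; over.
- by rewrite sumrB H1 H3 (partialB k x sq sq') opprB opprK addrC.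
- by rewrite (partialB l x sq sq') mulrBr; over.
- by rewrite sumrB H2 H4 (partialB k x sp sp').
Qed.

Lemma holomorphic_pairM p q p' q' : smooth p -> smooth q -> smooth p' -> smooth q' ->
  holomorphic_pair p q -> holomorphic_pair p' q' ->
  holomorphic_pair (fun x => p x * p' x - q x * q' x) (fun x => p x * q' x + q x * p' x).
Proof.
move=> sp sq sp' sq' H H' k x; have [H1 H2] := H k x; have [H3 H4] := H' k x.
have M f f' l : smooth f -> smooth f' -> partial l (fun y => f y * f' y) x =
  f x * partial l f' x + partial l f x * f' x by move=> sf sf'; exact: partialM.
have [s1 s2] := (smoothM sp sp', smoothM sq sq').
have [s3 s4] := (smoothM sp sq', smoothM sq sp').
have B l := partialB l x s1 s2; have D l := partialD l x s3 s4.
have S a b a' b' : \sum_l J k l * (a * partial l b x + partial l b' x * a') =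
  a * (\sum_l J k l * partial l b x) + (\sum_l J k l * partial l b' x) * a'.
  rewrite mulr_sumr mulr_suml -big_split /=; apply: eq_bigr => l _; ring.
split.
  under eq_bigr => l _ do rewrite B !M // mulrBr.
  rewrite sumrB !S H1 H2 H3 H4 D !M //; ring.
under eq_bigr => l _ do rewrite D !M // mulrDr.
rewrite big_split /= !S H1 H2 H3 H4 B !M //; ring.
Qed.

(** For the holomorphic function p + i q, the form d^c log(p^2 + q^2) is twice
    the differential of the argument, hence closed. *)
Section LogModulus.
Variables p q : V -> R.
Hypotheses (sp : smooth p) (sq : smooth q) (H : holomorphic_pair p q).
Hypothesis N0 : forall x, 0 < p x ^+ 2 + q x ^+ 2.

Let N x := p x * p x + q x * q x.

Let N_gt0 x : 0 < N x. Proof. by rewrite /N -!expr2. Qed.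

Let sN : smooth N. Proof. exact: smoothD (smoothM sp sp) (smoothM sq sq). Qed.

Let dN k x : partial k N x = 2 * (p x * partial k p x + q x * partial k q x).
Proof.
rewrite (partialD k x (smoothM sp sp) (smoothM sq sq)) (partialM k x sp sp) (partialM k x sq sq).
ring.
Qed.

Let is_derive_lnN k x :
  is_derive x (delta_mx 0 k) (fun y => ln (N y)) ((N x)^-1 * partial k N x).
Proof. exact: (is_derive_chain (is_derive1_ln (N_gt0 x)) (smooth_is_derive k x sN)). Qed.

Let sNV : smooth (fun x => (N x)^-1).
Proof.
apply: (@smooth_generated R (fun _ x => (N x)^-1) 0); apply: generated_inv.
  exact: generated_smooth_gen.
by move=> t x _; rewrite gt_eqF.
Qed.

Lemma smooth_ln_modulus : smooth (fun x => ln (N x)).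
Proof.
apply: smooth_of_partial => [x|k x|k].
- apply: continuous_comp; first exact: (@smooth_continuous _ _ sN x).
  exact: continuous_ln.
- exact: is_derive_derivable (is_derive_lnN k x).
- rewrite (_ : partial k _ = fun x => (N x)^-1 * partial k N x).
    exact: smoothM sNV (smooth_partial k sN).
  by apply/funext => x; exact: partial_is_derive (is_derive_lnN k x).
Qed.

Lemma ddc_ln_modulus x : ddc (fun x => ln (N x)) x = 0.
Proof.
have dcE k y : dc (fun x => ln (N x)) k y
    = 2 * ((N y)^-1 * (p y * partial k q y - q y * partial k p y)).
  rewrite /dc; under eq_bigr => l _ do
    rewrite (partial_is_derive (is_derive_lnN l y)) dN.
  have [H1 H2] := H k y.
  rewrite (_ : \sum_(l < 4) _ = 2 * (N y)^-1 * (p y * (\sum_l J k l * partial l p y)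
     + q y * (\sum_l J k l * partial l q y))); first by rewrite H1 H2; ring.
  rewrite [p y * _]mulr_sumr [q y * _]mulr_sumr -big_split mulr_sumr.
  by apply: eq_bigr => l _ /=; ring.
have E j k : partial j (dc (fun x => ln (N x)) k) x =
  2 * ((N x)^-1 * (p x * partial j (partial k q) x + partial j p x * partial k q x
    - (q x * partial j (partial k p) x + partial j q x * partial k p x))
   + - (N x) ^- 2 * (2 * (p x * partial j p x + q x * partial j q x))
     * (p x * partial k q x - q x * partial k p x)).
  rewrite (_ : dc _ k = fun y => 2 * ((N y)^-1 * (p y * partial k q y - q y * partial k p y))); last exact/funext.
  have [spk sqk] := (smooth_partial k sp, smooth_partial k sq).
  have sB := smoothB (smoothM sp sqk) (smoothM sq spk).
  rewrite (partialZ 2 j x (smoothM sNV sB)) (partialM j x sNV sB); congr (2 * (_ + _ * _)).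
    rewrite (partialB j x (smoothM sp sqk) (smoothM sq spk)).
    by rewrite (partialM j x sp sqk) (partialM j x sq spk).
  have := is_derive_inv (lt0r_neq0 (N_gt0 x)) (smooth_is_derive j x sN).
  by move/partial_is_derive => ->; rewrite dN.
apply/matrixP => j k; rewrite [LHS]mxE [RHS]mxE !E (partialC j k x sp) (partialC j k x sq).
have := N_gt0 x; rewrite /N; move: (p x) (q x) (partial j p x) (partial k p x) (partial j q x)
  (partial k q x) (partial k (partial j q) x) (partial k (partial j p) x) => a b c d e f s t N1.
field; exact: lt0r_neq0.
Qed.

End LogModulus.

End ExteriorCalculus.

(** * The profile and its primitive *)

Section ExponentialMoments.
Variable R : realType.
Implicit Types (s x : R) (k n : nat).

Definition expmoment_coeff k n : R := (-1) ^+ n / (n`!%:R * (n + k).+1%:R).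

(** The integral of t^k exp(- s t) over [0, 1]. The power series makes it a
    smooth function of s also across s = 0, where the closed formulas have
    removable singularities, and differentiation raises k. *)
Definition expmoment k s : R := limn (pseries (expmoment_coeff k) s).

Lemma is_cvg_expmoment k s : cvgn (pseries (expmoment_coeff k) s).
Proof.
apply: normed_cvg; apply: series_le_cvg (@is_cvg_series_exp_coeff R `|s|).
- by move=> n; exact: normr_ge0.
- by move=> n; apply: exp_coeff_ge0.
move=> n; rewrite /exp_coeff /expmoment_coeff /= !normrM normrX normrN1 expr1n mul1r mulrC normrX.
rewrite ler_wpM2l ?exprn_ge0 // normfV ger0_norm ?mulr_ge0 //.
rewrite lef_pV2 ?posrE ?mulr_gt0 ?ltr0n ?fact_gt0 //.
by rewrite ler_peMr ?ler0n // ler1n.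
Qed.

Lemma expmoment_diffs k : pseries_diffs (expmoment_coeff k) = - expmoment_coeff k.+1.
Proof.
apply/funext => n; rewrite /pseries_diffs /expmoment_coeff.
have -> : (- (fun n => (-1) ^+ n / (n`!%:R * (n + k.+1).+1%:R))) n =
  - ((-1) ^+ n / (n`!%:R * (n + k.+1).+1%:R)) :> R by [].
rewrite factS natrM exprS addSn addnS.
have : (n`!%:R != 0 :> R) by rewrite pnatr_eq0 -lt0n fact_gt0.
have : (n.+1%:R != 0 :> R) by rewrite pnatr_eq0.
have : ((n + k).+2%:R != 0 :> R) by rewrite pnatr_eq0.
move: (n`!%:R) (n.+1%:R) ((n + k).+2%:R) ((-1) ^+ n) => a b c t c0 b0 a0.
by field; rewrite a0 b0 c0.
Qed.

Lemma pseriesN (c : nat -> R) s : pseries (- c) s = - pseries c s.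
Proof.
apply/funext => n; rewrite /pseries /series /=.
have -> : (- (fun m => \sum_(0 <= i < m) c i * s ^+ i)) n = - \sum_(0 <= i < n) c i * s ^+ i by [].
rewrite -sumrN; apply: eq_bigr => i _; exact: mulNr.
Qed.

Lemma is_derive_expmoment k s : is_derive s 1 (expmoment k) (- expmoment k.+1 s).
Proof.
pose K := `|s| + 1.
have sK : `|s| < `|K| by rewrite [ltRHS]ger0_norm ?addr_ge0 // ltrDl.
have CN j x : cvgn (pseries (- expmoment_coeff j) x).
  by rewrite pseriesN; apply: is_cvgN; exact: is_cvg_expmoment.
have := @pseries_snd_diffs R (expmoment_coeff k) K s (@is_cvg_expmoment k K).
rewrite expmoment_diffs pseries_diffsN expmoment_diffs opprK => /(_ (CN _ _)).
move=> /(_ (@is_cvg_expmoment _ _) sK); rewrite pseriesN limN //.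
exact: is_cvg_expmoment.
Qed.

Lemma continuous_expmoment k : continuous (expmoment k).
Proof.
move=> s; apply: differentiable_continuous; apply/derivable1_diffP.
exact: is_derive_derivable (is_derive_expmoment k s).
Qed.

Lemma expmoment0E s : s * expmoment 0 s = 1 - expR (- s).
Proof.
have H1 : (fun n => s * pseries (expmoment_coeff 0) s n) @ \oo --> s * expmoment 0 s.
  by apply: cvgM; [exact: cvg_cst | exact: is_cvg_expmoment].
have H2 : (fun n => 1 - series (exp_coeff (- s)) n.+1) @ \oo --> 1 - expR (- s).
  apply: cvgB; first exact: cvg_cst.
  by rewrite (cvg_shiftS (series (exp_coeff (- s)))); exact: is_cvg_series_exp_coeff.
suff E : (fun n => s * pseries (expmoment_coeff 0) s n) = (fun n => 1 - series (exp_coeff (- s)) n.+1).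
  by rewrite E in H1; exact: (cvg_unique _ H1 H2).
apply/funext => n; rewrite /pseries /series /= big_nat_recl // /exp_coeff /= expr0 fact0 divr1.
rewrite opprD addrA addrN add0r mulr_sumr -sumrN; apply: eq_bigr => i _.
rewrite /expmoment_coeff addn0 factS natrM !exprS (exprNn s).
have : (i`!%:R != 0 :> R) by rewrite pnatr_eq0 -lt0n fact_gt0.
have : (i.+1%:R != 0 :> R) by rewrite pnatr_eq0.
move: (i`!%:R) (i.+1%:R) ((-1) ^+ i) (s ^+ i) => a b t y b0 a0.
by field; rewrite a0 b0.
Qed.

Lemma expmoment0_0 : expmoment 0 0 = 1.
Proof.
have H := is_derive_mul (is_derive_id (0 : R) (1 : R)) (is_derive_expmoment 0 0).
have : is_derive (0 : R) (1 : R) (fun s : R => s * expmoment 0 s) (- (expR (- 0) * -1)).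
  rewrite (_ : (fun s => _) = fun s => 1 - expR (- s)); last by apply/funext => s; exact: expmoment0E.
  rewrite -[X in is_derive _ _ _ X]add0r.
  exact: is_derive_sub.
move=> [_ H2]; have [_ H1] := H; move: H2; rewrite H1.
by rewrite /= oppr0 expR0 mul0r add0r mul1r => ->; ring.
Qed.

Lemma expmoment0_gt0 s : 0 < expmoment 0 s.
Proof.
have E := expmoment0E s; have [s0|s0|s0] := ltgtP s 0.
- rewrite -(nmulr_rlt0 _ s0) E subr_lt0 expR_gt1; lra.
- rewrite -(pmulr_rgt0 _ s0) E subr_gt0 expR_lt1; lra.
- by rewrite s0 expmoment0_0.
Qed.

End ExponentialMoments.

Section Profile.
Variable R : realType.
Implicit Types (c v : R).

(** The function (1 + v - exp(- c v)) / v with its singularity at v = 0 removed. *)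
Definition profile c v : R := 1 + c * expmoment 0 (c * v).

Lemma profileE c v : v * profile c v = 1 + v - expR (- (c * v)).
Proof. by rewrite mulrDr mulr1 mulrCA mulrA expmoment0E; ring. Qed.

Lemma profile_ge1 c v : 0 <= c -> 1 <= profile c v.
Proof. by move=> c0; rewrite lerDl mulr_ge0 // ltW // expmoment0_gt0. Qed.

Lemma profile_gt0 c v : 0 <= c -> 0 < profile c v.
Proof. by move=> c0; exact: lt_le_trans (profile_ge1 v c0). Qed.

Lemma is_derive_profile c v :
  is_derive v 1 (profile c) (- (c * (c * expmoment 1 (c * v)))).
Proof.
have Hc : is_derive v (1 : R) (fun t => c * t) (c * 1 + 0 * v).
  exact: (is_derive_mul (is_derive_cst c v 1) (is_derive_id v 1)).
have HE := is_derive_chain (is_derive_expmoment 0 (c * v)) Hc.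
have := is_derive_add (is_derive_cst (1 : R) v 1) (is_derive_mul (is_derive_cst c v 1) HE).
by congr (is_derive _ _ _ _); rewrite /cst; ring.
Qed.

Lemma continuous_profile c : continuous (profile c).
Proof.
move=> v; apply: differentiable_continuous; apply/derivable1_diffP.
exact: is_derive_derivable (is_derive_profile c v).
Qed.

Lemma profile_lip c c' v : 0 <= c -> 0 <= c' -> 0 <= v ->
  `|profile c v - profile c' v| <= `|c - c'|.
Proof.
wlog cc : c c' / c <= c' => [H|].
  move=> c0 c0' v0; have [cc|/ltW cc] := leP c c'; first exact: H.
  by rewrite distrC [leRHS]distrC; apply: H.
move=> c0 c0' v0; move: (v0); rewrite le_eqVlt => /orP[/eqP<-|vp].
  by rewrite /profile !mulr0 expmoment0_0 !mulr1 opprD addrACA subrr add0r.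
rewrite -(ler_pM2l vp) -{1}(gtr0_norm vp) -normrM mulrBr !profileE.
have -> : 1 + v - expR (- (c * v)) - (1 + v - expR (- (c' * v))) =
  - (expR (- (c * v)) * (1 - expR (- ((c' - c) * v)))).
  by rewrite mulrBr mulr1 -expRD (_ : - (c * v) - (c' - c) * v = - (c' * v)); ring.
have d0 : 0 <= (c' - c) * v by rewrite mulr_ge0 // subr_ge0.
have h0 : 0 <= 1 - expR (- ((c' - c) * v)) by rewrite subr_ge0 expR_le1 oppr_le0.
rewrite normrN normrM ger0_norm ?expR_ge0 // ger0_norm //.
rewrite distrC [X in _ <= v * X]ger0_norm ?subr_ge0 // [leRHS]mulrC.
apply: le_trans (_ : 1 - expR (- ((c' - c) * v)) <= _).
  by rewrite ler_piMl // expR_le1 oppr_le0 mulr_ge0.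
by have := expR_ge1Dx (- ((c' - c) * v)); lra.
Qed.

(** The primitive of the inverse of the profile that vanishes at 0. The base
    point -1 makes 0 an interior point of the domain, and so provides a
    two-sided derivative there. *)
Definition prim c v : R :=
  \int[lebesgue_measure]_(t in `[(-1), v]) (profile c t)^-1
  - \int[lebesgue_measure]_(t in `[(-1), 0]) (profile c t)^-1.

Lemma prim0 c : prim c 0 = 0.
Proof. by rewrite /prim subrr. Qed.

Lemma is_derive_prim c v : 0 <= c -> -1 < v -> is_derive v 1 (prim c) (profile c v)^-1.
Proof.
move=> c0 v1; have cf : continuous (fun t => (profile c t)^-1).
  by move=> t; apply: cvgV; [rewrite gt_eqF // profile_gt0|exact: continuous_profile].
have fi : lebesgue_measure.-integrable `[(-1), v + 1] (EFin \o (fun t => (profile c t)^-1)).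
  apply: continuous_compact_integrable; first exact: segment_compact.
  by apply: continuous_subspaceT => t; exact: cf.
have vv : v < v + 1 by rewrite ltrDl.
have [D E] := continuous_FTC1_closed vv fi v1 (cf v).
rewrite -[X in is_derive _ _ _ X]subr0.
have HI : is_derive v 1 (fun x => \int[lebesgue_measure]_(t in `[(-1), x]) (profile c t)^-1)
    (profile c v)^-1 by apply: DeriveDef; [exact: D|rewrite -derive1E].
exact: (is_derive_sub HI (is_derive_cst _ v 1)).
Qed.

Lemma mvt_nonneg (f f' : R -> R) v v' : 0 <= v -> v <= v' ->
  (forall t : R, 0 <= t -> is_derive t 1 f (f' t)) ->
  exists2 t, v <= t <= v' & f v' - f v = f' t * (v' - v).
Proof.
move=> v0 vv H.
have Hd (t : R) : t \in `]v, v'[ -> is_derive t 1 f (f' t).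
  by rewrite in_itv => /andP[vt _]; apply: H; exact: le_trans v0 (ltW vt).
have Hc : {within `[v, v'], continuous f}.
  apply: continuous_in_subspaceT => t; rewrite inE /= in_itv /= => /andP[vt _].
  apply: differentiable_continuous; apply/derivable1_diffP.
  exact: is_derive_derivable (H t (le_trans v0 vt)).
by have [t tv E] := MVT_segment vv Hd Hc; exists t => //; move: tv; rewrite in_itv.
Qed.

Lemma prim_incr c v v' : 0 <= c -> 0 <= v -> v <= v' -> 0 <= prim c v' - prim c v <= v' - v.
Proof.
move=> c0 v0 vv.
have H (t : R) : 0 <= t -> is_derive t 1 (prim c) ((profile c t)^-1).
  by move=> t0; apply: is_derive_prim => //; lra.
have [t _ ->] := mvt_nonneg v0 vv H.
have p1 := profile_ge1 t c0; have p0 := profile_gt0 t c0.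
have d0 : 0 <= v' - v by rewrite subr_ge0.
by rewrite mulr_ge0 ?invr_ge0 ?(ltW p0) //= ler_piMl // invf_le1.
Qed.

Lemma prim_ge0 c v : 0 <= c -> 0 <= v -> 0 <= prim c v.
Proof. by move=> c0 v0; have := prim_incr c0 (lexx 0) v0; rewrite prim0; lra. Qed.

Lemma prim_le c v : 0 <= c -> 0 <= v -> prim c v <= v.
Proof. by move=> c0 v0; have := prim_incr c0 (lexx 0) v0; rewrite prim0; lra. Qed.

Lemma prim_lip c v v' : 0 <= c -> 0 <= v -> 0 <= v' -> `|prim c v - prim c v'| <= `|v - v'|.
Proof.
wlog vv : v v' / v <= v' => [H|].
  move=> c0 v0 v0'; have [vv|/ltW vv] := leP v v'; first exact: H.
  by rewrite distrC [leRHS]distrC; apply: H.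
move=> c0 v0 v0'; have /andP[A B] := prim_incr c0 v0 vv.
by rewrite distrC [leRHS]distrC !ger0_norm // subr_ge0.
Qed.

Lemma prim_lip_param c c' v : 0 <= c -> 0 <= c' -> 0 <= v ->
  `|prim c v - prim c' v| <= `|c - c'| * v.
Proof.
move=> c0 c0' v0.
have H (t : R) : 0 <= t -> is_derive t 1 (fun t => prim c t - prim c' t) ((profile c t)^-1 - (profile c' t)^-1).
  by move=> t0; apply: is_derive_sub (is_derive_prim _ _) (is_derive_prim _ _) => //; lra.
have [t /andP[t0 _]] := mvt_nonneg (lexx 0) v0 H.
rewrite !prim0 subrr !subr0 => ->; rewrite normrM (ger0_norm v0) ler_wpM2r //.
have [p1 p1'] := (profile_ge1 t c0, profile_ge1 t c0').
have [p0 p0'] := (profile_gt0 t c0, profile_gt0 t c0').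
have -> : (profile c t)^-1 - (profile c' t)^-1 = (profile c' t - profile c t) / (profile c t * profile c' t).
  by field; rewrite !lt0r_neq0.
rewrite normrM distrC (le_trans _ (profile_lip c0 c0' t0)) //.
rewrite ler_piMr // normfV invf_le1 ?normr_gt0 ?mulf_neq0 ?lt0r_neq0 //.
rewrite ger0_norm ?mulr_ge0 ?(ltW p0) ?(ltW p0') //.
by rewrite -[1]mulr1 ler_pM.
Qed.

End Profile.

(** * Solving for the two unknowns *)

(** At z0 - e and z0 + e the limit function lies strictly on either side of k0,
    so eventually h t lies on either side of k t there, and monotonicity traps
    the root z t between these points. *)
Lemma root_cvg (R : realType) (T : Type) (F : set_system T) {FF : Filter F}
    (h : T -> R -> R) (h0 : R -> R) (k z : T -> R) (k0 z0 : R) :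
  (\forall t \near F, [/\ 0 <= z t, h t (z t) = k t &
     forall y y', 0 <= y -> y <= y' -> h t y <= h t y']) ->
  0 <= z0 -> h0 z0 = k0 -> (forall y y', 0 <= y -> y < y' -> h0 y < h0 y') ->
  (forall y, 0 <= y -> h t y @[t --> F] --> h0 y) -> k t @[t --> F] --> k0 ->
  z t @[t --> F] --> z0.
Proof.
move=> H z00 hz0 h0m hc kc; apply/cvgrPdist_lt => e e0.
have up : \forall t \near F, z t < z0 + e.
  have y0 : 0 <= z0 + e by rewrite addr_ge0 // ltW.
  have hk : 0 < h0 (z0 + e) - k0 by rewrite subr_gt0 -hz0 h0m // ltrDl.
  have : h t (z0 + e) - k t @[t --> F] --> h0 (z0 + e) - k0 by apply: cvgB => //; exact: hc.
  move=> /cvgr_gt /(_ 0 hk) P; near=> t.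
  have [zt hzt hm] : [/\ 0 <= z t, h t (z t) = k t & forall y y', 0 <= y -> y <= y' -> h t y <= h t y'].
    by near: t.
  rewrite ltNge; apply/negP => /(hm _ _ y0); rewrite hzt leNgt -subr_gt0.
  by apply/negP; rewrite negbK; near: t.
have down : \forall t \near F, z0 - e < z t.
  have [y0|y0] := leP 0 (z0 - e); last first.
    by near=> t; apply: (lt_le_trans y0); near: t; apply: filterS H => t [].
  have hk : h0 (z0 - e) - k0 < 0 by rewrite subr_lt0 -hz0 h0m // ltrBlDr ltrDl.
  have : h t (z0 - e) - k t @[t --> F] --> h0 (z0 - e) - k0 by apply: cvgB => //; exact: hc.
  move=> /cvgr_lt /(_ 0 hk) P; near=> t.
  have [zt hzt hm] : [/\ 0 <= z t, h t (z t) = k t & forall y y', 0 <= y -> y <= y' -> h t y <= h t y'].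
    by near: t.
  rewrite ltNge; apply/negP => /(hm _ _ zt); rewrite hzt leNgt -subr_lt0.
  by apply/negP; rewrite negbK; near: t.
near=> t.
rewrite distrC ltr_distl; apply/andP; split; [by near: t|by near: t].
Unshelve. all: by end_near.
Qed.

Section Solution.
Variable R : realType.
Implicit Types (c r u v y : R).

Definition xexp u : R := u * expR u.

Lemma xexp_lt u u' : 0 <= u -> u < u' -> xexp u < xexp u'.
Proof.
move=> u0 uu; rewrite /xexp; apply: (@le_lt_trans _ _ (u * expR u')).
  by rewrite ler_wpM2l // ler_expR ltW.
by rewrite ltr_pM2r // expR_gt0.
Qed.

Lemma xexp_le u u' : 0 <= u -> u <= u' -> xexp u <= xexp u'.
Proof. by move=> u0; rewrite le_eqVlt => /orP[/eqP->//|/(xexp_lt u0)/ltW]. Qed.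

Lemma continuous_xexp : continuous xexp.
Proof. by move=> u; apply: cvgM; [exact: cvg_id|exact: continuous_expR]. Qed.

Definition lambert y : R := xget 0 [set u | 0 <= u /\ xexp u = y].

Lemma lambertP y : 0 <= y -> 0 <= lambert y /\ xexp (lambert y) = y.
Proof.
move=> y0; suff : exists u, [set u | 0 <= u /\ xexp u = y] u by move/(xgetPex 0).
have [||u] := @IVT R xexp 0 y y y0.
- by apply: continuous_subspaceT => u; exact: continuous_xexp.
- have e1 : 1 <= expR y by rewrite -expR0 ler_expR.
  have yx : y <= xexp y by rewrite /xexp ler_peMr.
  have -> : xexp 0 = 0 by rewrite /xexp mul0r.
  by rewrite min_l ?max_r ?y0 // (le_trans y0).
- by rewrite in_itv /= => /andP[u0 _] E; exists u.
Qed.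

Lemma lambert_cvg (T : Type) (F : set_system T) {FF : Filter F} (y : T -> R) y0 :
  (\forall t \near F, 0 <= y t) -> 0 <= y0 -> y t @[t --> F] --> y0 ->
  lambert (y t) @[t --> F] --> lambert y0.
Proof.
move=> H y00 yc; have [W0 WE] := lambertP y00.
apply: (@root_cvg R T F FF (fun _ => xexp) xexp y _ y0) => //.
- apply: filterS H => t /lambertP[Wt WtE]; split => //; exact: xexp_le.
- exact: xexp_lt.
- by move=> z _; exact: cvg_cst.
Qed.

(** The value of u that the equation u exp(u) = r1 exp(P - 1) determines for a
    given v. *)
Definition firstU c r1 v : R := lambert (r1 * expR (prim c v - 1)).

Lemma firstUP c r1 v : 0 <= r1 -> 0 <= firstU c r1 v /\
  xexp (firstU c r1 v) = r1 * expR (prim c v - 1).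
Proof. by move=> r0; apply: lambertP; rewrite mulr_ge0 // expR_ge0. Qed.

Lemma firstU_incr c r1 v v' : 0 <= c -> 0 <= r1 -> 0 <= v -> v <= v' ->
  firstU c r1 v' - firstU c r1 v <= prim c v' - prim c v.
Proof.
move=> c0 r0 v0 vv; have /andP[d0 _] := prim_incr c0 v0 vv.
have [u0 uE] := firstUP c v r0; have [u0' uE'] := firstUP c v' r0.
set u := firstU c r1 v in u0 uE *; set u' := firstU c r1 v' in u0' uE' *.
set d := prim c v' - prim c v in d0 *.
rewrite lerBlDr addrC leNgt; apply/negP => /(xexp_lt (addr_ge0 u0 d0)).
rewrite uE' ltNge => /negP; apply.
have -> : r1 * expR (prim c v' - 1) = xexp u * expR d.
  by rewrite uE -mulrA -expRD /d; congr (_ * expR _); ring.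
rewrite /xexp (expRD u d) mulrA; apply: ler_wpM2r; first exact: expR_ge0.
by apply: ler_wpM2r; [exact: expR_ge0|rewrite lerDl].
Qed.

(** The second equation after elimination of u, with the terms in v and u
    collected on one side. *)
Definition balance c r1 v : R :=
  v * profile c v * expR (prim c v + c * v - (1 + c) * firstU c r1 v).

Lemma profile_mul_lt c v v' : 0 <= c -> v < v' -> v * profile c v < v' * profile c v'.
Proof.
move=> c0 vv; rewrite !profileE.
have : expR (- (c * v')) <= expR (- (c * v)).
  by rewrite ler_expR lerN2 ler_wpM2l // ltW.
lra.
Qed.

(** As v grows, u grows by at most as much as P, and P by at most as much as v,
    so the exponent c (v - P) + (1 + c) (P - u) of balance is increasing. *)
Lemma balance_exponent_le c r1 v v' : 0 <= c -> 0 <= r1 -> 0 <= v -> v <= v' ->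
  expR (prim c v + c * v - (1 + c) * firstU c r1 v) <=
  expR (prim c v' + c * v' - (1 + c) * firstU c r1 v').
Proof.
move=> c0 r0 v0 vv; rewrite ler_expR.
have H := firstU_incr c0 r0 v0 vv; have /andP[_ H'] := prim_incr c0 v0 vv.
rewrite -subr_ge0.
have -> : prim c v' + c * v' - (1 + c) * firstU c r1 v' - (prim c v + c * v - (1 + c) * firstU c r1 v)
  = c * (v' - v - (prim c v' - prim c v))
    + (1 + c) * (prim c v' - prim c v - (firstU c r1 v' - firstU c r1 v)).
  by move: (prim c v') (prim c v) (firstU c r1 v') (firstU c r1 v) => a a' b b'; ring.
by apply: addr_ge0; apply: mulr_ge0; rewrite ?subr_ge0 // addr_ge0.
Qed.

Lemma balance_lt c r1 v v' : 0 <= c -> 0 <= r1 -> 0 <= v -> v < v' ->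
  balance c r1 v < balance c r1 v'.
Proof.
move=> c0 r0 v0 vv; have H := balance_exponent_le c0 r0 v0 (ltW vv).
have H' := profile_mul_lt c0 vv.
apply: (@le_lt_trans _ _ (v * profile c v * expR (prim c v' + c * v' - (1 + c) * firstU c r1 v'))).
  by rewrite ler_wpM2l // mulr_ge0 // ltW // profile_gt0.
by rewrite ltr_pM2r // expR_gt0.
Qed.

Lemma balance_le c r1 v v' : 0 <= c -> 0 <= r1 -> 0 <= v -> v <= v' ->
  balance c r1 v <= balance c r1 v'.
Proof.
move=> c0 r0 v0; rewrite le_eqVlt => /orP[/eqP->//|vv].
exact: ltW (balance_lt c0 r0 v0 vv).
Qed.

Section Convergence.
Context (T : Type) (F : set_system T) {FF : Filter F}.
Variables (c r1 r2 : T -> R) (c0 r10 r20 : R).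
Hypotheses (c_ge0 : \forall t \near F, 0 <= c t) (c0_ge0 : 0 <= c0).
Hypotheses (r1_ge0 : \forall t \near F, 0 <= r1 t) (r10_ge0 : 0 <= r10).
Hypotheses (cc : c t @[t --> F] --> c0) (r1c : r1 t @[t --> F] --> r10).

Lemma prim_cvg (v : T -> R) v0 : (\forall t \near F, 0 <= v t) -> 0 <= v0 ->
  v t @[t --> F] --> v0 -> prim (c t) (v t) @[t --> F] --> prim c0 v0.
Proof.
move=> vt v00 vc; apply/cvgrPdist_le => e e0.
have B : `|c0 - c t| * v0 + `|v0 - v t| @[t --> F] --> `|c0 - c0| * v0 + `|v0 - v0|.
  apply: cvgD; first apply: cvgM; try (apply: cvg_norm; apply: cvgB => //); exact: cvg_cst.
rewrite (subrr c0) (subrr v0) !normr0 mul0r addr0 in B.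
move: B => /cvgr_le/(_ e e0) B.
near=> t; apply: le_trans (_ : `|c0 - c t| * v0 + `|v0 - v t| <= e); last by near: t.
have H1 : 0 <= c t by near: t.
have H2 : 0 <= v t by near: t.
apply: le_trans (ler_distD (prim (c t) v0) _ _) _.
by apply: lerD; [exact: prim_lip_param|exact: prim_lip].
Unshelve. all: by end_near.
Qed.

Lemma profile_cvg v : 0 <= v -> profile (c t) v @[t --> F] --> profile c0 v.
Proof.
move=> v0; apply/cvgrPdist_le => e e0.
have /cvgrPdist_le/(_ e e0) B := cc.
near=> t; have H1 : 0 <= c t by near: t.
by apply: le_trans (profile_lip c0_ge0 H1 v0) _; near: t.
Unshelve. all: by end_near.
Qed.

Lemma firstU_cvg (v : T -> R) v0 : (\forall t \near F, 0 <= v t) -> 0 <= v0 ->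
  v t @[t --> F] --> v0 -> firstU (c t) (r1 t) (v t) @[t --> F] --> firstU c0 r10 v0.
Proof.
move=> vt v00 vc; apply: lambert_cvg.
- by apply: filterS r1_ge0 => t r0; rewrite mulr_ge0 // expR_ge0.
- by rewrite mulr_ge0 // expR_ge0.
- apply: cvgM => //; apply: (@cvg_comp _ _ _ _ (@expR R) _ (nbhs (prim c0 v0 - 1))).
    by apply: cvgB; [exact: prim_cvg|exact: cvg_cst].
  exact: continuous_expR.
Qed.

Lemma balance_cvg v : 0 <= v -> balance (c t) (r1 t) v @[t --> F] --> balance c0 r10 v.
Proof.
move=> v0; have vn : \forall t \near F, 0 <= v by apply: filterE.
apply: cvgM; first by apply: cvgM; [exact: cvg_cst|exact: profile_cvg].
apply: (@cvg_comp _ _ _ _ (@expR R) _ (nbhs (prim c0 v + c0 * v - (1 + c0) * firstU c0 r10 v))).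
  apply: cvgB; first apply: cvgD.
  - by apply: (prim_cvg vn v0); exact: cvg_cst.
  - by apply: cvgM => //; exact: cvg_cst.
  apply: cvgM; first by apply: cvgD => //; exact: cvg_cst.
  by apply: (firstU_cvg vn v0); exact: cvg_cst.
exact: continuous_expR.
Qed.

End Convergence.

Definition solV c r1 r2 : R :=
  xget 0 [set v | 0 <= v /\ balance c r1 v = r2 * (1 + c) * expR (- 1)].

Definition solU c r1 r2 : R := firstU c r1 (solV c r1 r2).

Section SolutionFacts.
Variables (c r1 r2 : R).
Hypotheses (c0 : 0 <= c) (r10 : 0 <= r1) (r20 : 0 <= r2).

Lemma solVP : 0 <= solV c r1 r2 /\ balance c r1 (solV c r1 r2) = r2 * (1 + c) * expR (- 1).
Proof.
set k := r2 * (1 + c) * expR (- 1).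
suff : exists v, [set v | 0 <= v /\ balance c r1 v = k] v by move/(xgetPex 0).
have k0 : 0 <= k by rewrite !mulr_ge0 ?expR_ge0 // addr_ge0.
pose E := expR (- ((1 + c) * firstU c r1 0)).
have E0 : 0 < E by exact: expR_gt0.
pose B := k / E; have B0 : 0 <= B by rewrite divr_ge0 // ltW.
have b0 : balance c r1 0 = 0 by rewrite /balance !mul0r.
have bB : k <= balance c r1 B.
  have H := balance_exponent_le c0 r10 (lexx 0) B0.
  rewrite prim0 mulr0 addr0 sub0r -/E in H.
  have -> : k = B * 1 * E by rewrite mulr1 /B mulfVK // gt_eqF.
  have p1 := profile_ge1 B c0.
  apply: ler_pM => //; first by rewrite mulr1.
    exact: ltW.
  by rewrite ler_wpM2l.
have [||v] := @IVT R (balance c r1) 0 B k B0.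
- apply/subspace_continuousP => v; rewrite /= in_itv /= => /andP[v0 _].
  have W : \forall x \near within `[0, B] (nbhs v), 0 <= x.
    by rewrite near_withinE; near=> x; rewrite /= in_itv /= => /andP[].
  have Wc : x @[x --> within `[0, B] (nbhs v)] --> v by apply: cvg_within_filter; exact: cvg_id.
  have Cc (a : R) : (fun=> a) x @[x --> within `[0, B] (nbhs v)] --> a by exact: cvg_cst.
  have c0' : \forall x \near within `[0, B] (nbhs v), 0 <= (fun=> c) x by apply: filterE.
  have r0' : \forall x \near within `[0, B] (nbhs v), 0 <= (fun=> r1) x by apply: filterE.
  apply: cvgM.
    by apply: cvgM => //; apply: cvg_within_filter; exact: continuous_profile.
  apply: (@cvg_comp _ _ _ _ (@expR R) _ (nbhs (prim c v + c * v - (1 + c) * firstU c r1 v))); last exact: continuous_expR.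
  apply: cvgB; first apply: cvgD.
  - exact: (prim_cvg c0' c0 (Cc c) W v0 Wc).
  - by apply: cvgM.
  apply: cvgM; first exact: Cc.
  exact: (firstU_cvg c0' c0 r0' r10 (Cc c) (Cc r1) W v0 Wc).
- by rewrite b0 min_l ?max_r ?k0 // (le_trans k0).
- by rewrite in_itv /= => /andP[v0 _] Ev; exists v.
Unshelve. all: by end_near.
Qed.

Lemma solV_ge0 : 0 <= solV c r1 r2. Proof. by have [] := solVP. Qed.

Lemma solU_ge0 : 0 <= solU c r1 r2. Proof. by have [] := firstUP c (solV c r1 r2) r10. Qed.

Lemma solU_eq : xexp (solU c r1 r2) = r1 * expR (prim c (solV c r1 r2) - 1).
Proof. by have [] := firstUP c (solV c r1 r2) r10. Qed.

Lemma solV_eq : let v := solV c r1 r2 in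
  v * profile c v * expR (prim c v + c * v) = r2 * ((1 + c) * expR ((1 + c) * solU c r1 r2 - 1)).
Proof.
move=> v; have [_] := solVP; rewrite /balance -/v -/(solU c r1 r2) => E.
have -> : prim c v + c * v = prim c v + c * v - (1 + c) * solU c r1 r2 + (1 + c) * solU c r1 r2 by rewrite subrK.
by rewrite expRD mulrA E expRD [expR _ * expR (- 1)]mulrC !mulrA.
Qed.

End SolutionFacts.

Section SolutionContinuity.
Context (T : Type) (F : set_system T) {FF : Filter F}.
Variables (c r1 r2 : T -> R) (c0 r10 r20 : R).
Hypotheses (c_ge0 : \forall t \near F, 0 <= c t) (c0_ge0 : 0 <= c0).
Hypotheses (r1_ge0 : \forall t \near F, 0 <= r1 t) (r10_ge0 : 0 <= r10).
Hypotheses (r2_ge0 : \forall t \near F, 0 <= r2 t) (r20_ge0 : 0 <= r20).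
Hypotheses (cc : c t @[t --> F] --> c0) (r1c : r1 t @[t --> F] --> r10).
Hypotheses (r2c : r2 t @[t --> F] --> r20).

Lemma solV_cvg : solV (c t) (r1 t) (r2 t) @[t --> F] --> solV c0 r10 r20.
Proof.
have [V0 VE] := solVP c0_ge0 r10_ge0 r20_ge0.
apply: (@root_cvg R T F FF (fun t => balance (c t) (r1 t)) (balance c0 r10)
  (fun t => r2 t * (1 + c t) * expR (- 1)) _ (r20 * (1 + c0) * expR (- 1)) _ _ V0 VE).
- near=> t.
  have H1 : 0 <= c t by near: t.
  have H2 : 0 <= r1 t by near: t.
  have H3 : 0 <= r2 t by near: t.
  have [Vt VtE] := solVP H1 H2 H3; split; [exact: Vt|exact: VtE|].
  by move=> y y'; exact: balance_le.
- by move=> y y'; exact: balance_lt.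
- by move=> y y0; exact: (balance_cvg c_ge0 c0_ge0 r1_ge0 r10_ge0 cc r1c y0).
- apply: cvgM; last exact: cvg_cst.
  by apply: cvgM; [exact: r2c|apply: cvgD; [exact: cvg_cst|exact: cc]].
Unshelve. all: by end_near.
Qed.

Lemma solU_cvg : solU (c t) (r1 t) (r2 t) @[t --> F] --> solU c0 r10 r20.
Proof.
apply: (firstU_cvg c_ge0 c0_ge0 r1_ge0 r10_ge0 cc r1c); last exact: solV_cvg.
  near=> t.
  have H1 : 0 <= c t by near: t.
  have H2 : 0 <= r1 t by near: t.
  have H3 : 0 <= r2 t by near: t.
  exact: solV_ge0.
exact: solV_ge0.
Unshelve. all: by end_near.
Qed.

End SolutionContinuity.
End Solution.

(** * Implicit differentiation *)

Lemma is_derive_continuous (R : realType) (f : R -> R) (x d : R) :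
  is_derive x (1 : R) f d -> f @ x --> f x.
Proof.
move=> H; apply: differentiable_continuous; apply/derivable1_diffP.
exact: is_derive_derivable H.
Qed.

(** Caratheodory's criterion provides the slopes of g, also for f t = y0. *)
Lemma is_derive_slope (R : realType) (f g : R -> R) (x d y0 : R) : y0 = x ->
  is_derive y0 (1 : R) g d ->
  (f @ (0 : R) --> x) ->
  exists G : R -> R, (forall t, g (f t) - g y0 = G t * (f t - y0)) /\ G t @[t --> (0 : R)] --> d.
Proof.
move=> E Hg fc; have /is_derive1_caratheodory[s [sE sc s0]] := Hg.
exists (fun t => s (f t)); split=> [t|]; first exact: sE.
by rewrite -s0 E; apply: (cvg_comp f s fc); rewrite -E; exact: sc.
Qed.

(** Implicit differentiation of a pair of equations
    a(u) = r1 p(v), b(v) = r2 q(u) along a line: the increments solve a linear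
    system whose coefficients are slopes, and the slopes converge. *)
Section ImplicitPair.
Variables (R : realType) (a b p q u v r1 r2 : R -> R) (a' b' p' q' d1 d2 : R).
Hypotheses (Ha : is_derive (u 0) (1 : R) a a') (Hb : is_derive (v 0) (1 : R) b b').
Hypotheses (Hp : is_derive (v 0) (1 : R) p p') (Hq : is_derive (u 0) (1 : R) q q').
Hypotheses (uc : u @ (0 : R) --> u 0) (vc : v @ (0 : R) --> v 0).
Hypotheses (H1 : is_derive (0 : R) (1 : R) r1 d1) (H2 : is_derive (0 : R) (1 : R) r2 d2).
Hypotheses (E1 : forall t, a (u t) = r1 t * p (v t)) (E2 : forall t, b (v t) = r2 t * q (u t)).

Let det := a' * b' - r1 0 * p' * (r2 0 * q').
Hypothesis det0 : det != 0.

Lemma implicit_pair :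
  is_derive (0 : R) (1 : R) u ((b' * (d1 * p (v 0)) + r1 0 * p' * (d2 * q (u 0))) / det) /\
  is_derive (0 : R) (1 : R) v ((a' * (d2 * q (u 0)) + r2 0 * q' * (d1 * p (v 0))) / det).
Proof.
have [A [AE Ac]] := is_derive_slope erefl Ha uc.
have [B [BE Bc]] := is_derive_slope erefl Hb vc.
have [P [PE Pc]] := is_derive_slope erefl Hp vc.
have [Q [QE Qc]] := is_derive_slope erefl Hq uc.
have [S1 [S1E S1c]] := is_derive_slope erefl H1 (@cvg_id _ (nbhs (0 : R))).
have [S2 [S2E S2c]] := is_derive_slope erefl H2 (@cvg_id _ (nbhs (0 : R))).
have pc : p (v t) @[t --> (0 : R)] --> p (v 0).
  exact: (cvg_comp v p vc (is_derive_continuous Hp)).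
have qc : q (u t) @[t --> (0 : R)] --> q (u 0).
  exact: (cvg_comp u q uc (is_derive_continuous Hq)).
pose D t := A t * B t - r1 0 * P t * (r2 0 * Q t).
have Dc : D t @[t --> (0 : R)] --> det.
  by apply: cvgB; [exact: cvgM|apply: cvgM; apply: cvgM => //; exact: cvg_cst].
have D0 : \forall t \near (0 : R)^', D t != 0.
  apply: nbhs_dnbhs; apply: (cvgr_neq0 _ Dc det0).
have tn0 : \forall t \near (0 : R)^', t != 0 by exact: nbhs_dnbhs_neq.
have eq1 t : A t * (u t - u 0) - r1 0 * P t * (v t - v 0) = S1 t * t * p (v t).
  have -> : S1 t * t = r1 t - r1 0 by rewrite S1E subr0.
  by rewrite -AE -mulrA -PE !E1; ring.
have eq2 t : B t * (v t - v 0) - r2 0 * Q t * (u t - u 0) = S2 t * t * q (u t).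
  have -> : S2 t * t = r2 t - r2 0 by rewrite S2E subr0.
  by rewrite -BE -mulrA -QE !E2; ring.
pose Nu t := B t * (S1 t * p (v t)) + r1 0 * P t * (S2 t * q (u t)).
pose Nv t := A t * (S2 t * q (u t)) + r2 0 * Q t * (S1 t * p (v t)).
have EU t : D t * (u t - u 0) = t * Nu t.
  rewrite (_ : t * Nu t = B t * (S1 t * t * p (v t)) + r1 0 * P t * (S2 t * t * q (u t))).
    by rewrite -eq1 -eq2 /D; ring.
  by rewrite /Nu; ring.
have EV t : D t * (v t - v 0) = t * Nv t.
  rewrite (_ : t * Nv t = A t * (S2 t * t * q (u t)) + r2 0 * Q t * (S1 t * t * p (v t))).
    by rewrite -eq1 -eq2 /D; ring.
  by rewrite /Nv; ring.
have lim (f N : R -> R) (n : R) : (forall t, D t * (f t - f 0) = t * N t) ->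
    N t @[t --> (0 : R)] --> n -> is_derive (0 : R) (1 : R) f (n / det).
  move=> EN Nc; apply: is_derive_cvg.
  apply: (@cvg_trans _ (N t / D t @[t --> (0 : R)^'])).
    apply: near_eq_cvg; near=> t.
    have t0 : t != 0 by near: t.
    have Dt : D t != 0 by near: t.
    rewrite addr0 [t *: _]mulr1 [_ *: _]mulrC; apply/eqP; rewrite eqr_div //.
    by rewrite [N t * _]mulrC -EN mulrC.
  apply: cvg_within_filter; apply: cvgM => //; exact: cvgV.
split; apply: lim => //.
  by apply: cvgD; apply: cvgM => //; apply: cvgM => //; exact: cvg_cst.
by apply: cvgD; apply: cvgM => //; apply: cvgM => //; exact: cvg_cst.
Unshelve. all: by end_near.
Qed.

End ImplicitPair.

Section SolutionDerivative.
Variable R : realType.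
Implicit Types (c u v : R).

Lemma is_derive_xexp u : is_derive u (1 : R) (@xexp R) ((1 + u) * expR u).
Proof.
have := is_derive_mul (is_derive_id u 1) (is_derive_expR u).
by congr (is_derive _ _ _ _); rewrite /=; ring.
Qed.

Definition weighted_profile c v : R := v * profile c v * expR (prim c v + c * v).

(** The exponentials exp(- c v) from the two factors cancel. *)
Lemma is_derive_weighted_profile c v : 0 <= c -> -1 < v ->
  is_derive v (1 : R) (weighted_profile c) ((1 + c) * (1 + v) * expR (prim c v + c * v)).
Proof.
move=> c0 v1.
have Hcv : is_derive v (1 : R) (fun t => c * t) c.
  have := is_derive_mul (is_derive_cst c v 1) (is_derive_id v 1).
  by congr (is_derive _ _ _ _); rewrite /cst mulr1 mul0r addr0.
have Hp := is_derive_prim c0 v1.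
have H1 := is_derive_exp (is_derive_add Hp Hcv).
have H2 : is_derive v (1 : R) (fun t => t * profile c t) (1 + c * expR (- (c * v))).
  rewrite (_ : (fun t => _) = fun t => 1 + t - expR (- (c * t))); last by apply/funext => t; exact: profileE.
  have H3 := is_derive_exp (is_derive_opp Hcv).
  have := is_derive_sub (is_derive_add (is_derive_cst (1 : R) v 1) (is_derive_id v 1)) H3.
  by congr (is_derive _ _ _ _); ring.
have := is_derive_mul H2 H1; congr (is_derive _ _ _ _).
have p0 := profile_gt0 v c0; have E := profileE c v.
have -> : v * profile c v * (expR (prim c v + c * v) * ((profile c v)^-1 + c)) =
  expR (prim c v + c * v) * (v + c * (v * profile c v)).
  by field; exact: lt0r_neq0.
by rewrite E; move: (expR (prim c v + c * v)) (expR (- (c * v))) => s t; ring.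
Qed.

End SolutionDerivative.

Section Coordinates.
Variable R : realType.
Notation V := 'rV[R]_4.
Implicit Types (x : V) (i j : 'I_4) (c : R).

Definition o0 : 'I_4 := Ordinal (isT : (0 < 4)%N).
Definition o1 : 'I_4 := Ordinal (isT : (1 < 4)%N).
Definition o2 : 'I_4 := Ordinal (isT : (2 < 4)%N).
Definition o3 : 'I_4 := Ordinal (isT : (3 < 4)%N).

Definition rad1 x : R := x 0 o0 * x 0 o0 + x 0 o1 * x 0 o1.
Definition rad2 x : R := x 0 o2 * x 0 o2 + x 0 o3 * x 0 o3.

Definition drad1 i x : R := if (i < 2)%N then 2 * x 0 i else 0.
Definition drad2 i x : R := if (i < 2)%N then 0 else 2 * x 0 i.

Lemma ord4P (P : 'I_4 -> Prop) : P o0 -> P o1 -> P o2 -> P o3 -> forall i, P i.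
Proof.
by move=> H0 H1 H2 H3 [[|[|[|[|i]]]] Hi] //;
  [move: H0|move: H1|move: H2|move: H3]; congr P; exact: val_inj.
Qed.

Lemma rad1_ge0 x : 0 <= rad1 x. Proof. by rewrite addr_ge0 // -expr2 sqr_ge0. Qed.
Lemma rad2_ge0 x : 0 <= rad2 x. Proof. by rewrite addr_ge0 // -expr2 sqr_ge0. Qed.

Lemma is_derive_sq i j x :
  is_derive x (delta_mx 0 i) (fun y : V => y 0 j * y 0 j) ((i == j)%:R * 2 * x 0 j).
Proof.
have := is_derive_mul (is_derive_coord i j x) (is_derive_coord i j x).
by congr (is_derive _ _ _ _); ring.
Qed.

Lemma is_derive_rad1 i x : is_derive x (delta_mx 0 i) rad1 (drad1 i x).
Proof.
have := is_derive_add (is_derive_sq i o0 x) (is_derive_sq i o1 x).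
by congr (is_derive _ _ _ _); move: i; apply: ord4P; rewrite /drad1 /=; ring.
Qed.

Lemma is_derive_rad2 i x : is_derive x (delta_mx 0 i) rad2 (drad2 i x).
Proof.
have := is_derive_add (is_derive_sq i o2 x) (is_derive_sq i o3 x).
by congr (is_derive _ _ _ _); move: i; apply: ord4P; rewrite /drad2 /=; ring.
Qed.

(** The unknowns u and v of the construction; for c = 0, - xi1 and xi2 - 1. *)
Definition sol_u c x : R := solU c (rad1 x) (rad2 x).
Definition sol_v c x : R := solV c (rad1 x) (rad2 x).

Lemma sol_rad c x y : rad1 x = rad1 y -> rad2 x = rad2 y ->
  sol_u c x = sol_u c y /\ sol_v c x = sol_v c y.
Proof. by rewrite /sol_u /sol_v => -> ->. Qed.

Definition nonneg : set R := [set c | 0 <= c].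

Lemma smooth_rad1 : smooth rad1.
Proof. by apply: smoothD; apply: smoothM; exact: smooth_coord. Qed.

Lemma smooth_rad2 : smooth rad2.
Proof. by apply: smoothD; apply: smoothM; exact: smooth_coord. Qed.

Section SolutionNear.
Variables (T : Type) (F : set_system T).
Context {FF : Filter F}.
Variables (c : T -> R) (y : T -> V) (c0 : R) (x : V).
Hypotheses (c_ge0 : \forall t \near F, 0 <= c t) (c0_ge0 : 0 <= c0).
Hypotheses (cc : c t @[t --> F] --> c0) (yc : y t @[t --> F] --> x).

Let h1 : \forall t \near F, 0 <= rad1 (y t).
Proof. by apply: filterE => t; exact: rad1_ge0. Qed.
Let h2 : \forall t \near F, 0 <= rad2 (y t).
Proof. by apply: filterE => t; exact: rad2_ge0. Qed.
Let r1c : rad1 (y t) @[t --> F] --> rad1 x.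
Proof. exact: cvg_comp yc (@smooth_continuous _ _ smooth_rad1 x). Qed.
Let r2c : rad2 (y t) @[t --> F] --> rad2 x.
Proof. exact: cvg_comp yc (@smooth_continuous _ _ smooth_rad2 x). Qed.

Lemma sol_u_cvg : sol_u (c t) (y t) @[t --> F] --> sol_u c0 x.
Proof. exact: (solU_cvg c_ge0 c0_ge0 h1 (rad1_ge0 x) h2 (rad2_ge0 x) cc r1c r2c). Qed.

Lemma sol_v_cvg : sol_v (c t) (y t) @[t --> F] --> sol_v c0 x.
Proof. exact: (solV_cvg c_ge0 c0_ge0 h1 (rad1_ge0 x) h2 (rad2_ge0 x) cc r1c r2c). Qed.

End SolutionNear.

Section FixedParam.
Variable c : R.
Hypothesis c0 : 0 <= c.
Notation u := (sol_u c).
Notation v := (sol_v c).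

Lemma sol_u_ge0 x : 0 <= u x. Proof. by apply: solU_ge0; exact: rad1_ge0. Qed.
Lemma sol_v_ge0 x : 0 <= v x.
Proof. by apply: solV_ge0 => //; [exact: rad1_ge0|exact: rad2_ge0]. Qed.

(** The quotients u / |z1|^2 and v / |z2|^2, in a form that makes sense on the
    coordinate axes. *)
Definition quot1 x : R := expR (- 1 - u x + prim c (v x)).
Definition quot2 x : R :=
  (1 + c) * expR (- 1 - prim c (v x) - c * v x + (1 + c) * u x) * (profile c (v x))^-1.
(** For c = 0 this is xi2 - xi1. *)
Definition width_sum x : R := 1 + u x + v x.

Lemma quot1E x : rad1 x * quot1 x = u x.
Proof.
have := solU_eq c (rad2 x) (rad1_ge0 x); rewrite -/(u x) -/(v x) /xexp /quot1 => E.
rewrite (_ : - 1 - u x + prim c (v x) = (prim c (v x) - 1) + - u x); last first.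
  by move: (u x) (prim c (v x)) => a b; ring.
by rewrite expRD mulrA -E -mulrA expRxMexpNx_1 mulr1.
Qed.

Lemma quot2E x : rad2 x * quot2 x = v x.
Proof.
have := solV_eq c0 (rad1_ge0 x) (rad2_ge0 x); rewrite /= -/(u x) -/(v x) /quot2 => E.
rewrite (_ : - 1 - prim c (v x) - c * v x + (1 + c) * u x =
   ((1 + c) * u x - 1) + - (prim c (v x) + c * v x)); last first.
  by move: (u x) (v x) (prim c (v x)) => a b d; ring.
have p0 := lt0r_neq0 (profile_gt0 (v x) c0).
rewrite expRD [(1 + c) * (_ * _)]mulrA !mulrA -(mulrA (rad2 x)) -E.
have := expRxMexpNx_1 (prim c (v x) + c * v x).
move: (expR (prim _ _ + _)) (expR (- _)) => s t st.
by rewrite -(mulrA _ s) st mulr1 mulfK.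
Qed.

Lemma width_sum_gt0 x : 0 < width_sum x.
Proof. by rewrite /width_sum -addrA ltr_wpDr // addr_ge0 ?sol_u_ge0 ?sol_v_ge0. Qed.

Lemma quot1_gt0 x : 0 < quot1 x. Proof. exact: expR_gt0. Qed.

Lemma quot2_gt0 x : 0 < quot2 x.
Proof. by rewrite !mulr_gt0 ?expR_gt0 ?invr_gt0 ?profile_gt0 // ltr_wpDr. Qed.

Definition du i x : R := (quot1 x * (1 + v x) * drad1 i x
  + (1 + c)^-1 * u x * quot2 x * drad2 i x) / width_sum x.
Definition dv i x : R := (v x * profile c (v x) * quot1 x * drad1 i x
  + (1 + c)^-1 * profile c (v x) * quot2 x * (1 + u x) * drad2 i x) / width_sum x.

Lemma is_derive_sol i x : is_derive x (delta_mx 0 i) u (du i x) /\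
  is_derive x (delta_mx 0 i) v (dv i x).
Proof.
pose l (t : R) : V := t *: delta_mx 0 i + x.
have l0 : l 0 = x by rewrite /l scale0r add0r.
have lc : l t @[t --> (0 : R)] --> l 0.
  by apply: cvgD; [apply: cvgZr_tmp; exact: cvg_id|exact: cvg_cst].
have cnear : \forall t \near (0 : R), 0 <= (fun=> c) t by apply: filterE.
rewrite l0 in lc.
have uc : u (l t) @[t --> (0 : R)] --> u x by exact: sol_u_cvg cnear c0 (cvg_cst c) lc.
have vc : v (l t) @[t --> (0 : R)] --> v x by exact: sol_v_cvg cnear c0 (cvg_cst c) lc.
have v0 := sol_v_ge0 x; have u0 := sol_u_ge0 x.
have v1 : -1 < v x by exact: lt_le_trans v0.
have H1 := iffLR (is_derive_line0 rad1 x _ _) (is_derive_rad1 i x).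
have H2 := iffLR (is_derive_line0 rad2 x _ _) (is_derive_rad2 i x).
pose p t : R := expR (prim c t - 1); pose q t : R := (1 + c) * expR ((1 + c) * t - 1).
have Hp : is_derive (v x) (1 : R) p (p (v x) * (profile c (v x))^-1).
  have H := is_derive_sub (is_derive_prim c0 v1) (is_derive_cst (1 : R) (v x) 1).
  have := is_derive_exp H.
  by rewrite subr0.
have Hq : is_derive (u x) (1 : R) q ((1 + c) * q (u x)).
  have H := is_derive_sub (is_derive_mul (is_derive_cst (1 + c) (u x) 1) (is_derive_id (u x) 1))
    (is_derive_cst (1 : R) (u x) 1).
  have := is_derive_mul (is_derive_cst (1 + c) (u x) 1)
    (is_derive_exp H).
  by congr (is_derive _ _ _ _); rewrite /q /cst; move: (expR _) => s; ring.
have Hb := is_derive_weighted_profile c0 v1.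
have Ha := is_derive_xexp (u x).
have E1 t : xexp (u (l t)) = rad1 (l t) * p (v (l t)) by exact: solU_eq (rad1_ge0 _).
have E2 t : weighted_profile c (v (l t)) = rad2 (l t) * q (u (l t)).
  exact: solV_eq c0 (rad1_ge0 _) (rad2_ge0 _).
have := @implicit_pair R (@xexp R) (weighted_profile c) p q (fun t => u (l t)) (fun t => v (l t))
  (fun t => rad1 (l t)) (fun t => rad2 (l t)).
rewrite !l0 => /(_ _ _ _ _ _ _ Ha Hb Hp Hq).
move=> /(_ _ _ uc vc H1 H2 E1 E2).
have := width_sum_gt0 x; rewrite /width_sum => w0.
have P0 := profile_gt0 (v x) c0.
have PE : p (v x) = quot1 x * expR (u x).
  by rewrite /p /quot1 -expRD; congr expR; move: (u x) (prim c (v x)) => a b; ring.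
have QE : q (u x) = quot2 x * profile c (v x) * expR (prim c (v x) + c * v x).
  rewrite /q /quot2 mulfVK ?lt0r_neq0 // -mulrA -expRD; congr (_ * expR _).
  by move: (u x) (v x) (prim c (v x)) => a b d; ring.
have R1 : rad1 x * p (v x) = u x * expR (u x) by rewrite PE mulrA quot1E.
have R2 : rad2 x * q (u x) = v x * profile c (v x) * expR (prim c (v x) + c * v x).
  by rewrite QE [LHS]mulrA [rad2 x * _]mulrA quot2E.
rewrite [rad1 x * (p (v x) / _)]mulrA R1 [rad2 x * (_ * q (u x))]mulrCA R2 PE QE.
have s0 := expR_gt0 (u x); have t0 := expR_gt0 (prim c (v x) + c * v x).
have c10 : 0 < 1 + c by rewrite ltr_wpDr.
rewrite (_ : (1 + u x) * expR (u x) * ((1 + c) * (1 + v x) * expR (prim c (v x) + c * v x)) -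
  u x * expR (u x) / profile c (v x) *
    ((1 + c) * (v x * profile c (v x) * expR (prim c (v x) + c * v x))) =
  (1 + c) * expR (u x) * expR (prim c (v x) + c * v x) * (1 + u x + v x)); last first.
  move: (expR (u x)) => a; move: (expR (prim _ _ + _)) => b.
  move: (profile _ _) P0 => d d0; move: (u x) (v x) => e f.
  by field; exact: lt0r_neq0.
case; first by rewrite !mulf_neq0 // lt0r_neq0.
move=> DU DV; split; apply/is_derive_line0.
  move: DU; congr (is_derive _ _ _ _); rewrite /du /width_sum.
  move: (expR (u x)) s0 => a a0; move: (expR (prim _ _ + _)) t0 => b b0.
  move: (profile _ _) P0 => d d0; move: (quot1 x) (quot2 x) => e f.
  move: w0; move: (u x) (v x) => m n mn; move: (drad1 i x) (drad2 i x) => r1 r2.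
  by field; rewrite !lt0r_neq0.
move: DV; congr (is_derive _ _ _ _); rewrite /dv /width_sum.
move: (expR (u x)) s0 => a a0; move: (expR (prim _ _ + _)) t0 => b b0.
move: (profile _ _) P0 => d d0; move: (quot1 x) (quot2 x) => e f.
move: w0; move: (u x) (v x) => m n mn; move: (drad1 i x) (drad2 i x) => r1 r2.
by field; rewrite !lt0r_neq0.
Qed.

End FixedParam.
End Coordinates.

(** * Hermitian matrices *)

Section HermitianMatrices.
Variable R : realType.
Notation V := 'rV[R]_4.
Notation J := (@Jmx R).

(** The real matrix of multiplication by a complex 2x2 matrix with entries
    a + ib, c + id, e + if, g + ih, on row vectors. *)
Definition cmx (a b c d e f g h : R) : 'M[R]_4 := \matrix_(i, j)
  nth 0 (nth [::] [:: [:: a; b; c; d]; [:: - b; a; - d; c]; [:: e; f; g; h]; [:: - f; e; - h; g]] i) j.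

(** The Hermitian matrix with diagonal entries P, Q and off-diagonal entry
    S + i T. *)
Definition hmx (P Q S T : R) : 'M[R]_4 := cmx P 0 S T S (- T) Q 0.

Lemma matrix4P (A B : 'M[R]_4) : (forall j, A o0 j = B o0 j) -> (forall j, A o1 j = B o1 j) ->
  (forall j, A o2 j = B o2 j) -> (forall j, A o3 j = B o3 j) -> A = B.
Proof. by move=> H0 H1 H2 H3; apply/matrixP; apply: ord4P. Qed.

Lemma sum4 (F : 'I_4 -> R) : \sum_i F i = F o0 + F o1 + F o2 + F o3.
Proof.
rewrite !big_ord_recl big_ord0 addr0 !addrA.
by congr (F _ + F _ + F _ + F _); apply: val_inj.
Qed.

Lemma JmxE i j : J i j = nth 0 (nth [::] [:: [:: 0; 1; 0; 0]; [:: - 1; 0; 0; 0]; [:: 0; 0; 0; 1];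
  [:: 0; 0; - 1; 0]] i) j.
Proof.
by rewrite mxE; move: i j; apply: ord4P; apply: ord4P => //=; rewrite ?oppr0.
Qed.

Lemma mulmxE4 m n (A : 'M[R]_(m, 4)) (B : 'M[R]_(4, n)) i j :
  (A *m B) i j = A i o0 * B o0 j + A i o1 * B o1 j + A i o2 * B o2 j + A i o3 * B o3 j.
Proof. by rewrite mxE sum4. Qed.

Lemma Jcommuting_cmx (M : 'M[R]_4) : J *m M = M *m J ->
  M = cmx (M o0 o0) (M o0 o1) (M o0 o2) (M o0 o3) (M o2 o0) (M o2 o1) (M o2 o2) (M o2 o3).
Proof.
move=> H.
have E i j : (J *m M) i j = (M *m J) i j by rewrite H.
apply: matrix4P; apply: ord4P; rewrite [RHS]mxE //=.
- by have := E o0 o0; rewrite !mulmxE4 !JmxE /=; lra.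
- by have := E o0 o1; rewrite !mulmxE4 !JmxE /=; lra.
- by have := E o0 o2; rewrite !mulmxE4 !JmxE /=; lra.
- by have := E o0 o3; rewrite !mulmxE4 !JmxE /=; lra.
- by have := E o2 o0; rewrite !mulmxE4 !JmxE /=; lra.
- by have := E o2 o1; rewrite !mulmxE4 !JmxE /=; lra.
- by have := E o2 o2; rewrite !mulmxE4 !JmxE /=; lra.
- by have := E o2 o3; rewrite !mulmxE4 !JmxE /=; lra.
Qed.

Lemma hmxT P Q S T : (hmx P Q S T)^T = hmx P Q S T.
Proof. by apply: matrix4P; apply: ord4P; rewrite !mxE //= ?oppr0 ?opprK. Qed.

Lemma hmxJ P Q S T : J *m hmx P Q S T = hmx P Q S T *m J.
Proof.
by apply: matrix4P; apply: ord4P; rewrite !mulmxE4 !JmxE !mxE /=; ring.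
Qed.

Lemma hmx_invariant P Q S T : J *m hmx P Q S T *m J^T = hmx P Q S T.
Proof. by rewrite JmxT mulmxN hmxJ JmxJA opprK. Qed.

Lemma hmx_mul P Q S T P' Q' S' T' :
  hmx P Q S T *m hmx P' Q' S' T' = cmx (P * P' + S * S' + T * T') (S * - T' + T * S') (P * S' + S * Q') (P * T' + T * Q')
   (S * P' + Q * S') (- T * P' + Q * - T') (S * S' + T * T' + Q * Q') (S * T' - T * S').
Proof.
by apply: matrix4P; apply: ord4P; rewrite !mulmxE4 !mxE /=; ring.
Qed.

Lemma det_cmx a b c d e f g h : \det (cmx a b c d e f g h) =
  (a * g - b * h - (c * e - d * f)) ^+ 2 + (a * h + b * g - (c * f + d * e)) ^+ 2.
Proof.
rewrite (expand_det_row _ o0) sum4 /cofactor !(expand_det_row _ ord0) !big_ord_recl !big_ord0.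
rewrite /cofactor !(expand_det_row _ ord0) !big_ord_recl !big_ord0 /cofactor !det_mx11 !mxE /=.
rewrite /bump /=; ring.
Qed.

End HermitianMatrices.

(** * Invariant forms and the algebra of explicit functions *)

Section RadialForms.
Variable R : realType.
Notation V := 'rV[R]_4.
Notation J := (@Jmx R).
Implicit Types (x : V) (i j k : 'I_4).

Opaque partial smooth Jmx.

(** The angular forms x_i dy_i - y_i dx_i. *)
Definition eta1 k x : R := nth 0 [:: - x 0 o1; x 0 o0; 0; 0] k.
Definition eta2 k x : R := nth 0 [:: 0; 0; - x 0 o3; x 0 o2] k.

Lemma smooth_eta1 k : smooth (eta1 k).
Proof.
move: k; apply: ord4P; first exact: smoothN (smooth_coord R o1).
- exact: smooth_coord o0.
- exact: smooth_cst.
- exact: smooth_cst.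
Qed.

Lemma smooth_eta2 k : smooth (eta2 k).
Proof.
move: k; apply: ord4P; [exact: smooth_cst|exact: smooth_cst| |].
- exact: smoothN (smooth_coord R o3).
- exact: smooth_coord o2.
Qed.

Lemma partial_eta1 j k x : partial j (eta1 k) x =
  nth 0 (nth [::] [:: [:: 0; 1]; [:: - 1; 0]] j) k.
Proof.
move: k; apply: ord4P.
- rewrite (_ : eta1 o0 = fun y => - y 0 o1) // (partialN _ _ (smooth_coord R o1)) partial_coord.
  by move: j; apply: ord4P; rewrite /= ?oppr0.
- rewrite (_ : eta1 o1 = fun y => y 0 o0) // partial_coord.
  by move: j; apply: ord4P.
- rewrite (_ : eta1 o2 = fun y => 0) // partial_cst.
  by move: j; apply: ord4P.
- rewrite (_ : eta1 o3 = fun y => 0) // partial_cst.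
  by move: j; apply: ord4P.
Qed.

Lemma partial_eta2 j k x : partial j (eta2 k) x =
  nth 0 (nth [::] [:: [::]; [::]; [:: 0; 0; 0; 1]; [:: 0; 0; - 1; 0]] j) k.
Proof.
move: k; apply: ord4P.
- rewrite (_ : eta2 o0 = fun y => 0) // partial_cst.
  by move: j; apply: ord4P.
- rewrite (_ : eta2 o1 = fun y => 0) // partial_cst.
  by move: j; apply: ord4P.
- rewrite (_ : eta2 o2 = fun y => - y 0 o3) // (partialN _ _ (smooth_coord R o3)) partial_coord.
  by move: j; apply: ord4P; rewrite /= ?oppr0.
- rewrite (_ : eta2 o3 = fun y => y 0 o2) // partial_coord.
  by move: j; apply: ord4P.
Qed.

(** The Hermitian matrix with diagonal entries P, Q and off-diagonal entry
    t times conj(z1) z2. *)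
Definition radial_hmx (P Q t : R) x : 'M[R]_4 :=
  hmx P Q (t * (x 0 o0 * x 0 o2 + x 0 o1 * x 0 o3)) (t * (x 0 o0 * x 0 o3 - x 0 o1 * x 0 o2)).

Section RadialPair.
Variables (f1 f2 : V -> R) (a b d : V -> R).
Hypotheses (s1 : smooth f1) (s2 : smooth f2).
Hypothesis D1 : forall i x, partial i f1 x = a x * drad1 i x + b x * drad2 i x.
Hypothesis D2 : forall i x, partial i f2 x = b x * drad1 i x + d x * drad2 i x.

(** By dc_radial, d^c of an invariant function is twice a form of this kind. *)
Definition radial_form k x : R := f1 x * eta1 k x + f2 x * eta2 k x.

Lemma smooth_radial_form k : smooth (radial_form k).
Proof. exact: smoothD (smoothM s1 (smooth_eta1 k)) (smoothM s2 (smooth_eta2 k)). Qed.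

Lemma d_radial_form j k x :
  partial j (radial_form k) x - partial k (radial_form j) x =
  2 * (J *m radial_hmx (f1 x + rad1 x * a x) (f2 x + rad2 x * d x) (b x) x) j k.
Proof.
have E p q : partial p (radial_form q) x =
    f1 x * partial p (eta1 q) x + partial p f1 x * eta1 q x
    + (f2 x * partial p (eta2 q) x + partial p f2 x * eta2 q x).
  rewrite (partialD p x (smoothM s1 (smooth_eta1 q)) (smoothM s2 (smooth_eta2 q))).
  by rewrite (partialM p x s1 (smooth_eta1 q)) (partialM p x s2 (smooth_eta2 q)).
rewrite !E !D1 !D2 !partial_eta1 !partial_eta2 mulmxE4 !JmxE !mxE /eta1 /eta2 /drad1 /drad2 /rad1 /rad2.
by move: j k; apply: ord4P; apply: ord4P => /=; ring.
Qed.

End RadialPair.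

Lemma dc_radial (f f1 f2 : V -> R) k x :
  (forall i, partial i f x = f1 x * drad1 i x + f2 x * drad2 i x) ->
  dc f k x = 2 * radial_form f1 f2 k x.
Proof.
move=> Df; rewrite /dc sum4 !Df !JmxE /radial_form /eta1 /eta2 /drad1 /drad2.
by move: k; apply: ord4P => /=; ring.
Qed.

Lemma ddc_radial (f f1 f2 a b d : V -> R) x :
  smooth f1 -> smooth f2 ->
  (forall i x, partial i f x = f1 x * drad1 i x + f2 x * drad2 i x) ->
  (forall i x, partial i f1 x = a x * drad1 i x + b x * drad2 i x) ->
  (forall i x, partial i f2 x = b x * drad1 i x + d x * drad2 i x) ->
  ddc f x = 4 *: (J *m radial_hmx (f1 x + rad1 x * a x) (f2 x + rad2 x * d x) (b x) x).
Proof.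
move=> s1 s2 Df D1 D2; apply/matrixP => j k; rewrite [LHS]mxE [RHS]mxE.
have E q : dc f q = fun y => 2 * radial_form f1 f2 q y.
  by apply/funext => y; apply: dc_radial => i; exact: Df.
rewrite !E (partialZ 2 j x (smooth_radial_form s1 s2 k)) (partialZ 2 k x (smooth_radial_form s1 s2 j)).
rewrite -mulrBr (d_radial_form s1 s2 D1 D2) mulrA; congr (_ * _); ring.
Qed.

Lemma closed_radial (W : V -> 'M[R]_4) (f1 f2 : V -> R) : smooth f1 -> smooth f2 ->
  (forall x j k, W x j k = 2^-1 * (partial j (radial_form f1 f2 k) x - partial k (radial_form f1 f2 j) x)) ->
  closed2 W.
Proof.
move=> s1 s2 HW x i j k; have st q := smooth_radial_form s1 s2 q.
have E p q r : partial p (fun y => W y q r) x =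
   2^-1 * (partial p (partial q (radial_form f1 f2 r)) x - partial p (partial r (radial_form f1 f2 q)) x).
  rewrite (_ : (fun y => W y q r) = fun y => 2^-1 * (partial q (radial_form f1 f2 r) y - partial r (radial_form f1 f2 q) y)); last by apply/funext => y; exact: HW.
  have [sa sb] := (smooth_partial q (st r), smooth_partial r (st q)).
  by rewrite (partialZ _ p x (smoothB sa sb)) (partialB p x sa sb).
rewrite !E (partialC i j x (st k)) (partialC i k x (st j)) (partialC j k x (st i)).
move: (partial j (partial i _) x) (partial k (partial i _) x) (partial k (partial j _) x) => p q r.
ring.
Qed.

End RadialForms.

Section SolutionClass.
Variable R : realType.
Notation V := 'rV[R]_4.
Implicit Types (x : V) (i j k : 'I_4) (c : R).

(** Generators of the algebra of functions of (c, z) in which all tensors of the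
    construction have their components. *)
Inductive sol_gen : (R -> V -> R) -> Prop :=
| sol_gen_u : sol_gen (@sol_u R)
| sol_gen_v : sol_gen (@sol_v R)
| sol_gen_prim : sol_gen (fun c x => prim c (sol_v c x))
| sol_gen_moment n : sol_gen (fun c x => expmoment n (c * sol_v c x))
| sol_gen_coord j : sol_gen (fun _ x => x 0 j).

Notation gen := (generated (@nonneg R) sol_gen).

Lemma gen_const (a : R) : gen (fun _ _ => a).
Proof. by apply: (@generated_cst _ _ _ (fun=> a)); apply: continuous_subspaceT => t; exact: cvg_cst. Qed.

Lemma gen_param : gen (fun c _ => c).
Proof. by apply: (@generated_cst _ _ _ id); apply: continuous_subspaceT => t; exact: cvg_id. Qed.

Lemma gen_opp F : gen F -> gen (fun c x => - F c x).
Proof.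
move=> H; rewrite (_ : (fun c x => _) = fun c x => -1 * F c x).
  exact: generated_mul (gen_const _) H.
by apply/funext => c; apply/funext => x; rewrite mulN1r.
Qed.

Lemma gen_sub F G : gen F -> gen G -> gen (fun c x => F c x - G c x).
Proof. by move=> HF HG; apply: generated_add => //; exact: gen_opp. Qed.

Lemma gen_u : gen (@sol_u R). Proof. exact: generated_gen sol_gen_u. Qed.
Lemma gen_v : gen (@sol_v R). Proof. exact: generated_gen sol_gen_v. Qed.
Lemma gen_prim : gen (fun c x => prim c (sol_v c x)). Proof. exact: generated_gen sol_gen_prim. Qed.
Lemma gen_moment n : gen (fun c x => expmoment n (c * sol_v c x)).
Proof. exact: generated_gen (sol_gen_moment n). Qed.
Lemma gen_coord j : gen (fun _ x => x 0 j). Proof. exact: generated_gen (sol_gen_coord j). Qed.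

Lemma gen_profile : gen (fun c x => profile c (sol_v c x)).
Proof. exact: generated_add (gen_const 1) (generated_mul gen_param (gen_moment 0)). Qed.

Lemma gen_profileV : gen (fun c x => (profile c (sol_v c x))^-1).
Proof. by apply: generated_inv gen_profile _ => c x c0; rewrite lt0r_neq0 // profile_gt0. Qed.

Lemma gen_paramV : gen (fun c x => (1 + c)^-1).
Proof.
apply: (@generated_inv _ _ _ (fun c x => 1 + c)); first exact: generated_add (gen_const 1) gen_param.
by move=> c x c0; rewrite lt0r_neq0 // ltr_wpDr.
Qed.

Lemma gen_width_sum : gen (@width_sum R).
Proof. exact: generated_add (generated_add (gen_const 1) gen_u) gen_v. Qed.

Lemma gen_width_sumV : gen (fun c x => (width_sum c x)^-1).
Proof. by apply: generated_inv gen_width_sum _ => c x c0; rewrite lt0r_neq0 // width_sum_gt0. Qed.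

Lemma gen_quot1 : gen (@quot1 R).
Proof.
exact: generated_exp (generated_add (gen_sub (gen_const _) gen_u) gen_prim).
Qed.

Lemma gen_1param : gen (fun c x => 1 + c).
Proof. exact: generated_add (gen_const 1) gen_param. Qed.

Lemma gen_quot2 : gen (@quot2 R).
Proof.
apply: generated_mul gen_profileV; apply: generated_mul gen_1param _.
exact: generated_exp (generated_add (gen_sub (gen_sub (gen_const _) gen_prim)
  (generated_mul gen_param gen_v)) (generated_mul gen_1param gen_u)).
Qed.

Lemma gen_drad1 i : gen (fun _ x => drad1 i x).
Proof.
rewrite /drad1; case: (i < 2)%N; [exact: generated_mul (gen_const 2) (gen_coord i)|exact: gen_const].
Qed.

Lemma gen_drad2 i : gen (fun _ x => drad2 i x).
Proof.
rewrite /drad2; case: (i < 2)%N; [exact: gen_const|exact: generated_mul (gen_const 2) (gen_coord i)].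
Qed.

Lemma gen_du i : gen (fun c x => du c i x).
Proof.
apply: generated_mul gen_width_sumV; apply: generated_add.
  exact: generated_mul (generated_mul gen_quot1 (generated_add (gen_const 1) gen_v)) (gen_drad1 i).
exact: generated_mul (generated_mul (generated_mul gen_paramV gen_u) gen_quot2) (gen_drad2 i).
Qed.

Lemma gen_dv i : gen (fun c x => dv c i x).
Proof.
apply: generated_mul gen_width_sumV; apply: generated_add.
  exact: generated_mul (generated_mul (generated_mul gen_v gen_profile) gen_quot1) (gen_drad1 i).
apply: generated_mul (gen_drad2 i).
exact: generated_mul (generated_mul (generated_mul gen_paramV gen_profile) gen_quot2) (generated_add (gen_const 1) gen_u).
Qed.

Lemma sol_gen_continuous F : sol_gen F -> jointly_continuous (@nonneg R) F.
Proof.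
have key t x : nonneg t ->
    let G := within [set p : R * V | nonneg p.1] (nbhs (t, x)) in
    [/\ \forall p \near G, 0 <= p.1, p.1 @[p --> G] --> t & p.2 @[p --> G] --> x].
  move=> It; split.
  - by rewrite near_withinE; near=> p.
  - by apply: cvg_within_filter; exact: cvg_fst.
  - by apply: cvg_within_filter; exact: cvg_snd.
case=> [|||n|j]; apply/jointly_continuousP => t x It; have [K1 K2 K3] := key t x It.
- exact: sol_u_cvg K1 It K2 K3.
- exact: sol_v_cvg K1 It K2 K3.
- apply: (prim_cvg K1 It K2 _ (sol_v_ge0 It x) (sol_v_cvg K1 It K2 K3)).
  by apply: filterS K1 => p p0; exact: sol_v_ge0.
- apply: (@cvg_comp _ _ _ (fun p : R * V => p.1 * sol_v p.1 p.2) (@expmoment R n) _ (nbhs (t * sol_v t x))).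
    exact: cvgM K2 (sol_v_cvg K1 It K2 K3).
  exact: (@continuous_expmoment R n _).
- exact: cvg_comp K3 (@coord_continuous R 1 4 0 j x).
Unshelve. all: by end_near.
Qed.

Lemma is_derive_prim_v c i x : 0 <= c ->
  is_derive x (delta_mx 0 i) (fun y => prim c (sol_v c y)) ((profile c (sol_v c x))^-1 * dv c i x).
Proof.
move=> c0; have v1 : -1 < sol_v c x by exact: lt_le_trans (sol_v_ge0 c0 x).
exact: is_derive_chain (is_derive_prim c0 v1) (is_derive_sol c0 i x).2.
Qed.

Lemma is_derive_moment_v n c i x : 0 <= c ->
  is_derive x (delta_mx 0 i) (fun y => expmoment n (c * sol_v c y))
    (- expmoment n.+1 (c * sol_v c x) * (c * dv c i x)).
Proof.
move=> c0; apply: is_derive_chain; first exact: is_derive_expmoment.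
have := is_derive_mul (is_derive_cst c x (delta_mx 0 i)) (is_derive_sol c0 i x).2.
by congr (is_derive _ _ _ _); rewrite /cst mul0r addr0.
Qed.

Lemma sol_gen_derive F i : sol_gen F -> exists2 G, gen G &
  forall t x, nonneg t -> is_derive x (delta_mx 0 i) (F t) (G t x).
Proof.
case=> [|||n|j].
- by exists (fun c x => du c i x); [exact: gen_du|move=> t x /is_derive_sol /(_ i x)[]].
- by exists (fun c x => dv c i x); [exact: gen_dv|move=> t x /is_derive_sol /(_ i x)[]].
- exists (fun c x => (profile c (sol_v c x))^-1 * dv c i x).
    exact: generated_mul gen_profileV (gen_dv i).
  by move=> t x; exact: is_derive_prim_v.
- exists (fun c x => - expmoment n.+1 (c * sol_v c x) * (c * dv c i x)).
    exact: generated_mul (gen_opp (gen_moment n.+1)) (generated_mul gen_param (gen_dv i)).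
  by move=> t x; exact: is_derive_moment_v.
- exists (fun _ _ => (i == j)%:R); first exact: gen_const.
  by move=> t x _; exact: is_derive_coord.
Qed.

Lemma gen_smooth_family F : gen F -> smooth_family (@nonneg R) F.
Proof. move=> HF; exact: (generated_smooth sol_gen_continuous sol_gen_derive HF). Qed.

Lemma gen_smooth F c : gen F -> 0 <= c -> smooth (F c).
Proof. move=> HF c0; exact: (smooth_familyW (I := @nonneg R) c0 (gen_smooth_family HF)). Qed.

End SolutionClass.

(** * Derivatives in the variables |z1|^2 and |z2|^2 *)

Ltac field_assumption := field; repeat (apply/andP; split); assumption.

Section RadialDerivatives.
Variable R : realType.
Notation V := 'rV[R]_4.
Implicit Types (x : V) (i j k : 'I_4) (c : R).

(** The partial derivatives of F at x are those of a function of |z1|^2 and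
    |z2|^2 with first derivatives a and b. *)
Definition radial_at x (F : V -> R) (a b : R) :=
  forall i, is_derive x (delta_mx 0 i) F (a * drad1 i x + b * drad2 i x).

Lemma radial_at_eq x F a b a' b' : a = a' -> b = b' -> radial_at x F a b -> radial_at x F a' b'.
Proof. by move=> -> ->. Qed.

Lemma radial_cst x (a : R) : radial_at x (fun=> a) 0 0.
Proof. by move=> i; rewrite !mul0r addr0; exact: is_derive_cst. Qed.

Lemma radialD x F G a b a' b' : radial_at x F a b -> radial_at x G a' b' ->
  radial_at x (fun y => F y + G y) (a + a') (b + b').
Proof.
move=> HF HG i; have := is_derive_add (HF i) (HG i).
by congr (is_derive _ _ _ _); rewrite !mulrDl addrACA.
Qed.

Lemma radialN x F a b : radial_at x F a b -> radial_at x (fun y => - F y) (- a) (- b).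
Proof.
move=> HF i; have := is_derive_opp (HF i).
by congr (is_derive _ _ _ _); rewrite opprD !mulNr.
Qed.

Lemma radialB x F G a b a' b' : radial_at x F a b -> radial_at x G a' b' ->
  radial_at x (fun y => F y - G y) (a - a') (b - b').
Proof. by move=> HF HG; exact: radialD HF (radialN HG). Qed.

Lemma radialM x F G a b a' b' : radial_at x F a b -> radial_at x G a' b' ->
  radial_at x (fun y => F y * G y) (F x * a' + a * G x) (F x * b' + b * G x).
Proof.
move=> HF HG i; have := is_derive_mul (HF i) (HG i).
by congr (is_derive _ _ _ _); ring.
Qed.

Lemma radial_scale x (s : R) F a b : radial_at x F a b ->
  radial_at x (fun y => s * F y) (s * a) (s * b).
Proof.
move=> HF; apply: radial_at_eq (radialM (radial_cst x s) HF);
  by rewrite mul0r addr0.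
Qed.

Lemma radialV x F a b : F x != 0 -> radial_at x F a b ->
  radial_at x (fun y => (F y)^-1) (- (F x) ^- 2 * a) (- (F x) ^- 2 * b).
Proof.
move=> F0 HF i; have := is_derive_inv F0 (HF i).
by congr (is_derive _ _ _ _); rewrite mulrDr !mulrA.
Qed.

Lemma radial_exp x F a b : radial_at x F a b ->
  radial_at x (fun y => expR (F y)) (expR (F x) * a) (expR (F x) * b).
Proof.
move=> HF i; have := is_derive_exp (HF i).
by congr (is_derive _ _ _ _); rewrite mulrDr !mulrA.
Qed.

Lemma radial_chain x (f : R -> R) (F : V -> R) d a b : is_derive (F x) (1 : R) f d -> radial_at x F a b ->
  radial_at x (fun y => f (F y)) (d * a) (d * b).
Proof.
move=> Hf HF i; have := is_derive_chain Hf (HF i).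
by congr (is_derive _ _ _ _); rewrite mulrDr !mulrA.
Qed.

Definition dprofile c (v : R) : R := - (c * (c * expmoment 1 (c * v))).

Lemma is_derive_dprofile c (v : R) : is_derive v (1 : R) (profile c) (dprofile c v).
Proof. exact: is_derive_profile. Qed.

(** Obtained by differentiating profileE. *)
Lemma dprofileE c v : v * dprofile c v = 1 + c * (1 + v - v * profile c v) - profile c v.
Proof.
have H1 := is_derive_mul (is_derive_id v 1) (is_derive_profile c v).
have Hcv : is_derive v (1 : R) (fun t => c * t) c.
  have := is_derive_mul (is_derive_cst c v 1) (is_derive_id v 1).
  by congr (is_derive _ _ _ _); rewrite /cst mulr1 mul0r addr0.
have H2 := is_derive_sub (is_derive_add (is_derive_cst (1 : R) v 1) (is_derive_id v 1))
  (is_derive_exp (is_derive_opp Hcv)).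
have E : (fun t : R => id t * profile c t) = (fun t => cst (1 : R) t + id t - expR (- (c * t))).
  by apply/funext => t; exact: profileE.
have := @derive_val _ _ _ _ _ _ _ H1; rewrite E (@derive_val _ _ _ _ _ _ _ H2).
rewrite /= -/(dprofile c v) profileE.
move: (expR _) (dprofile c v) (profile c v) => s t p; lra.
Qed.

Lemma quot1_def c : quot1 c = fun x => expR (- 1 - sol_u c x + prim c (sol_v c x)).
Proof. by []. Qed.

Lemma quot2_def c : quot2 c = fun x => (1 + c) * expR (- 1 - prim c (sol_v c x) - c * sol_v c x
  + (1 + c) * sol_u c x) * (profile c (sol_v c x))^-1.
Proof. by []. Qed.

Lemma width_sum_def c : width_sum c = fun x => 1 + sol_u c x + sol_v c x.
Proof. by []. Qed.

Opaque sol_u sol_v quot1 quot2 width_sum prim profile dprofile.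

Section FixedParam.
Variables (c : R) (c0 : 0 <= c).
Variable x : V.
Notation u := (sol_u c x).
Notation v := (sol_v c x).
Notation w := (width_sum c x).
Notation e1 := (quot1 c x).
Notation e2 := (quot2 c x).
Notation p := (profile c v).
Notation p' := (dprofile c v).
Notation k := ((1 + c)^-1).

Let w0 : w != 0. Proof. by rewrite lt0r_neq0 // width_sum_gt0. Qed.
Let p0 : p != 0. Proof. by rewrite lt0r_neq0 // profile_gt0. Qed.
Let c10 : 1 + c != 0. Proof. by rewrite lt0r_neq0 // ltr_wpDr. Qed.

Lemma radial_u : radial_at x (sol_u c) (e1 * (1 + v) / w) (k * u * e2 / w).
Proof.
move=> i; have [+ _] := is_derive_sol c0 i x; congr (is_derive _ _ _ _).
by rewrite /du; move: w w0 => W W0; field_assumption.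
Qed.

Lemma radial_v : radial_at x (sol_v c) (v * p * e1 / w) (k * p * e2 * (1 + u) / w).
Proof.
move=> i; have [_ +] := is_derive_sol c0 i x; congr (is_derive _ _ _ _).
by rewrite /dv; move: w w0 => W W0; field_assumption.
Qed.

Lemma radial_profile : radial_at x (fun y => profile c (sol_v c y))
  ((1 + c * (1 + v - v * p) - p) * p * e1 / w) (p' * (k * p * e2 * (1 + u) / w)).
Proof.
have := radial_chain (is_derive_dprofile c v) radial_v.
apply: radial_at_eq => //; rewrite -dprofileE.
by move: w w0 e1 p p' => W W0 ? ? ?; field_assumption.
Qed.

Lemma radial_prim : radial_at x (fun y => prim c (sol_v c y))
  (v * e1 / w) (k * e2 * (1 + u) / w).
Proof.
have v1 : -1 < v by exact: lt_le_trans (sol_v_ge0 c0 x).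
apply: radial_at_eq (radial_chain (is_derive_prim c0 v1) radial_v).
  by move: p p0 w w0 e1 => ? ? ? ? ?; field_assumption.
by move: p p0 w w0 e2 => ? ? ? ? ?; field_assumption.
Qed.

Lemma radial_quot1 : radial_at x (quot1 c) (- e1 ^+ 2 / w) (k * e1 * e2 / w).
Proof.
have := radial_exp (radialD (radialB (radial_cst x (- 1)) radial_u) radial_prim).
rewrite -(congr1 (fun f => f x) (quot1_def c)) -quot1_def.
by apply: radial_at_eq; move: e1 e2 w w0 => ? ? ? ?; field_assumption.
Qed.

Lemma radial_quot2 : radial_at x (quot2 c) (e1 * e2 * p / w)
  (k * e2 ^+ 2 / w * ((1 + c) * u - (1 + u) * (1 + c * p + p'))).
Proof.
have H := radialB (radialB (radial_cst x (- 1)) radial_prim) (radial_scale c radial_v).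
have := radialM (radial_scale (1 + c) (radial_exp (radialD H (radial_scale (1 + c) radial_u))))
  (radialV p0 radial_profile).
rewrite -quot2_def.
have Es : expR (- 1 - prim c v - c * v + (1 + c) * u) = k * e2 * p.
  by rewrite quot2_def; move: (expR _) p p0 => s P P0; field_assumption.
rewrite Es; move: p p0 w w0 e1 e2 p' {Es H} => P P0 W W0 s1 s2 P'.
move: (sol_u c x) (sol_v c x) => U V.
by apply: radial_at_eq; field_assumption.
Qed.

Lemma radial_width_sumV : radial_at x (fun y => (width_sum c y)^-1)
  (- (e1 * (1 + v) + v * p * e1) / w ^+ 3) (- (k * u * e2 + k * p * e2 * (1 + u)) / w ^+ 3).
Proof.
have := radialD (radialD (radial_cst x 1) radial_u) radial_v.
rewrite -width_sum_def => /(radialV w0).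
move: w w0 p e1 e2 => W W0 P s1 s2; move: (sol_u c x) (sol_v c x) => U V.
by apply: radial_at_eq; field_assumption.
Qed.

(** The coefficients of the primitive of twice the Kahler form on eta1 and eta2,
    and their derivatives; the mixed derivatives agree, which makes the form
    of type (1,1). *)
Definition pot1 y := (1 + sol_v c y) * quot1 c y.
Definition pot2 y := k * ((1 + sol_u c y) * quot2 c y).

Definition pot11 := e1 ^+ 2 / w * (v * p - (1 + v)).
Definition pot12 := k * e1 * e2 / w * (p * (1 + u) + (1 + v)).
Definition pot22 := k ^+ 2 * e2 ^+ 2 / w * (u + (1 + u) * ((1 + c) * u - (1 + u) * (1 + c * p + p'))).

Lemma radial_pot1 : radial_at x pot1 pot11 pot12.
Proof.
have := radialM (radialD (radial_cst x 1) radial_v) radial_quot1.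
rewrite /pot11 /pot12; move: p p0 w w0 e1 e2 p' => P P0 W W0 s1 s2 P'.
move: (sol_u c x) (sol_v c x) => U V.
by apply: radial_at_eq; field_assumption.
Qed.

Lemma radial_pot2 : radial_at x pot2 pot12 pot22.
Proof.
have := radial_scale k (radialM (radialD (radial_cst x 1) radial_u) radial_quot2).
rewrite /pot12 /pot22; move: p p0 w w0 e1 e2 p' => P P0 W W0 s1 s2 P'.
move: (sol_u c x) (sol_v c x) => U V.
by apply: radial_at_eq; field_assumption.
Qed.

(** The first and second derivatives of v - u in |z1|^2 and |z2|^2. *)
Definition dham1 y := - (quot1 c y * (1 + sol_v c y - sol_v c y * profile c (sol_v c y))) * (width_sum c y)^-1.
Definition dham2 y := k * (quot2 c y * (profile c (sol_v c y) * (1 + sol_u c y) - sol_u c y)) * (width_sum c y)^-1.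

Notation eps := (1 + v - v * p).

Definition dham11 := e1 ^+ 2 * eps / w ^+ 2 * (1 + c * v * p + (1 + v + v * p) / w).
Definition dham12 := k * e1 * e2 * eps / w ^+ 3 * (p * (1 + u) * (1 + c * w) - (1 + v)).
Definition dham22 := k ^+ 2 * e2 ^+ 2 / w ^+ 2 *
  ((p * (1 + u) - u) * ((1 + c) * u - (1 + u) * (1 + c * p + p') - (u + p * (1 + u)) / w)
   + p' * p * (1 + u) ^+ 2 + (p - 1) * u).

Lemma radial_ham : radial_at x (fun y => sol_v c y - sol_u c y) (dham1 x) (dham2 x).
Proof.
have := radialB radial_v radial_u; rewrite /dham1 /dham2.
move: p w w0 e1 e2 => P W W0 s1 s2; move: (sol_u c x) (sol_v c x) => U V.
by apply: radial_at_eq; field_assumption.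
Qed.

Let wE : w = 1 + u + v. Proof. by rewrite width_sum_def. Qed.

Lemma radial_dham1 : radial_at x dham1 dham11 dham12.
Proof.
have := radialM (radialN (radialM radial_quot1
  (radialB (radialD (radial_cst x 1) radial_v) (radialM radial_v radial_profile)))) radial_width_sumV.
have := wE; have := w0; rewrite /dham11 /dham12; have := dprofileE c v.
move: p p0 w w0 e1 e2 p' => P P0 W _ s1 s2 P'.
move: (sol_u c x) (sol_v c x) => U V EP W0 WE; subst W.
apply: radial_at_eq; first by field_assumption.
(* Both sides agree up to a multiple of dprofileE. *)
set lhs := (X in X = _); set rhs := (X in _ = X).
suff : lhs = rhs + k * s1 * s2 * P * (1 + U) / (1 + U + V) ^+ 2 *
    (V * P' - (1 + c * (1 + V - V * P) - P)) by rewrite EP subrr mulr0 addr0.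
by rewrite /lhs /rhs; field_assumption.
Qed.

Lemma radial_dham2 : radial_at x dham2 dham12 dham22.
Proof.
have := radialM (radial_scale k (radialM radial_quot2
  (radialB (radialM radial_profile (radialD (radial_cst x 1) radial_u)) radial_u))) radial_width_sumV.
have := wE; have := w0; rewrite /dham12 /dham22.
move: p p0 w w0 e1 e2 p' => P P0 W _ s1 s2 P'.
move: (sol_u c x) (sol_v c x) => U V W0 WE; subst W.
by apply: radial_at_eq; field_assumption.
Qed.

(** Diagonal entries of the Hermitian matrices of the metric and of the Hessian
    of v - u; the off-diagonal entries are pot12 and dham12 times conj(z1) z2. *)
Definition met1 : R := e1 / w * ((1 + v) ^+ 2 + u * v * p).
Definition met2 : R := k ^+ 2 * e2 / w * (u * v + p * (1 + u) ^+ 2).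
Definition hes1 : R := e1 * eps / w ^+ 3 * ((1 + c * w) * u * v * p - (1 + v) ^+ 2).
Definition hes2 : R := k ^+ 2 * e2 * eps / w ^+ 3 * ((1 + c * w) * p * (1 + u) ^+ 2 - u * v).

Lemma met1E : pot1 x + rad1 x * pot11 = met1.
Proof.
rewrite /pot1 /pot11 /met1; have := quot1E c x; have := wE; have := w0.
move: p w e1 (rad1 x) => P W s1 r; move: (sol_u c x) (sol_v c x) => U V.
by move=> W0 WE UE; subst W U; field_assumption.
Qed.

Lemma met2E : pot2 x + rad2 x * pot22 = met2.
Proof.
have E := dprofileE c v; rewrite /pot2 /pot22 /met2; have := quot2E c0 x; have := wE; have := w0.
move: E; move: p w e2 p' (rad2 x) => P W s2 P' r; move: (sol_u c x) (sol_v c x) => U V E.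
move=> W0 WE VE; subst W V.
(* The difference of the two sides is a multiple of dprofileE. *)
suff -> : k * ((1 + U) * s2) + r * (k ^+ 2 * s2 ^+ 2 / (1 + U + r * s2) *
   (U + (1 + U) * ((1 + c) * U - (1 + U) * (1 + c * P + P')))) =
  k ^+ 2 * s2 / (1 + U + r * s2) * (U * (r * s2) + P * (1 + U) ^+ 2)
  - k ^+ 2 * s2 / (1 + U + r * s2) * (1 + U) ^+ 2 *
    (r * s2 * P' - (1 + c * (1 + r * s2 - r * s2 * P) - P)).
  by rewrite E subrr mulr0 subr0.
by field_assumption.
Qed.

Lemma hes1E : dham1 x + rad1 x * dham11 = hes1.
Proof.
rewrite /dham1 /dham11 /hes1; have := quot1E c x; have := wE; have := w0.
move: p w e1 (rad1 x) => P W s1 r; move: (sol_u c x) (sol_v c x) => U V.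
by move=> W0 WE UE; subst W U; field_assumption.
Qed.

Lemma hes2E : dham2 x + rad2 x * dham22 = hes2.
Proof.
have E := dprofileE c v; rewrite /dham2 /dham22 /hes2; have := quot2E c0 x; have := wE; have := w0.
move: E; move: p w e2 p' (rad2 x) => P W s2 P' r; move: (sol_u c x) (sol_v c x) => U V E.
move=> W0 WE VE; subst W V.
(* The difference of the two sides is a multiple of dprofileE. *)
suff -> : k * (s2 * (P * (1 + U) - U)) * (1 + U + r * s2)^-1 + r * (k ^+ 2 * s2 ^+ 2 / (1 + U + r * s2) ^+ 2 *
  ((P * (1 + U) - U) * ((1 + c) * U - (1 + U) * (1 + c * P + P') - (U + P * (1 + U)) / (1 + U + r * s2))
   + P' * P * (1 + U) ^+ 2 + (P - 1) * U)) =
  k ^+ 2 * s2 * (1 + r * s2 - r * s2 * P) / (1 + U + r * s2) ^+ 3 *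
    ((1 + c * (1 + U + r * s2)) * P * (1 + U) ^+ 2 - U * (r * s2))
  + k ^+ 2 * s2 / (1 + U + r * s2) ^+ 2 * (1 + U) * U *
    (r * s2 * P' - (1 + c * (1 + r * s2 - r * s2 * P) - P)).
  by rewrite E subrr mulr0 addr0.
by field_assumption.
Qed.

End FixedParam.
End RadialDerivatives.

(** * Metrics given by Hermitian matrices *)

Section HermitianFields.
Variable R : realType.
Notation V := 'rV[R]_4.
Notation J := (@Jmx R).
Implicit Types (x y : V) (i j k : 'I_4).

Opaque partial smooth Jmx.

Lemma hmx_quad (P Q S T : R) (Y : V) : P * (Y *m hmx P Q S T *m Y^T) 0 0 =
  (P * Y 0 o0 + S * Y 0 o2 + T * Y 0 o3) ^+ 2 + (P * Y 0 o1 - T * Y 0 o2 + S * Y 0 o3) ^+ 2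
  + (P * Q - S * S - T * T) * (Y 0 o2 ^+ 2 + Y 0 o3 ^+ 2).
Proof.
rewrite mulmxE4 !mulmxE4 !mxE /=.
move: (Y 0 o0) (Y 0 o1) (Y 0 o2) (Y 0 o3) => a b d e; ring.
Qed.

Lemma hmx_gt0 (P Q S T : R) (Y : V) : 0 < P -> 0 < P * Q - S * S - T * T -> Y != 0 ->
  0 < (Y *m hmx P Q S T *m Y^T) 0 0.
Proof.
move=> P0 D0 Y0; rewrite -(pmulr_rgt0 _ P0) hmx_quad.
have [E|] := eqVneq (Y 0 o2 ^+ 2 + Y 0 o3 ^+ 2) 0.
  move: (E) => /eqP; rewrite paddr_eq0 ?sqr_ge0 // !sqrf_eq0 => /andP[/eqP E2 /eqP E3].
  rewrite E mulr0 addr0 E2 E3 !mulr0 !addr0 subr0 !exprMn -mulrDr mulr_gt0 ?exprn_gt0 //.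
  rewrite lt_neqAle addr_ge0 ?sqr_ge0 // andbT eq_sym; apply/negP.
  rewrite paddr_eq0 ?sqr_ge0 // !sqrf_eq0 => /andP[/eqP E0 /eqP E1].
  case/eqP: Y0; apply/rowP => j; rewrite [RHS]mxE; move: j; exact: ord4P.
move=> N0; apply: ltr_wpDl; first by rewrite addr_ge0 ?sqr_ge0.
by rewrite mulr_gt0 // lt_neqAle eq_sym N0 addr_ge0 ?sqr_ge0.
Qed.

Section Fields.
Variables P Q S T : V -> R.
Hypotheses (sP : smooth P) (sQ : smooth Q) (sS : smooth S) (sT : smooth T).

Lemma smooth_hmx : smooth_mx (fun x => hmx (P x) (Q x) (S x) (T x)).
Proof.
move=> j k; rewrite (_ : (fun x => hmx _ _ _ _ j k) = fun x => nth 0 (nth [::]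
  [:: [:: P x; 0; S x; T x]; [:: - 0; P x; - T x; S x]; [:: S x; - T x; Q x; 0];
      [:: - - T x; S x; - 0; Q x]] j) k); last by apply/funext => x; rewrite mxE.
have s0 : smooth (fun _ : V => - 0 : R) by exact: smooth_cst.
have s1 : smooth (fun _ : V => 0 : R) by exact: smooth_cst.
have sTN := smoothN sT; have sTNN := smoothN sTN.
by move: j k; apply: ord4P; apply: ord4P; [exact: sP|exact: s1|exact: sS|exact: sT
  |exact: s0|exact: sP|exact: sTN|exact: sS|exact: sS|exact: sTN|exact: sQ|exact: s1
  |exact: sTNN|exact: sS|exact: s0|exact: sQ].
Qed.

Lemma partial_hmx i x : partial_mx i (fun x => hmx (P x) (Q x) (S x) (T x)) x =
  hmx (partial i P x) (partial i Q x) (partial i S x) (partial i T x).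
Proof.
apply/matrixP => j k; rewrite partial_mx_entry.
rewrite (_ : (fun x => hmx _ _ _ _ j k) = fun x => nth 0 (nth [::]
  [:: [:: P x; 0; S x; T x]; [:: - 0; P x; - T x; S x]; [:: S x; - T x; Q x; 0];
      [:: - - T x; S x; - 0; Q x]] j) k); last by apply/funext => y; rewrite mxE.
have pN : partial i (fun x => - T x) x = - partial i T x by exact: partialN.
have pNN : partial i (fun x => - - T x) x = - - partial i T x.
  by rewrite (partialN _ _ (smoothN sT)) pN.
have p1 : partial i (fun _ : V => 0 : R) x = 0 by exact: partial_cst.
have p0 : partial i (fun _ : V => - 0 : R) x = - 0 by rewrite partial_cst oppr0.
rewrite mxE; move: j k; apply: ord4P; apply: ord4P;
  [by []|exact: p1|by []|by []|exact: p0|by []|exact: pN|by []|by []|exact: pN|by []|exact: p1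
  |exact: pNN|by []|exact: p0|by []].
Qed.

Let D x := P x * Q x - S x * S x - T x * T x.

Lemma trace_partial_hmx i x : D x != 0 ->
  \tr (partial_mx i (fun x => hmx (P x) (Q x) (S x) (T x)) x
    *m hmx (Q x / D x) (P x / D x) (- S x / D x) (- T x / D x)) = 2 * (partial i D x / D x).
Proof.
move=> D0; rewrite partial_hmx hmx_mul /mxtrace sum4 !mxE /=.
have -> : partial i D x = P x * partial i Q x + partial i P x * Q x
   - (S x * partial i S x + partial i S x * S x) - (T x * partial i T x + partial i T x * T x).
  rewrite /D (partialB i x (smoothB (smoothM sP sQ) (smoothM sS sS)) (smoothM sT sT)).
  rewrite (partialB i x (smoothM sP sQ) (smoothM sS sS)).
  by rewrite (partialM i x sP sQ) (partialM i x sS sS) (partialM i x sT sT).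
move: (D x) D0 (P x) (Q x) (S x) (T x) => d d0 p q s t.
by field.
Qed.

Lemma hmx_inverse x : D x != 0 -> hmx (P x) (Q x) (S x) (T x)
    *m hmx (Q x / D x) (P x / D x) (- S x / D x) (- T x / D x) = 1%:M.
Proof.
move=> D0; rewrite hmx_mul; apply: matrix4P; apply: ord4P; rewrite !mxE //=.
all: move: D0; rewrite /D => D0; field; exact: D0.
Qed.

End Fields.

(** The real determinant is the square of the Hermitian one, so that the trace of
    (partial i g) g^-1 is twice the derivative of the logarithm L + log K of
    the Hermitian determinant. *)
Lemma ricci_hmx (P Q S T : V -> R) (K : R) (L : V -> R) :
  smooth P -> smooth Q -> smooth S -> smooth T -> smooth L -> 0 < K ->
  (forall x, P x * Q x - S x * S x - T x * T x = K * expR (L x)) ->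
  kahler (fun x => hmx (P x) (Q x) (S x) (T x)) ->
  (forall x j k, ricci (fun x => hmx (P x) (Q x) (S x) (T x)) x j k = - (2^-1 * (partial j (partial k L) x
     + \sum_m \sum_l J k m * (J j l * partial l (partial m L) x)))) /\
  (forall x, ricci_form (fun x => hmx (P x) (Q x) (S x) (T x)) x = - 2^-1 *: ddc L x).
Proof.
move=> sP sQ sS sT sL K0 DE [[sg gT _] gJ cg].
set g := (fun x => hmx (P x) _ _ _) in sg gT gJ cg *.
pose D x := P x * Q x - S x * S x - T x * T x.
have D0 x : D x != 0 by rewrite /D DE lt0r_neq0 // mulr_gt0 ?expR_gt0.
have sD : smooth D.
  exact: smoothB (smoothB (smoothM sP sQ) (smoothM sS sS)) (smoothM sT sT).
have sDV : smooth (fun x => (D x)^-1).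
  apply: (@smooth_generated R (fun _ x => (D x)^-1) 0); apply: generated_inv.
    exact: generated_smooth_gen.
  by move=> t x _; exact: D0.
pose h x := hmx (Q x / D x) (P x / D x) (- S x / D x) (- T x / D x).
have sh : smooth_mx h.
  apply: smooth_hmx; first exact: smoothM sQ sDV.
  - exact: smoothM sP sDV.
  - exact: smoothM (smoothN sS) sDV.
  - exact: smoothM (smoothN sT) sDV.
have gh x : g x *m h x = 1%:M by exact: (@hmx_inverse P Q S T x (D0 x)).
have HL l y : \tr (partial_mx l g y *m h y) = 2 * partial l L y.
  rewrite (trace_partial_hmx sP sQ sS sT l (D0 y)); congr (2 * _).
  have -> : partial l (fun x => P x * Q x - S x * S x - T x * T x) y = D y * partial l L y.
    rewrite (_ : (fun x => _) = fun x => K * expR (L x)); last exact/funext.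
    apply: partial_is_derive.
    have := is_derive_mul (is_derive_cst K y (delta_mx 0 l)) (is_derive_exp (smooth_is_derive l y sL)).
    by congr (is_derive _ _ _ _); rewrite /cst mul0r addr0 mulrA /D DE.
  by rewrite -/(D y) mulrAC (mulfV (D0 y)) mul1r.
split=> [x j k|x]; first exact: (ricci_kahler sg sh gh gT gJ cg x j k sL HL).
exact: (ricci_form_kahler sg sh gh gT gJ cg x sL HL).
Qed.

End HermitianFields.

(** * The solitons *)

Section SolitonFamily.
Variable R : realType.
Notation V := 'rV[R]_4.
Notation J := (@Jmx R).
Implicit Types (c : R) (x y : V) (i j k : 'I_4).

Opaque partial smooth Jmx sol_u sol_v quot1 quot2 width_sum prim profile dprofile.

Notation gen := (generated (@nonneg R) (@sol_gen R)).

(** The real and imaginary parts of conj(z1) z2. *)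
Definition inner x : R := x 0 o0 * x 0 o2 + x 0 o1 * x 0 o3.
Definition cross x : R := x 0 o0 * x 0 o3 - x 0 o1 * x 0 o2.

Definition metric c x : 'M[R]_4 :=
  hmx (met1 c x) (met2 c x) (pot12 c x * inner x) (pot12 c x * cross x).

(** A multiple of (1 + c) times the rotation of z2 minus the rotation of z1,
    whose components are those of the forms eta2 and eta1. *)
Definition soliton_field c x : V := \row_j (2 * c * ((1 + c) * eta2 j x - eta1 j x)).

Definition ham c x : R := c * (sol_v c x - sol_u c x).

Lemma inner_cross x : inner x * inner x + cross x * cross x = rad1 x * rad2 x.
Proof. by rewrite /inner /cross /rad1 /rad2; ring. Qed.

Lemma gen_sqr F : gen F -> gen (fun c x => F c x ^+ 2).
Proof. by move=> HF; exact: (generated_mul HF HF). Qed.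

Lemma gen_one_u : gen (fun c x => 1 + sol_u c x).
Proof. exact: generated_add (gen_const 1) (gen_u R). Qed.

Lemma gen_one_v : gen (fun c x => 1 + sol_v c x).
Proof. exact: generated_add (gen_const 1) (gen_v R). Qed.

Lemma gen_inner : gen (fun _ x => inner x).
Proof.
exact: (generated_add (generated_mul (gen_coord R o0) (gen_coord R o2)) (generated_mul (gen_coord R o1) (gen_coord R o3))).
Qed.

Lemma gen_cross : gen (fun _ x => cross x).
Proof.
exact: (gen_sub (generated_mul (gen_coord R o0) (gen_coord R o3)) (generated_mul (gen_coord R o1) (gen_coord R o2))).
Qed.

Lemma gen_pot1 : gen (@pot1 R).
Proof. exact: (generated_mul gen_one_v (gen_quot1 R)). Qed.

Lemma gen_pot2 : gen (@pot2 R).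
Proof. exact: (generated_mul (gen_paramV R) (generated_mul gen_one_u (gen_quot2 R))). Qed.

Lemma gen_met1 : gen (@met1 R).
Proof.
exact: (generated_mul (generated_mul (gen_quot1 R) (gen_width_sumV R))
  (generated_add (gen_sqr gen_one_v) (generated_mul (generated_mul (gen_u R) (gen_v R)) (gen_profile R)))).
Qed.

Lemma gen_met2 : gen (@met2 R).
Proof.
exact: (generated_mul (generated_mul (generated_mul (gen_sqr (gen_paramV R)) (gen_quot2 R)) (gen_width_sumV R))
  (generated_add (generated_mul (gen_u R) (gen_v R)) (generated_mul (gen_profile R) (gen_sqr gen_one_u)))).
Qed.

Lemma gen_pot12 : gen (@pot12 R).
Proof.
exact: (generated_mul (generated_mul (generated_mul (generated_mul (gen_paramV R) (gen_quot1 R)) (gen_quot2 R)) (gen_width_sumV R))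
  (generated_add (generated_mul (gen_profile R) gen_one_u) gen_one_v)).
Qed.

Lemma gen_dham1 : gen (@dham1 R).
Proof.
exact: (generated_mul (gen_opp (generated_mul (gen_quot1 R)
  (gen_sub gen_one_v (generated_mul (gen_v R) (gen_profile R))))) (gen_width_sumV R)).
Qed.

Lemma gen_dham2 : gen (@dham2 R).
Proof.
exact: (generated_mul (generated_mul (gen_paramV R) (generated_mul (gen_quot2 R)
  (gen_sub (generated_mul (gen_profile R) gen_one_u) (gen_u R)))) (gen_width_sumV R)).
Qed.

Lemma gen_ham : gen ham.
Proof. exact: (generated_mul (gen_param R) (gen_sub (gen_v R) (gen_u R))). Qed.

Lemma gen_eta1 k : gen (fun _ x => eta1 k x).
Proof.
move: k; apply: ord4P; [exact: gen_opp (gen_coord R o1)|exact: (gen_coord R o0)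
  |exact: gen_const|exact: gen_const].
Qed.

Lemma gen_eta2 k : gen (fun _ x => eta2 k x).
Proof.
move: k; apply: ord4P; [exact: gen_const|exact: gen_const
  |exact: gen_opp (gen_coord R o3)|exact: (gen_coord R o2)].
Qed.

Lemma gen_soliton_field j : gen (fun c x => soliton_field c x 0 j).
Proof.
rewrite (_ : (fun c x => _) = fun c x => 2 * c * ((1 + c) * eta2 j x - eta1 j x)).
  exact: generated_mul (generated_mul (gen_const 2) (gen_param R))
    (gen_sub (generated_mul (gen_1param R) (gen_eta2 j)) (gen_eta1 j)).
by apply/funext => c; apply/funext => x; rewrite mxE.
Qed.

Lemma gen_metric i j : gen (fun c x => metric c x i j).
Proof.
have gP := gen_met1; have gQ := gen_met2.
have gS := generated_mul gen_pot12 gen_inner; have gT := generated_mul gen_pot12 gen_cross.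
have gTN := gen_opp gT; have gTNN := gen_opp gTN.
have g0 : gen (fun _ _ => 0) by exact: gen_const.
have g00 : gen (fun _ _ => - 0) by exact: gen_const.
rewrite (_ : (fun c x => _) = fun c x => nth 0 (nth [::]
  [:: [:: met1 c x; 0; pot12 c x * inner x; pot12 c x * cross x];
      [:: - 0; met1 c x; - (pot12 c x * cross x); pot12 c x * inner x];
      [:: pot12 c x * inner x; - (pot12 c x * cross x); met2 c x; 0];
      [:: - - (pot12 c x * cross x); pot12 c x * inner x; - 0; met2 c x]] i) j); last first.
  by apply/funext => c; apply/funext => x; rewrite mxE.
by move: i j; apply: ord4P; apply: ord4P; [exact: gP|exact: g0|exact: gS|exact: gT
  |exact: g00|exact: gP|exact: gTN|exact: gS|exact: gS|exact: gTN|exact: gQ|exact: g0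
  |exact: gTNN|exact: gS|exact: g00|exact: gQ].
Qed.

Section FixedParam.
Variable c : R.
Hypothesis c0 : 0 <= c.

Let w0 x : width_sum c x != 0. Proof. by rewrite lt0r_neq0 // width_sum_gt0. Qed.
Let p0 x : profile c (sol_v c x) != 0. Proof. by rewrite lt0r_neq0 // profile_gt0. Qed.
Let c10 : 1 + c != 0. Proof. by rewrite lt0r_neq0 // ltr_wpDr. Qed.

Lemma met1_gt0 x : 0 < met1 c x.
Proof.
rewrite /met1 !mulr_gt0 ?invr_gt0 ?quot1_gt0 ?width_sum_gt0 //.
rewrite ltr_wpDr ?mulr_ge0 ?sol_u_ge0 ?sol_v_ge0 ?(ltW (profile_gt0 _ c0)) // exprn_gt0 //.
by rewrite ltr_wpDr // sol_v_ge0.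
Qed.

(** The factors of quot1 and quot2 cancel up to exp(c u - c v); this is what makes
    the Ricci potential equal to the Hamiltonian. *)
Lemma metric_det x :
  met1 c x * met2 c x - pot12 c x * inner x * (pot12 c x * inner x)
    - pot12 c x * cross x * (pot12 c x * cross x)
  = (1 + c)^-1 * expR (- 2) * expR (- ham c x).
Proof.
have -> : met1 c x * met2 c x - pot12 c x * inner x * (pot12 c x * inner x)
    - pot12 c x * cross x * (pot12 c x * cross x)
  = met1 c x * met2 c x - pot12 c x ^+ 2 * (rad1 x * rad2 x) by rewrite -inner_cross; ring.
have -> : met1 c x * met2 c x - pot12 c x ^+ 2 * (rad1 x * rad2 x)
   = (1 + c)^-1 ^+ 2 * (quot1 c x * quot2 c x * profile c (sol_v c x)).
  rewrite /met1 /met2 /pot12; have := quot1E c x; have := quot2E c0 x; have := w0 x.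
  rewrite width_sum_def; move: (profile _ _) (quot1 c x) (quot2 c x) (rad1 x) (rad2 x) => p e1 e2 r1 r2.
  move: (sol_u c x) (sol_v c x) => u v W0 VE UE; subst u v.
  by field_assumption.
have -> : quot1 c x * quot2 c x * profile c (sol_v c x) = (1 + c) * (expR (- 2) * expR (- ham c x)).
  rewrite quot1_def quot2_def mulrA (mulfVK (p0 x)) mulrCA -!expRD /ham; congr (_ * expR _).
  by move: (sol_v c x) (sol_u c x) (prim c (sol_v c x)) => d b a; ring.
by field_assumption.
Qed.

Lemma metric_det_gt0 x : 0 < met1 c x * met2 c x - pot12 c x * inner x * (pot12 c x * inner x)
    - pot12 c x * cross x * (pot12 c x * cross x).
Proof. by rewrite metric_det !mulr_gt0 ?expR_gt0 // invr_gt0 ltr_wpDr. Qed.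

Let rd (F a b : V -> R) : (forall x, radial_at x F (a x) (b x)) ->
  forall i x, partial i F x = a x * drad1 i x + b x * drad2 i x.
Proof. by move=> H i x; exact: partial_is_derive (H x i). Qed.

Lemma metric_kform x j k : kform (metric c) x j k =
  2^-1 * (partial j (radial_form (pot1 c) (pot2 c) k) x - partial k (radial_form (pot1 c) (pot2 c) j) x).
Proof.
have s1 := gen_smooth gen_pot1 c0; have s2 := gen_smooth gen_pot2 c0.
rewrite (d_radial_form s1 s2 (rd (radial_pot1 c0)) (rd (radial_pot2 c0))).
rewrite mulKf ?pnatr_eq0 // (met1E c0) (met2E c0); congr ((_ *m _) j k).
Qed.

Lemma metric_smooth : smooth_mx (metric c).
Proof. by move=> i j; exact: gen_smooth (gen_metric i j) c0. Qed.

Lemma metric_kahler : kahler (metric c).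
Proof.
split; first split.
- by move=> i j; exact: metric_smooth.
- by move=> x; exact: hmxT.
- by move=> x Y; apply: hmx_gt0; [exact: met1_gt0|exact: metric_det_gt0].
- by move=> x; exact: hmx_invariant.
- apply: (@closed_radial R _ (pot1 c) (pot2 c)); [exact: gen_smooth gen_pot1 c0
    |exact: gen_smooth gen_pot2 c0|exact: metric_kform].
Qed.

Lemma ddc_ham x : ddc (ham c) x = (4 * c) *: (J *m hmx (hes1 c x) (hes2 c x)
  (dham12 c x * inner x) (dham12 c x * cross x)).
Proof.
have s1 := gen_smooth gen_dham1 c0; have s2 := gen_smooth gen_dham2 c0.
have sm : smooth (fun x => sol_v c x - sol_u c x) by exact: gen_smooth (gen_sub (gen_v R) (gen_u R)) c0.
have := @ddc_radial R (fun x => sol_v c x - sol_u c x) (dham1 c) (dham2 c) (dham11 c) (dham12 c) (dham22 c) x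
  s1 s2 (rd (radial_ham c0)) (rd (radial_dham1 c0)) (rd (radial_dham2 c0)).
rewrite (hes1E c0) (hes2E c0) mulrC -scalerA => <-.
exact: ddcZ sm.
Qed.

Lemma smooth_ham : smooth (ham c). Proof. exact: gen_smooth gen_ham c0. Qed.

Lemma metric_ricci : (forall x j k, ricci (metric c) x j k =
    - (2^-1 * (partial j (partial k (fun y => - ham c y)) x
     + \sum_m \sum_l J k m * (J j l * partial l (partial m (fun y => - ham c y)) x)))) /\
  (forall x, ricci_form (metric c) x = - 2^-1 *: ddc (fun y => - ham c y) x).
Proof.
apply: (@ricci_hmx R (met1 c) (met2 c) (fun x => pot12 c x * inner x) (fun x => pot12 c x * cross x)
  ((1 + c)^-1 * expR (- 2)) (fun y => - ham c y)).
- exact: gen_smooth gen_met1 c0.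
- exact: gen_smooth gen_met2 c0.
- exact: gen_smooth (generated_mul gen_pot12 gen_inner) c0.
- exact: gen_smooth (generated_mul gen_pot12 gen_cross) c0.
- exact: smoothN smooth_ham.
- by rewrite mulr_gt0 ?expR_gt0 // invr_gt0 ltr_wpDr.
- exact: metric_det.
- exact: metric_kahler.
Qed.

Lemma soliton_field_smooth : smooth_map (soliton_field c).
Proof. by move=> j; exact: gen_smooth (gen_soliton_field j) c0. Qed.

Lemma soliton_field_holomorphic : real_holomorphic (soliton_field c).
Proof.
split; first exact: soliton_field_smooth.
move=> x; have E i j : jac (soliton_field c) x i j =
    2 * c * ((1 + c) * partial i (eta2 j) x - partial i (eta1 j) x).
  rewrite mxE (_ : (fun y => _) = fun y => 2 * c * ((1 + c) * eta2 j y - eta1 j y)); last first.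
    by apply/funext => y; rewrite mxE.
  have s1 := smoothM (smooth_cst (1 + c)) (smooth_eta2 R j).
  rewrite (partialZ _ _ _ (smoothB s1 (smooth_eta1 R j))) (partialB _ _ s1 (smooth_eta1 R j)).
  by rewrite (partialZ _ _ _ (smooth_eta2 R j)).
apply: matrix4P; apply: ord4P; rewrite !mulmxE4 !E !JmxE !partial_eta1 !partial_eta2 /=; ring.
Qed.

Lemma soliton_field_hamiltonian : hamiltonian (metric c) (soliton_field c) (ham c).
Proof.
split; first exact: smooth_ham.
move=> x k.
have -> : partial k (ham c) x = c * (dham1 c x * drad1 k x + dham2 c x * drad2 k x).
  have := radial_scale c (radial_ham c0 x) k.
  by move/partial_is_derive; rewrite /ham => ->; ring.
have EX j : soliton_field c x 0 j = 2 * c * ((1 + c) * eta2 j x - eta1 j x) by rewrite mxE.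
have K j l : kform (metric c) x j l = (J *m metric c x) j l by [].
have D1 : dham1 c x = (1 + c) * (pot12 c x * rad2 x) - met1 c x.
  rewrite /dham1 /met1 /pot12; have := quot1E c x; have := quot2E c0 x; have := w0 x.
  rewrite width_sum_def; move: (profile _ _) (quot1 c x) (quot2 c x) (rad1 x) (rad2 x) => p e1 e2 r1 r2.
  move: (sol_u c x) (sol_v c x) => u v W0 VE UE; subst u v.
  by field_assumption.
have D2 : dham2 c x = (1 + c) * met2 c x - pot12 c x * rad1 x.
  rewrite /dham2 /met2 /pot12; have := quot1E c x; have := quot2E c0 x; have := w0 x.
  rewrite width_sum_def; move: (profile _ _) (quot1 c x) (quot2 c x) (rad1 x) (rad2 x) => p e1 e2 r1 r2.
  move: (sol_u c x) (sol_v c x) => u v W0 VE UE; subst u v.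
  by field_assumption.
rewrite D1 D2 mulmxE4 !EX !K !mulmxE4 !JmxE /metric !mxE /eta1 /eta2 /drad1 /drad2 /inner /cross /rad1 /rad2.
move: (met1 c x) (met2 c x) (pot12 c x) => m1 m2 t.
by move: k; apply: ord4P => /=; ring.
Qed.

Lemma metric_soliton : steady_gkrs (metric c) (soliton_field c).
Proof.
split; [exact: metric_kahler|exact: soliton_field_holomorphic
  |by exists (ham c); exact: soliton_field_hamiltonian|].
move=> x; have [_ ->] := metric_ricci; rewrite (ddcN x smooth_ham).
have [[_ gT _] gJ cg] := metric_kahler.
by rewrite (lie2_hamiltonian x metric_smooth gT gJ cg soliton_field_smooth soliton_field_hamiltonian).
Qed.

End FixedParam.
End SolitonFamily.

(** * Torus invariance and Taub-NUT *)

Section TorusInvariance.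
Variable R : realType.
Notation V := 'rV[R]_4.
Notation J := (@Jmx R).
Implicit Types (c : R) (x y : V) (i j k : 'I_4).

Opaque partial smooth Jmx sol_u sol_v quot1 quot2 width_sum prim profile dprofile.

Lemma rotmx_cmx (c1 s1 c2 s2 : R) : rotmx c1 s1 c2 s2 = cmx c1 s1 0 0 0 0 c2 s2.
Proof.
by apply: matrix4P; apply: ord4P; rewrite /rotmx mxE mulmxE4 !JmxE !mxE /=; ring.
Qed.

Section Rotation.
Variables (c1 s1 c2 s2 : R).
Hypotheses (H1 : c1 ^+ 2 + s1 ^+ 2 = 1) (H2 : c2 ^+ 2 + s2 ^+ 2 = 1).
Notation A := (cmx c1 s1 0 0 0 0 c2 s2).

Lemma rot_coord x : [/\ (x *m A) 0 o0 = x 0 o0 * c1 - x 0 o1 * s1,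
  (x *m A) 0 o1 = x 0 o0 * s1 + x 0 o1 * c1,
  (x *m A) 0 o2 = x 0 o2 * c2 - x 0 o3 * s2 & (x *m A) 0 o3 = x 0 o2 * s2 + x 0 o3 * c2].
Proof. by split; rewrite mulmxE4 !mxE /=; ring. Qed.

Lemma rad1_rot x : rad1 (x *m A) = rad1 x.
Proof.
rewrite /rad1; have [-> -> _ _] := rot_coord x; rewrite -[RHS]mulr1 -H1.
by move: (x 0 o0) (x 0 o1) => a b; ring.
Qed.

Lemma rad2_rot x : rad2 (x *m A) = rad2 x.
Proof.
rewrite /rad2; have [_ _ -> ->] := rot_coord x; rewrite -[RHS]mulr1 -H2.
by move: (x 0 o2) (x 0 o3) => a b; ring.
Qed.

Lemma sol_u_rot c x : sol_u c (x *m A) = sol_u c x.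
Proof. by have [] := sol_rad c (rad1_rot x) (rad2_rot x). Qed.

Lemma sol_v_rot c x : sol_v c (x *m A) = sol_v c x.
Proof. by have [] := sol_rad c (rad1_rot x) (rad2_rot x). Qed.

(** Rotations multiply conj(z1) z2 by a unit complex number, and the metric is
    otherwise a function of |z1|^2 and |z2|^2. *)
Lemma metric_rot c x : A *m metric c (x *m A) *m A^T = metric c x.
Proof.
have Q1 : quot1 c (x *m A) = quot1 c x by rewrite quot1_def sol_v_rot sol_u_rot.
have Q2 : quot2 c (x *m A) = quot2 c x by rewrite quot2_def sol_v_rot sol_u_rot.
have W : width_sum c (x *m A) = width_sum c x by rewrite width_sum_def sol_v_rot sol_u_rot.
have -> : metric c (x *m A) = hmx (met1 c x) (met2 c x)
    (pot12 c x * inner (x *m A)) (pot12 c x * cross (x *m A)).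
  by rewrite /metric /met1 /met2 /pot12 Q1 Q2 W sol_v_rot sol_u_rot.
rewrite /metric; move: (met1 c x) (met2 c x) (pot12 c x) => P Q t.
rewrite /inner /cross; have [-> -> -> ->] := rot_coord x.
move: (x 0 o0) (x 0 o1) (x 0 o2) (x 0 o3) => a b d e.
pose n1 := c1 ^+ 2 + s1 ^+ 2; pose n2 := c2 ^+ 2 + s2 ^+ 2.
transitivity (hmx (n1 * P) (n2 * Q) (n1 * n2 * (t * (a * d + b * e))) (n1 * n2 * (t * (a * e - b * d)))).
  by rewrite /n1 /n2; apply: matrix4P; apply: ord4P; rewrite !mulmxE4 !mxE /=; ring.
by rewrite /n1 /n2 H1 H2 !mul1r.
Qed.

Lemma soliton_field_rot c x : soliton_field c (x *m A) = soliton_field c x *m A.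
Proof.
have E : forall j, soliton_field c (x *m A) 0 j = (soliton_field c x *m A) 0 j.
  have [X0 X1 X2 X3] := rot_coord x.
  apply: ord4P; rewrite mulmxE4 !mxE /eta1 /eta2 /= ?X0 ?X1 ?X2 ?X3; ring.
by apply/rowP.
Qed.

End Rotation.

Lemma metric_torus_invariant c : torus_invariant (metric c) (soliton_field c).
Proof.
move=> c1 s1 c2 s2 H1 H2 x /=; rewrite rotmx_cmx; split.
- exact: metric_rot.
- exact: soliton_field_rot.
Qed.

Lemma metric_continuous_family i j : continuous_family (@nonneg R) (fun c x => metric c x i j).
Proof.
have H : smooth_family (@nonneg R) _ := gen_smooth_family (gen_metric R i j).
exact: (smooth_family_continuous H).
Qed.

Lemma soliton_field_continuous_family j :
  continuous_family (@nonneg R) (fun c x => soliton_field c x 0 j).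
Proof.
have H : smooth_family (@nonneg R) _ := gen_smooth_family (gen_soliton_field R j).
exact: (smooth_family_continuous H).
Qed.

End TorusInvariance.

Section TaubNUT.
Variable R : realType.
Notation V := 'rV[R]_4.
Implicit Types (x : V) (v : R).

Lemma profile0 v : profile 0 v = 1. Proof. by rewrite /profile mul0r addr0. Qed.

Lemma prim_param0 v : 0 <= v -> prim 0 v = v.
Proof.
move=> v0; have [t _] := @mvt_nonneg R (prim 0) (fun t => (profile 0 t)^-1) 0 v (lexx 0) v0
  (fun t t0 => is_derive_prim (lexx 0) (lt_le_trans (ltrN10 R) t0)).
by rewrite prim0 !subr0 profile0 invr1 mul1r.
Qed.

Definition nut1 x : R := - sol_u 0 x.
Definition nut2 x : R := 1 + sol_v 0 x.

Lemma nut_coordinates : taub_nut_coordinates nut1 nut2.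
Proof.
move=> x; have u0 := sol_u_ge0 0 x; have v0 := sol_v_ge0 (lexx 0) x.
have -> : inord 0 = o0 by apply: val_inj; rewrite /= inordK.
have -> : inord 1 = o1 by apply: val_inj; rewrite /= inordK.
have -> : inord 2 = o2 by apply: val_inj; rewrite /= inordK.
have -> : inord 3 = o3 by apply: val_inj; rewrite /= inordK.
have P1 := quot1E 0 x; have P2 := quot2E (lexx 0) x; rewrite /nut1 /nut2.
move: P1 P2; rewrite quot1_def quot2_def profile0 (prim_param0 v0) /rad1 /rad2.
rewrite invr1 mulr1 !mul0r addr0 !mul1r subr0.
have solve (r s u t : R) : r * expR s = u -> t = - s -> r = expR t * u.
  by move=> <- ->; rewrite mulrCA -expRD addNr expR0 mulr1.
move: (sol_u 0 x) (sol_v 0 x) u0 v0 => u v u0 v0 P1 P2; split.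
- by rewrite oppr_le0.
- by rewrite lerDl.
- rewrite !expr2 (solve _ _ _ (1 + u - v) P1); last by ring.
  rewrite mulrN !mulNr opprK -expRD; congr (expR _ * _); ring.
- rewrite !expr2 (solve _ _ _ (1 + v - u) P2); last by ring.
  by rewrite [1 + v]addrC addrK; congr (expR _ * _); ring.
Qed.

Notation H := (taub_nut_potential nut1 nut2).

(** For c = 0 the factors p and k are 1, and w cancels in the radial derivatives
    (1 + v) e1 and (1 + u) e2 of the potential. *)
Lemma radial_nut_potential x : radial_at x H (pot1 0 x) (pot2 0 x).
Proof.
have n1 := radialN (radial_u (lexx 0) x); have n2 := radialD (radial_cst x 1) (radial_v (lexx 0) x).
have m1 := radialB n1 (radial_cst x 1).
have := radial_scale 2^-1 (radialD (radialM m1 m1) (radialM n2 n2)).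
rewrite (_ : (fun y => _) = H); last by apply/funext => y; rewrite /H !expr2.
have w0 : width_sum 0 x != 0 by rewrite lt0r_neq0 // width_sum_gt0.
apply: radial_at_eq; rewrite /pot1 /pot2 profile0 ?addr0 ?invr1; move: w0; rewrite width_sum_def;
 move: (quot1 0 x) (quot2 0 x) (sol_u 0 x) (sol_v 0 x) => a b u v w0; by field_assumption.
Qed.

Lemma metric0_taub_nut : taub_nut (metric (0 : R)).
Proof.
exists 4^-1, nut1, nut2; split.
- by rewrite invr_gt0.
- exact: nut_coordinates.
- apply: (gen_smooth (F := fun c x => 2^-1 * ((- sol_u c x - 1) ^+ 2 + (1 + sol_v c x) ^+ 2))) (lexx 0).
  apply: generated_mul (gen_const _) (generated_add (gen_sqr _) (gen_sqr (gen_one_v R))).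
  exact: gen_sub (gen_opp (gen_u R)) (gen_const 1).
- move=> x.
  have rd (F a b : V -> R) : (forall x, radial_at x F (a x) (b x)) ->
    forall i x, partial i F x = a x * drad1 i x + b x * drad2 i x.
    by move=> HF i y; exact: partial_is_derive (HF y i).
  have := @ddc_radial R H (pot1 0) (pot2 0) (pot11 0) (pot12 0) (pot22 0) x
    (gen_smooth (gen_pot1 R) (lexx 0)) (gen_smooth (gen_pot2 R) (lexx 0))
    (rd _ _ _ radial_nut_potential) (rd _ _ _ (radial_pot1 (lexx 0))) (rd _ _ _ (radial_pot2 (lexx 0))).
  move=> ->; rewrite scalerA mulVf ?pnatr_eq0 // scale1r /kform.
  by rewrite (met1E (lexx 0)) (met2E (lexx 0)).
Qed.

Lemma metric0_ricci_flat x : ricci (metric (0 : R)) x = 0.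
Proof.
have [E _] := metric_ricci (lexx (0 : R)); apply/matrixP => j k; rewrite E mxE.
have -> : (fun y : V => - ham 0 y) = fun=> 0 by apply/funext => y; rewrite /ham mul0r oppr0.
have P0 m : partial m (fun=> 0) = (fun=> 0) :> (V -> R) by apply/funext => y; exact: partial_cst.
rewrite !P0 big1 ?addr0 ?mulr0 ?oppr0 // => m _; rewrite big1 // => l _.
by rewrite !P0 !mulr0.
Qed.

End TaubNUT.

(** * Completeness from a proper function *)

Section RiemannianDistance.
Variable R : realType.
Notation V := 'rV[R]_4.
Notation mu := (@lebesgue_measure R).
Implicit Types (x y z : V) (i j k : 'I_4) (c : R -> V).

Opaque partial smooth.

Section Metric.
Variable g : V -> 'M[R]_4.
Hypothesis gc : forall i j, continuous (fun x => g x i j).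

Definition speed c t : R := Num.sqrt ((derive1 c t *m g (c t) *m (derive1 c t)^T) 0 0).

Lemma C1_curve_continuous c : C1_curve c -> continuous c.
Proof. by case=> dc _ t; apply: differentiable_continuous; apply/derivable1_diffP. Qed.

Lemma continuous_coord (T : topologicalType) (c : T -> V) k : continuous c -> continuous (fun t => c t 0 k).
Proof. move=> cc t; apply: (@cvg_comp _ _ _ c (fun y : V => y 0 k) _ (nbhs (c t))); first exact: cc.
exact: coord_continuous. Qed.

Lemma quad_sum (Y : V) (M : 'M[R]_4) : (Y *m M *m Y^T) 0 0 = \sum_j \sum_i Y 0 i * M i j * Y 0 j.
Proof.
rewrite mxE; apply: eq_bigr => j _; rewrite !mxE mulr_suml.
by apply: eq_bigr => i _.
Qed.

Lemma continuous_speed c : C1_curve c -> continuous (speed c).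
Proof.
move=> Cc t; have [_ c'c] := Cc; have cc := C1_curve_continuous Cc.
rewrite /speed; apply: (@cvg_comp _ _ _ _ (@Num.sqrt R) _ (nbhs ((derive1 c t *m g (c t) *m (derive1 c t)^T) 0 0)));
  last exact: sqrt_continuous.
rewrite (_ : (fun s => _) = fun s => \sum_j \sum_i derive1 c s 0 i * g (c s) i j * derive1 c s 0 j);
  last by apply/funext => s; exact: quad_sum.
rewrite quad_sum; apply: cvg_bigsum => j; apply: cvg_bigsum => i.
have cd k : derive1 c s 0 k @[s --> t] --> derive1 c t 0 k.
  exact: (@continuous_coord _ (derive1 c) k c'c t).
apply: cvgM; last exact: cd.
apply: cvgM; first exact: cd.
by apply: (@cvg_comp _ _ _ c (fun y => g y i j) _ (nbhs (c t))); [exact: cc|exact: gc].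
Qed.

Lemma integrable01 (f : R -> R) : continuous f -> mu.-integrable `[0%R, 1%R] (EFin \o f).
Proof.
by move=> cf; apply: continuous_compact_integrable (@segment_compact R 0 1) _; exact: continuous_subspaceT.
Qed.

(** The derivative of f along c is bounded by the speed of c. *)
Lemma le_curve_length (f : V -> R) c : C1 f ->
  (forall x (Y : V), (\sum_k partial k f x * Y 0 k) ^+ 2 <= (Y *m g x *m Y^T) 0 0) ->
  C1_curve c -> `|f (c 1) - f (c 0)| <= curve_length g c.
Proof.
move=> Cf Hf Cc; have [dc c'c] := Cc; have cc := C1_curve_continuous Cc.
pose D t := \sum_k partial k f (c t) * derive1 c t 0 k.
have dF t : is_derive t (1 : R) (fun s => f (c s)) (D t) by exact: is_derive_curve.
have Dc : continuous D.
  move=> t; apply: cvg_bigsum => k; apply: cvgM; last exact: continuous_coord.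
  by apply: (@cvg_comp _ _ _ c (partial k f) _ (nbhs (c t))); [exact: cc|exact: Cf.2].
have Fc : continuous (fun s => f (c s)) by move=> t; exact: is_derive_continuous (dF t).
have FTC : \int[mu]_(t in `[0, 1]) D t = f (c 1) - f (c 0).
  rewrite /Rintegral (@continuous_FTC2 R D (fun s => f (c s)) 0 1) //.
  - exact: continuous_subspaceT.
  - split; first by move=> t _; exact: is_derive_derivable (dF t).
    + by apply: cvg_at_right_filter; exact: Fc.
    + by apply: cvg_at_left_filter; exact: Fc.
  - by move=> t _; rewrite derive1E; exact: @derive_val _ _ _ _ _ _ _ (dF t).
have m01 := @measurable_itv R `[(0 : R), 1].
have H := @le_normr_Rintegral _ _ R mu _ D m01 (integrable01 Dc).
have {}H : `|f (c 1) - f (c 0)| <= \int[mu]_(t in `[0, 1]) `|D t| by rewrite -FTC; exact: H.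
apply: (le_trans H).
have nDc : continuous (fun t => `|D t|).
  by move=> t; apply: cvg_norm; exact: Dc.
apply: le_Rintegral => //; [exact: integrable01|exact: integrable01 (continuous_speed Cc)|].
by move=> t _; rewrite /= -sqrtr_sqr; apply: ler_wsqrtr; exact: Hf.
Qed.

Lemma le_piecewise_length (f : V -> R) x y L : C1 f ->
  (forall x (Y : V), (\sum_k partial k f x * Y 0 k) ^+ 2 <= (Y *m g x *m Y^T) 0 0) ->
  piecewise_C1 g x y L -> `|f y - f x| <= L.
Proof.
move=> Cf Hf; elim => {x y L} [x|c y L Cc _ IH]; first by rewrite subrr normr0.
rewrite [_ + L]addrC; apply: le_trans (ler_distD (f (c 1)) _ _) _.
by apply: lerD => //; exact: le_curve_length.
Qed.

Lemma curve_length_ge0 c : 0 <= curve_length g c.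
Proof. by apply: Rintegral_ge0 => t _; exact: sqrtr_ge0. Qed.

Lemma piecewise_ge0 x y L : piecewise_C1 g x y L -> 0 <= L.
Proof. by elim => {x y L} // c y L _ _ L0; rewrite addr_ge0 ?curve_length_ge0. Qed.

Lemma piecewise_cat x y z L L' : piecewise_C1 g x y L -> piecewise_C1 g y z L' ->
  piecewise_C1 g x z (L + L').
Proof.
move=> H; elim: H z L' => {x y L} [x z L'|c y L Cc _ IH z L' H']; first by rewrite add0r.
by rewrite -addrA; apply: piecewise_cons => //; exact: IH.
Qed.

Definition segment x y (t : R) : V := t *: (y - x) + x.

Lemma is_derive_segment x y t : is_derive t (1 : R) (segment x y) (y - x).
Proof.
have : is_derive t (1 : R) (fun s : R => s *: (y - x)) (y - x).
  apply: is_derive_cvg; apply: cvg_near_cst; near=> h.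
  have h0 : h != 0 by near: h; exact: nbhs_dnbhs_neq.
  have -> : h *: (1 : R) = h by rewrite /GRing.scale /= mulr1.
  by rewrite scalerDl addrK scalerA mulVf // scale1r.
move=> H; rewrite -[y - x]addr0; have Hx := is_derive_cst x t (1 : R).
have := @is_deriveD _ _ _ _ _ _ _ _ _ H Hx.
by [].
Unshelve. all: by end_near.
Qed.

Lemma derive1_segment x y : derive1 (segment x y) = fun=> y - x.
Proof.
by apply/funext => t; rewrite derive1E; exact: @derive_val _ _ _ _ _ _ _ (is_derive_segment x y t).
Qed.

Lemma C1_segment x y : C1_curve (segment x y).
Proof.
split; first by move=> t; exact: is_derive_derivable (is_derive_segment x y t).
by rewrite derive1_segment => t; exact: cvg_cst.
Qed.

Lemma piecewise_segment x y : piecewise_C1 g x y (curve_length g (segment x y)).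
Proof.
have := piecewise_cons (C1_segment x y) (piecewise_nil g (segment x y 1)).
have E0 : segment x y 0 = x by rewrite /segment scale0r add0r.
have E1 : segment x y 1 = y by rewrite /segment scale1r subrK.
by rewrite addr0 E0 E1.
Qed.

Let lengths_inf x y : has_inf [set L | piecewise_C1 g x y L].
Proof.
split; first by exists (curve_length g (segment x y)); exact: piecewise_segment.
by exists 0 => L; exact: piecewise_ge0.
Qed.

Lemma rdist_le x y L : piecewise_C1 g x y L -> rdist g x y <= L.
Proof. by move=> H; apply: ge_inf => //; case: (lengths_inf x y). Qed.

Lemma le_rdist x y a : (forall L, piecewise_C1 g x y L -> a <= L) -> a <= rdist g x y.
Proof. by move=> H; apply: lb_le_inf => //; case: (lengths_inf x y). Qed.

Lemma rdist_ge0 x y : 0 <= rdist g x y.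
Proof. by apply: le_rdist => L; exact: piecewise_ge0. Qed.

Lemma rdist_triangle y x z : rdist g x z <= rdist g x y + rdist g y z.
Proof.
rewrite -lerBlDr; apply: le_rdist => L HL; rewrite lerBlDr -lerBlDl.
apply: le_rdist => L' HL'; rewrite lerBlDl; apply: rdist_le.
exact: piecewise_cat HL HL'.
Qed.

(** Near l the entries of g are bounded, so straight segments are short. *)
Lemma rdist_near l : exists2 K, 0 <= K & \forall x \near l, rdist g x l <= K * `|x - l|.
Proof.
pose a := \sum_i \sum_j (`|g l i j| + 1); pose K := Num.sqrt a.
have entry : \forall x \near l, forall ij : 'I_4 * 'I_4, `|g x ij.1 ij.2| <= `|g l ij.1 ij.2| + 1.
  refine (@filter_forall V _ (fun (ij : 'I_4 * 'I_4) x => `|g x ij.1 ij.2| <= `|g l ij.1 ij.2| + 1) (nbhs l) _ _).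
  move=> [i j] /=; have gl := cvg_norm (@gc i j l).
  by apply: (cvgr_le _ (gl _)); rewrite ltrDl.
have [r /= r0 Hr] := (nbhs_ballP _ _).1 entry.
exists K; first exact: sqrtr_ge0.
apply/nbhs_ballP; exists r => //= x; rewrite -ball_normE /= distrC => xl.
apply: le_trans (rdist_le (piecewise_segment x l)) _.
have -> : K * `|x - l| = \int[mu]_(t in `[0, 1]) (cst (K * `|x - l|) t).
  rewrite Rintegral_cst //= lebesgue_measure_itv /= lte_fin ltr01 oppr0 adde0 mulr1 //.
apply: le_Rintegral => //.
- exact: integrable01 (continuous_speed (C1_segment x l)).
- by apply: integrable01 => t; exact: cvg_cst.
move=> t /=; rewrite in_itv /= => /andP[t0 t1]; rewrite derive1_segment.
have tl : `|segment x l t - l| < r.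
  have -> : segment x l t - l = (1 - t) *: (x - l).
    by apply/rowP => k; rewrite !mxE; ring.
  rewrite normrZ; apply: le_lt_trans xl; rewrite ler_piMl // ger0_norm ?subr_ge0 //.
  by rewrite gerBl.
have Hb : ball l r (segment x l t) by rewrite -ball_normE /= distrC.
have bd i j : `|g (segment x l t) i j| <= `|g l i j| + 1 by exact: (Hr _ Hb (i, j)).
rewrite distrC -[leRHS]ger0_norm ?mulr_ge0 ?sqrtr_ge0 // -sqrtr_sqr; apply: ler_wsqrtr.
rewrite exprMn sqr_sqrtr; last by rewrite !sumr_ge0 // => i _; rewrite sumr_ge0 // => j _; rewrite addr_ge0.
rewrite quad_sum exchange_big /= mulr_suml; apply: ler_sum => i _; rewrite mulr_suml.
apply: ler_sum => j _; apply: le_trans (ler_norm _) _.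
rewrite !normrM.
rewrite expr2 mulrA [`|_ 0 i| * _]mulrC.
apply: ler_pM; rewrite ?mulr_ge0 ?le_row_norm //.
by apply: ler_pM; rewrite ?le_row_norm.
Qed.

(** The function f is bounded on a Cauchy sequence, since it is 1-Lipschitz for the
    distance. As f is proper, the sequence has a cluster point, and this is a
    limit for the distance by rdist_near. *)
Lemma complete_of_proper (f : V -> R) : C1 f ->
  (forall x (Y : V), (\sum_k partial k f x * Y 0 k) ^+ 2 <= (Y *m g x *m Y^T) 0 0) ->
  (forall a, exists b, forall x, `|f x| <= a -> `|x| <= b) -> complete_metric g.
Proof.
move=> Cf Hf proper u cauchy.
have lip x y : `|f x - f y| <= rdist g y x.
  by apply: le_rdist => L; exact: le_piecewise_length.
have [N HN] := cauchy 1 ltr01.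
have [b Hb] := proper (`|f (u N)| + 1).
have bounded n : (N <= n)%N -> `|u n| <= b.
  move=> Nn; apply: Hb; rewrite -[f (u n)](subrK (f (u N))).
  rewrite addrC; apply: le_trans (ler_normD _ _) _; rewrite lerD2l.
  by apply: le_trans (lip _ _) (ltW (HN _ _ _ _)).
have Bc : compact [set x : V | `|x| <= b].
  apply: bounded_closed_compact.
    by exists b; split; [exact: num_real|move=> t bt x /= /le_trans; apply; exact: ltW].
  rewrite (_ : [set x : V | _] = (fun x : V => `|x|) @^-1` [set r | r <= b]) //.
  apply: preimage_closed => [x _|]; [exact: norm_continuous|exact: closed_le].
have uB : (u @ \oo) [set x : V | `|x| <= b] by exists N => // n /= /bounded.
have [l [_ cl]] := Bc (u @ \oo) (fmap_proper_filter u _) uB.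
have [K K0 near_l] := rdist_near l.
exists l; apply/cvgrPdist_le => e e0.
have e20 : 0 < e / 2 by rewrite divr_gt0.
have [M HM] := cauchy (e / 2) e20.
have UM : (u @ \oo) [set x | exists2 n, (M <= n)%N & x = u n].
  by exists M => // n /= Mn; exists n.
have Ul : nbhs l [set x | rdist g x l <= K * `|x - l| /\ K * `|x - l| <= e / 2].
  apply: filterI => //.
  apply/nbhs_ballP; exists (e / 2 / (K + 1)); first by rewrite /= divr_gt0 // ltr_wpDl.
  move=> x; rewrite -ball_normE /= distrC => xl.
  have K1 : 0 < K + 1 by rewrite ltr_wpDl.
  apply: le_trans (_ : (K + 1) * `|x - l| <= _); first by rewrite ler_wpM2r // lerDl.
  by rewrite mulrC -ler_pdivlMr // ltW.
have [x [[n Mn ->] [h1 h2]]] := cl _ _ UM Ul.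
exists M => // m /= Mm; rewrite sub0r normrN ger0_norm ?rdist_ge0 //.
apply: le_trans (rdist_triangle (u n) _ _) _; rewrite [leRHS]splitr.
by apply: lerD; [exact: ltW (HM _ _ Mm Mn)|exact: le_trans h1 h2].
Qed.

End Metric.
End RiemannianDistance.

(** * Completeness of the solitons *)

Section Completeness.
Variable R : realType.
Notation V := 'rV[R]_4.
Implicit Types (c : R) (x y : V) (i j k : 'I_4).

Opaque partial smooth Jmx sol_u sol_v quot1 quot2 width_sum prim profile dprofile.

(** The Cauchy-Schwarz inequality for (x0, x1) and (a, b). *)
Lemma sqr_pairing_le (e w u x0 x1 a b : R) : 0 <= e -> 0 <= w -> (x0 * x0 + x1 * x1) * e = u ->
  w * u <= 1 -> (2 * w * e * (x0 * a + x1 * b)) ^+ 2 <= 4 * (w * (e * (a ^+ 2 + b ^+ 2))).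
Proof.
move=> e0 w0 uE wu.
have Q0 : 0 <= w * (e * (a ^+ 2 + b ^+ 2)) by rewrite !mulr_ge0 // addr_ge0 ?sqr_ge0.
apply: (@le_trans _ _ (4 * (w * u * (w * (e * (a ^+ 2 + b ^+ 2)))))); last first.
  by rewrite ler_wpM2l // ler_piMl.
have I0 : 0 <= (w * e * (x0 * b - x1 * a)) ^+ 2 by exact: sqr_ge0.
rewrite -subr_ge0 -uE; have := mulr_ge0 (ler0n R 4) I0.
by congr (0 <= _); ring.
Qed.

Section Energy.
Variables (k e1 e2 p w u v x0 x1 x2 x3 a0 a1 a2 a3 : R).
Hypotheses (e10 : 0 <= e1) (e20 : 0 <= e2) (p0 : 0 <= p) (w0 : 0 <= w).
Hypotheses (uE : (x0 * x0 + x1 * x1) * e1 = u) (vE : (x2 * x2 + x3 * x3) * e2 = v).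
Hypotheses (wu : w * u <= 1) (wv : w * (p * v) <= 1).

Let m := x0 * x2 + x1 * x3.
Let n := x0 * x3 - x1 * x2.
Let A0 := (1 + v) * a0 + k * e2 * (m * a2 + n * a3).
Let A1 := (1 + v) * a1 + k * e2 * (m * a3 - n * a2).
Let B0 := e1 * (m * a0 - n * a1) + k * (1 + u) * a2.
Let B1 := e1 * (m * a1 + n * a0) + k * (1 + u) * a3.
Let P := e1 * w * ((1 + v) ^+ 2 + u * v * p).
Let Q := k ^+ 2 * e2 * w * (u * v + p * (1 + u) ^+ 2).
Let T := k * e1 * e2 * w * (p * (1 + u) + (1 + v)).

(** With A = A0 + i A1 and B = B0 + i B1 the metric is w (e1 |A|^2 + p e2 |B|^2),
    w being here the inverse of 1 + u + v, and du = 2 w e1 Re(conj(z1) A),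
    dv = 2 w p e2 Re(conj(z2) B). Each of du^2 and dv^2 is then at most 4 times
    the metric by sqr_pairing_le. *)
Lemma energy_bound :
  (4^-1 * (2 * ((e1 * (1 + v) * w + v * p * e1 * w) * (x0 * a0 + x1 * a1)
    + (k * u * e2 * w + k * p * e2 * (1 + u) * w) * (x2 * a2 + x3 * a3)))) ^+ 2 <=
  P * (a0 ^+ 2 + a1 ^+ 2) + Q * (a2 ^+ 2 + a3 ^+ 2)
    + 2 * (T * m * (a0 * a2 + a1 * a3) + T * n * (a0 * a3 - a1 * a2)).
Proof.
have uv : e1 * e2 * (m ^+ 2 + n ^+ 2) = u * v by rewrite -uE -vE /m /n; ring.
have -> : P * (a0 ^+ 2 + a1 ^+ 2) + Q * (a2 ^+ 2 + a3 ^+ 2)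
    + 2 * (T * m * (a0 * a2 + a1 * a3) + T * n * (a0 * a3 - a1 * a2)) =
   w * (e1 * (A0 ^+ 2 + A1 ^+ 2)) + w * (p * e2 * (B0 ^+ 2 + B1 ^+ 2))
   + w * (p * e1 * (a0 ^+ 2 + a1 ^+ 2) + k ^+ 2 * e2 * (a2 ^+ 2 + a3 ^+ 2)) *
     (u * v - e1 * e2 * (m ^+ 2 + n ^+ 2)).
  by rewrite /P /Q /T /A0 /A1 /B0 /B1; move: m n => m' n'; ring.
rewrite uv subrr mulr0 addr0.
have -> : 2 * ((e1 * (1 + v) * w + v * p * e1 * w) * (x0 * a0 + x1 * a1)
    + (k * u * e2 * w + k * p * e2 * (1 + u) * w) * (x2 * a2 + x3 * a3)) =
  2 * w * e1 * (x0 * A0 + x1 * A1) + 2 * w * (p * e2) * (x2 * B0 + x3 * B1).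
  by rewrite /A0 /A1 /B0 /B1 -uE -vE /m /n; ring.
have HA := @sqr_pairing_le e1 w u x0 x1 A0 A1 e10 w0 uE wu.
have vE' : (x2 * x2 + x3 * x3) * (p * e2) = p * v by rewrite mulrCA vE.
have HB := @sqr_pairing_le (p * e2) w (p * v) x2 x3 B0 B1 (mulr_ge0 p0 e20) w0 vE' wv.
move: HA HB; set s := 2 * w * e1 * _; set t := 2 * w * (p * e2) * _.
have QA : 0 <= w * (e1 * (A0 ^+ 2 + A1 ^+ 2)) by rewrite !mulr_ge0 // addr_ge0 ?sqr_ge0.
have QB : 0 <= w * (p * e2 * (B0 ^+ 2 + B1 ^+ 2)) by rewrite !mulr_ge0 // addr_ge0 ?sqr_ge0.
move: QA QB; set qa := w * _; set qb := w * _ => QA QB HA HB.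
have st : 0 <= (s - t) ^+ 2 by exact: sqr_ge0.
move: s t qa qb QA QB HA HB st => s t qa qb QA QB HA HB st.
by nra.
Qed.

End Energy.

Lemma hmx_quadE (P Q S T : R) (Y : V) : (Y *m hmx P Q S T *m Y^T) 0 0 =
  P * (Y 0 o0 ^+ 2 + Y 0 o1 ^+ 2) + Q * (Y 0 o2 ^+ 2 + Y 0 o3 ^+ 2)
  + 2 * (S * (Y 0 o0 * Y 0 o2 + Y 0 o1 * Y 0 o3) + T * (Y 0 o0 * Y 0 o3 - Y 0 o1 * Y 0 o2)).
Proof.
rewrite mulmxE4 !mulmxE4 !mxE /=.
move: (Y 0 o0) (Y 0 o1) (Y 0 o2) (Y 0 o3) => a b d e; ring.
Qed.

Section FixedParam.
Variable c : R.
Hypothesis c0 : 0 <= c.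

Definition exhaustion x : R := 4^-1 * (sol_u c x + sol_v c x).

Lemma exhaustion_slope x (Y : V) :
  (\sum_k partial k exhaustion x * Y 0 k) ^+ 2 <= (Y *m metric c x *m Y^T) 0 0.
Proof.
have rad := radial_scale 4^-1 (radialD (radial_u c0 x) (radial_v c0 x)).
rewrite sum4 !(partial_is_derive (rad _)) /drad1 /drad2 /= hmx_quadE.
have w0 := width_sum_gt0 c0 x; have W := congr1 (@^~ x) (width_sum_def c).
have p0 := ltW (profile_gt0 (sol_v c x) c0).
have E1 := quot1E c x; have E2 := quot2E c0 x; have e10 := ltW (quot1_gt0 c x); have e20 := ltW (quot2_gt0 c0 x).
have PV := profileE c (sol_v c x); have X0 := expR_ge0 (- (c * sol_v c x)).
have U0 := sol_u_ge0 c x; have V0 := sol_v_ge0 c0 x.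
have wu : (width_sum c x)^-1 * sol_u c x <= 1.
  by rewrite mulrC ler_pdivrMr // mul1r W; lra.
have wv : (width_sum c x)^-1 * (profile c (sol_v c x) * sol_v c x) <= 1.
  rewrite mulrC ler_pdivrMr // mul1r W [_ * sol_v c x]mulrC PV.
  by move: (expR _) X0 => ? ?; lra.
have iw0 : 0 <= (width_sum c x)^-1 by rewrite invr_ge0 ltW.
rewrite /rad1 /rad2 in E1 E2.
have := energy_bound (1 + c)^-1 (Y 0 o0) (Y 0 o1) (Y 0 o2) (Y 0 o3) e10 e20 p0 iw0 E1 E2 wu wv.
rewrite /met1 /met2 /pot12 /inner /cross.
move: (x 0 o0) (x 0 o1) (x 0 o2) (x 0 o3) (Y 0 o0) (Y 0 o1) (Y 0 o2) (Y 0 o3).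
move=> {E1 E2 rad W wu wv PV X0 w0 p0 e10 e20 U0 V0 iw0} x0 x1 x2 x3 a0 a1 a2 a3.
move: (width_sum c x)^-1 (quot1 c x) (quot2 c x) (sol_u c x) (sol_v c x) => w e1 e2 u v.
by congr (_ <= _); ring.
Qed.

(** The defining equations express |z1|^2 and |z2|^2 by u and v, hence bound them
    where u + v is bounded. *)
Lemma exhaustion_proper a : exists b, forall x, `|exhaustion x| <= a -> `|x| <= b.
Proof.
pose s := 4 * a; pose B := (1 + s) * expR (1 + s + c * s).
exists (1 + B) => x; rewrite ger0_norm; last first.
  by rewrite mulr_ge0 ?addr_ge0 ?sol_u_ge0 ?sol_v_ge0 // invr_ge0.
rewrite ler_pdivrMl // -/s => Hs.
have U0 := sol_u_ge0 c x; have V0 := sol_v_ge0 c0 x.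
have us : sol_u c x <= s by lra.
have vs : sol_v c x <= s by lra.
have s0 : 0 <= s by exact: le_trans V0 vs.
have P0 := profile_gt0 (sol_v c x) c0.
have prim0' := prim_ge0 c0 V0; have primv := prim_le c0 V0.
have cv : c * sol_v c x <= c * s by rewrite ler_wpM2l.
have cv0 : 0 <= c * sol_v c x by rewrite mulr_ge0.
have cu0 : 0 <= (1 + c) * sol_u c x by rewrite mulr_ge0 // addr_ge0.
have r1 : rad1 x <= B.
  have -> : rad1 x = sol_u c x * expR (1 + sol_u c x - prim c (sol_v c x)).
    rewrite -[X in X * expR _](quot1E c x) quot1_def -mulrA -expRD [X in expR X](_ : _ = 0) ?expR0 ?mulr1 //.
    by move: (prim _ _) (sol_u c x) => t u; ring.
  apply: ler_pM; rewrite ?expR_ge0 //; first by apply: le_trans us _; rewrite lerDr.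
  rewrite ler_expR; move: (prim _ _) prim0' primv => t t0 tv; lra.
have r2 : rad2 x <= B.
  have -> : rad2 x = sol_v c x * profile c (sol_v c x) / (1 + c) * expR (1 + prim c (sol_v c x) + c * sol_v c x - (1 + c) * sol_u c x).
    have c10 : 1 + c != 0 by rewrite lt0r_neq0 // ltr_wpDr.
    rewrite -[X in X * profile _ _](quot2E c0 x) quot2_def.
    rewrite (_ : 1 + prim c (sol_v c x) + _ - _ = - (- 1 - prim c (sol_v c x) - c * sol_v c x + (1 + c) * sol_u c x)).
      rewrite expRN; set E := expR _; have /lt0r_neq0 E0 : 0 < E by exact: expR_gt0.
      move: E E0 => E E0; move: (rad2 x) => r; move: (profile _ _) (lt0r_neq0 P0) => p p0.
      by field_assumption.
    by move: (sol_u c x) (sol_v c x) => u v; move: (prim c v) => t; ring.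
  apply: ler_pM; rewrite ?expR_ge0 //.
  - by rewrite !mulr_ge0 ?(ltW P0) // invr_ge0 addr_ge0.
  - rewrite profileE; apply: le_trans (_ : 1 + sol_v c x <= _); last by rewrite lerD2l.
    rewrite ler_pdivrMr ?ltr_wpDr //.
    have := expR_ge0 (- (c * sol_v c x)); have := mulr_ge0 c0 V0.
    move: (expR _) => t; move: (sol_v c x) V0 => v v0 cv' t0;
    rewrite (_ : (1 + v) * (1 + c) = 1 + v + c + c * v); last by ring.
    move: (c * v) cv' => m m0; move: c0 m0 t0; clear; lra.
  - rewrite ler_expR; move: (prim _ _) prim0' primv cv cv0 cu0.
    move: (c * s) => n; move: ((1 + c) * _) => q t; move: (c * _) => m; move: Hs us vs; clear; lra.
have sq (t b : R) : 0 <= b -> t * t <= b -> `|t| <= 1 + b.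
  move=> b0 tb; rewrite -(ler_pXn2r (_ : (0 < 2)%N)) ?nnegrE ?addr_ge0 //.
  rewrite real_normK ?num_real // expr2; apply: le_trans tb _; rewrite sqrrD; nra.
have B0 : 0 <= B by rewrite mulr_ge0 ?expR_ge0 // addr_ge0.
rewrite /rad1 in r1; rewrite /rad2 in r2.
apply: row_norm_le; first by rewrite addr_ge0.
apply: ord4P; apply: sq => //.
- by apply: le_trans r1; rewrite lerDl -expr2 sqr_ge0.
- by apply: le_trans r1; rewrite lerDr -expr2 sqr_ge0.
- by apply: le_trans r2; rewrite lerDl -expr2 sqr_ge0.
- by apply: le_trans r2; rewrite lerDr -expr2 sqr_ge0.
Qed.

Lemma metric_complete : complete_metric (metric c).
Proof.
apply: (@complete_of_proper R (metric c) _ exhaustion).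
- by move=> i j x; apply: smooth_continuous; exact: metric_smooth.
- apply: smooth_C1; apply: (gen_smooth (F := fun c x => 4^-1 * (sol_u c x + sol_v c x))) c0.
  exact: generated_mul (gen_const _) (generated_add (gen_u R) (gen_v R)).
- exact: exhaustion_slope.
- exact: exhaustion_proper.
Qed.

End FixedParam.
End Completeness.

(** * Holomorphic homotheties *)

Section Rigidity.
Variable R : realType.
Notation V := 'rV[R]_4.
Notation J := (@Jmx R).
Implicit Types (c : R) (x y : V) (i j k : 'I_4).

Opaque partial smooth Jmx sol_u sol_v quot1 quot2 width_sum prim profile dprofile.

Lemma det_hmx (P Q S T : R) : \det (hmx P Q S T) = (P * Q - S * S - T * T) ^+ 2.
Proof. by rewrite det_cmx; ring. Qed.

Lemma det_congruence n (M H : 'M[R]_n) : \det (M *m H *m M^T) = \det M ^+ 2 * \det H.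
Proof. by rewrite !det_mulmx det_tr expr2 mulrAC. Qed.

Lemma hmx_pencil (s t P Q S T P' Q' S' T' : R) : s *: hmx P Q S T - t *: hmx P' Q' S' T' =
  hmx (s * P - t * P') (s * Q - t * Q') (s * S - t * S') (s * T - t * T').
Proof. by apply: matrix4P; apply: ord4P; rewrite !mxE /=; ring. Qed.

(** The Cauchy-Riemann equations of a holomorphic map, read off its Jacobian. *)
Lemma Jcommuting_cols (M : 'M[R]_4) k : M *m J = J *m M ->
  [/\ \sum_l J k l * M l o0 = - M k o1, \sum_l J k l * M l o1 = M k o0,
      \sum_l J k l * M l o2 = - M k o3 & \sum_l J k l * M l o3 = M k o2].
Proof.
move=> H; have E j : \sum_l J k l * M l j = (M *m J) k j by rewrite H [RHS]mxE.
rewrite !E !mulmxE4 !JmxE /=; move: (M k o0) (M k o1) (M k o2) (M k o3) => m0 m1 m2 m3.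
by split; ring.
Qed.

(** The Hermitian determinant of the metric, by metric_det. *)
Definition density c x : R := (1 + c)^-1 * expR (- 2) * expR (- ham c x).

Lemma density_gt0 c x : 0 <= c -> 0 < density c x.
Proof. by move=> c0; rewrite !mulr_gt0 ?expR_gt0 // invr_gt0 ltr_wpDr. Qed.

Section Pencil.
Variable c : R.
Hypothesis c0 : 0 <= c.

(** The Hermitian matrix of the Hessian of v - u. *)
Definition hess x : 'M[R]_4 := hmx (hes1 c x) (hes2 c x) (dham12 c x * inner x) (dham12 c x * cross x).

(** The eigenvalues of c hess, relative to the metric, are - pencil_root and
    pencil_root * (1 + c * w). *)
Definition pencil_root x : R := c * expR (- (c * sol_v c x)) / width_sum c x ^+ 2.

(** In the coframe that diagonalises the metric, c hess is diagonal as well. *)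
Lemma det_pencil x (t : R) : \det (c *: hess x - t *: metric c x) =
  (density c x * ((t + pencil_root x) * (t - pencil_root x * (1 + c * width_sum c x)))) ^+ 2.
Proof.
rewrite hmx_pencil det_hmx /density -(metric_det c0); congr (_ ^+ 2).
rewrite /pencil_root -[expR _](_ : 1 + sol_v c x - sol_v c x * profile c (sol_v c x) = _); last first.
  by rewrite profileE; move: (expR _) => t'; ring.
have mn := inner_cross x.
transitivity ((c * hes1 c x - t * met1 c x) * (c * hes2 c x - t * met2 c x) -
  (c * dham12 c x - t * pot12 c x) ^+ 2 * (rad1 x * rad2 x)).
  rewrite -mn; move: (hes1 c x) (hes2 c x) (dham12 c x) (met1 c x) (met2 c x) (pot12 c x).
  by move: (inner x) (cross x) => *; ring.
transitivity ((met1 c x * met2 c x - pot12 c x ^+ 2 * (rad1 x * rad2 x)) *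
  ((t + c * (1 + sol_v c x - sol_v c x * profile c (sol_v c x)) / width_sum c x ^+ 2) *
   (t - c * (1 + sol_v c x - sol_v c x * profile c (sol_v c x)) / width_sum c x ^+ 2 * (1 + c * width_sum c x)))); last first.
  rewrite -mn; congr (_ * _); move: (met1 c x) (met2 c x) (pot12 c x).
  by move: (inner x) (cross x) => *; ring.
rewrite /hes1 /hes2 /dham12 /met1 /met2 /pot12.
have w0 : width_sum c x != 0 by rewrite lt0r_neq0 // width_sum_gt0.
have c10 : 1 + c != 0 by rewrite lt0r_neq0 // ltr_wpDr.
have E1 := quot1E c x; have E2 := quot2E c0 x.
have W := congr1 (@^~ x) (width_sum_def c); rewrite /= in W.
move: w0 W E1 E2; move: (width_sum c x) (quot1 c x) (quot2 c x) (rad1 x) (rad2 x).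
move: (profile c (sol_v c x)) => p w e1 e2 r1 r2.
move: (sol_u c x) (sol_v c x) => u v w0 W E1 E2; move: w0; subst w; subst u v => w0.
by field_assumption.
Qed.

Lemma det_metric x : \det (metric c x) = density c x ^+ 2.
Proof. by rewrite det_hmx (metric_det c0). Qed.

Lemma pencil_root_ge0 x : 0 <= pencil_root x.
Proof. by rewrite /pencil_root divr_ge0 ?exprn_ge0 ?(ltW (width_sum_gt0 c0 x)) // mulr_ge0 // expR_ge0. Qed.

Lemma pencil_root_gt0 x : 0 < c -> 0 < pencil_root x.
Proof. by move=> c1; rewrite /pencil_root divr_gt0 ?exprn_gt0 ?width_sum_gt0 // mulr_gt0 // expR_gt0. Qed.

Lemma pencil_root_eq0 x : pencil_root x = 0 -> c = 0.
Proof.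
move=> rx; apply/eqP; rewrite eq_sym eq_le c0 /= leNgt; apply/negP => c1.
by have := pencil_root_gt0 x c1; rewrite rx ltxx.
Qed.

Lemma width_sum_ge1 x : 1 <= width_sum c x.
Proof. by rewrite width_sum_def -addrA lerDl addr_ge0 ?sol_u_ge0 ?sol_v_ge0. Qed.

Lemma width_sum_origin : width_sum c 0 = 1.
Proof.
rewrite width_sum_def -(quot1E c) -(quot2E c0) /rad1 /rad2 !mxE.
by rewrite !mul0r addr0 !mul0r !addr0.
Qed.

End Pencil.

Lemma jacE (phi : V -> V) x i j : jac phi x i j = partial i (fun y => phi y 0 j) x.
Proof. by rewrite mxE. Qed.

Opaque jac metric hess.

Lemma pencil_root_param0 x : pencil_root 0 x = 0.
Proof. by rewrite /pencil_root !mul0r. Qed.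

Lemma ddc_cst (a : R) x : ddc (fun=> a) x = 0.
Proof.
have E k : dc (fun=> a) k = fun=> 0.
  by apply/funext => y; rewrite /dc sum4 !partial_cst !mulr0 !addr0 oppr0.
by apply/matrixP => j k; rewrite !mxE !E !partial_cst subrr.
Qed.

Lemma Jcommuting_cancel (M A B : 'M[R]_4) (s t : R) : M *m J = J *m M ->
  M *m ((4 * s) *: (J *m A)) *m M^T = (4 * t) *: (J *m B) -> M *m (s *: A) *m M^T = t *: B.
Proof.
move=> MJ.
have -> : M *m ((4 * s) *: (J *m A)) = (4 * s) *: (J *m (M *m A)).
  by rewrite -scalemxAr [M *m (J *m A)]mulmxA MJ -mulmxA.
rewrite -scalemxAl -mulmxA => /(congr1 (mulmx J)).
rewrite -!scalemxAr !JmxAJ !scalerN => /oppr_inj; rewrite -!scalerA.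
have n4 : (4 : R) != 0 by rewrite pnatr_eq0.
by move/(scalerI n4) => <-; rewrite -scalemxAl.
Qed.

Lemma log_balance (c c' a n h h' : R) : 0 <= c -> 0 <= c' -> 0 < a -> 0 < n ->
  n * ((1 + c')^-1 * expR (- 2) * expR (- h')) = a ^+ 2 * ((1 + c)^-1 * expR (- 2) * expR (- h)) ->
  h' = h + (ln n + ln ((1 + c) / (1 + c') / a ^+ 2)).
Proof.
move=> c0 c'0 a0 n0 H.
have p1 : 0 < 1 + c by rewrite ltr_wpDr.
have p2 : 0 < 1 + c' by rewrite ltr_wpDr.
have k0 : 0 < (1 + c) / (1 + c') / a ^+ 2 by rewrite !divr_gt0 ?exprn_gt0.
rewrite -(lnM n0 k0) -[LHS]expRK -[h in RHS]expRK -lnM ?posrE ?expR_gt0 ?(mulr_gt0 n0 k0) //.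
congr ln; move: H; rewrite !expRN.
have := lt0r_neq0 (expR_gt0 h); have := lt0r_neq0 (expR_gt0 h'); have := lt0r_neq0 (expR_gt0 (2 : R)).
move: (expR h) (expR h') (expR 2) => e e' e2 e20 e'0 e0 H.
have {p1 p2} [p1 p2] : 1 + c != 0 /\ 1 + c' != 0 by rewrite !lt0r_neq0.
have a1 := lt0r_neq0 a0; have n1 := lt0r_neq0 n0.
have -> : e' = e' * e * (1 + c) / a ^+ 2 * e2 * (a ^+ 2 * ((1 + c)^-1 * e2^-1 * e^-1)).
  by field_assumption.
by rewrite -H; field_assumption.
Qed.

Section Homothety.
Variables (c c' a : R) (phi : V -> V).
Hypotheses (c0 : 0 <= c) (c'0 : 0 <= c') (a0 : 0 < a) (sphi : smooth_map phi).
Hypothesis phiJ : forall x, jac phi x *m J = J *m jac phi x.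
Hypothesis phig : forall x, jac phi x *m metric c' (phi x) *m (jac phi x)^T = a *: metric c x.

(** The real and imaginary parts of the complex determinant of dphi. *)
Definition jdet_re x : R := let m := jac phi x in
  m o0 o0 * m o2 o2 - m o0 o1 * m o2 o3 - (m o0 o2 * m o2 o0 - m o0 o3 * m o2 o1).
Definition jdet_im x : R := let m := jac phi x in
  m o0 o0 * m o2 o3 + m o0 o1 * m o2 o2 - (m o0 o2 * m o2 o1 + m o0 o3 * m o2 o0).

Lemma det_jac x : \det (jac phi x) = jdet_re x ^+ 2 + jdet_im x ^+ 2.
Proof. by rewrite {1}(Jcommuting_cmx (esym (phiJ x))) det_cmx. Qed.

Lemma holomorphic_jdet : [/\ smooth jdet_re, smooth jdet_im & holomorphic_pair jdet_re jdet_im].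
Proof.
pose f j y := phi y 0 j.
have sf j : smooth (f j) by exact: sphi.
have E i j : (fun x => jac phi x i j) = partial i (f j) by apply/funext => x; exact: jacE.
have sE i j : smooth (fun x => jac phi x i j) by rewrite E; exact: smooth_partial.
have cols k x := Jcommuting_cols k (phiJ x).
have P i j x : partial i (f j) x = jac phi x i j by rewrite jacE.
have H01 : holomorphic_pair (f o0) (f o1).
  move=> k x; have [E0 E1 _ _] := cols k x; rewrite !P -E0 -E1.
  by split; apply: eq_bigr => l _; rewrite P.
have H23 : holomorphic_pair (f o2) (f o3).
  move=> k x; have [_ _ E2 E3] := cols k x; rewrite !P -E2 -E3.
  by split; apply: eq_bigr => l _; rewrite P.
have K i : holomorphic_pair (fun x => jac phi x i o0) (fun x => jac phi x i o1).
  by rewrite !E; exact: holomorphic_pair_partial.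
have L i : holomorphic_pair (fun x => jac phi x i o2) (fun x => jac phi x i o3).
  by rewrite !E; exact: holomorphic_pair_partial.
split.
- exact: smoothB (smoothB (smoothM (sE _ _) (sE _ _)) (smoothM (sE _ _) (sE _ _)))
    (smoothB (smoothM (sE _ _) (sE _ _)) (smoothM (sE _ _) (sE _ _))).
- exact: smoothB (smoothD (smoothM (sE _ _) (sE _ _)) (smoothM (sE _ _) (sE _ _)))
    (smoothD (smoothM (sE _ _) (sE _ _)) (smoothM (sE _ _) (sE _ _))).
- apply: holomorphic_pairB.
  + exact: smoothB (smoothM (sE _ _) (sE _ _)) (smoothM (sE _ _) (sE _ _)).
  + exact: smoothD (smoothM (sE _ _) (sE _ _)) (smoothM (sE _ _) (sE _ _)).
  + exact: smoothB (smoothM (sE _ _) (sE _ _)) (smoothM (sE _ _) (sE _ _)).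
  + exact: smoothD (smoothM (sE _ _) (sE _ _)) (smoothM (sE _ _) (sE _ _)).
  + by apply: holomorphic_pairM.
  + by apply: holomorphic_pairM.
Qed.

Lemma jdet_density x : (jdet_re x ^+ 2 + jdet_im x ^+ 2) * density c' (phi x) = a ^+ 2 * density c x.
Proof.
have key (dj d' d N D' D : R) : dj = N -> d' = D' ^+ 2 -> d = D ^+ 2 ->
    dj ^+ 2 * d' = a ^+ 4 * d -> 0 <= N -> 0 < D' -> 0 < D -> N * D' = a ^+ 2 * D.
  move=> -> -> -> E N0 D'0 D0; apply/eqP.
  rewrite -(@eqrXn2 _ 2) ?mulr_ge0 ?exprn_ge0 ?(ltW D0) ?(ltW D'0) ?(ltW a0) //.
  by rewrite exprMn E; apply/eqP; ring.

have H := etrans (esym (det_congruence (jac phi x) (metric c' (phi x))))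
  (etrans (congr1 determinant (phig x)) (detZ a (metric c x))).
apply: (key _ _ _ _ _ _ (det_jac x) (det_metric c'0 (phi x)) (det_metric c0 x) H).
- by rewrite addr_ge0 ?sqr_ge0.
- exact: density_gt0.
- exact: density_gt0.
Qed.

Lemma jdet_gt0 x : 0 < jdet_re x ^+ 2 + jdet_im x ^+ 2.
Proof.
have : 0 < (jdet_re x ^+ 2 + jdet_im x ^+ 2) * density c' (phi x).
  by rewrite jdet_density mulr_gt0 ?exprn_gt0 ?density_gt0.
by rewrite pmulr_lgt0 // density_gt0.
Qed.

(** The logarithms of the Hermitian determinants differ by a constant and the
    pluriharmonic function log |det dphi|^2. *)
Lemma ham_pullback x : jac phi x *m ddc (ham c') (phi x) *m (jac phi x)^T = ddc (ham c) x.
Proof.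
have [sp sq hol] := holomorphic_jdet.
rewrite -(ddc_pullback _ (smooth_ham c'0) sphi phiJ).
pose N y := jdet_re y * jdet_re y + jdet_im y * jdet_im y.
have sN := smooth_ln_modulus sp sq jdet_gt0.
have HN y : ham c' (phi y) = ham c y + (ln (N y) + ln ((1 + c) / (1 + c') / a ^+ 2)).
  apply: (log_balance c0 c'0 a0); first by rewrite /N -!expr2; exact: jdet_gt0.
  by rewrite /N -!expr2; exact: jdet_density.
rewrite (_ : (fun y => _) = fun y => ham c y + (ln (N y) + ln ((1 + c) / (1 + c') / a ^+ 2)));
  last by apply/funext.
rewrite (ddcD x (smooth_ham c0) (smoothD sN (smooth_cst _))) (ddcD x sN (smooth_cst _)).
by rewrite (ddc_ln_modulus sp sq hol jdet_gt0) ddc_cst !addr0.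
Qed.

Lemma hess_pullback x : jac phi x *m (c' *: hess c' (phi x)) *m (jac phi x)^T = c *: hess c x.
Proof.
apply: (Jcommuting_cancel (phiJ x)).
rewrite -(ddc_ham c0 x) -(ddc_ham c'0 (phi x)); exact: ham_pullback.
Qed.

(** The determinants of corresponding members of the two pencils differ by the
    square of det dphi, which jdet_density eliminates. *)
Lemma root_pullback x (t : R) :
  (a ^+ 2 * ((t + pencil_root c' (phi x)) * (t - pencil_root c' (phi x) * (1 + c' * width_sum c' (phi x))))) ^+ 2 =
  ((a * t + pencil_root c x) * (a * t - pencil_root c x * (1 + c * width_sum c x))) ^+ 2.
Proof.
have E : jac phi x *m (c' *: hess c' (phi x) - t *: metric c' (phi x)) *m (jac phi x)^T =
    c *: hess c x - (a * t) *: metric c x.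
  rewrite mulmxBr mulmxBl hess_pullback; congr (_ - _).
  by rewrite -scalemxAr -scalemxAl phig scalerA mulrC.
have key (dj d' d N D' D P Q : R) : dj = N -> d' = (D' * P) ^+ 2 -> d = (D * Q) ^+ 2 ->
    dj ^+ 2 * d' = d -> N * D' = a ^+ 2 * D -> 0 < D -> (a ^+ 2 * P) ^+ 2 = Q ^+ 2.
  move=> -> -> -> H2 H D0; apply: (@mulfI _ (D ^+ 2)); first by rewrite expf_neq0 // lt0r_neq0.
  have -> : D ^+ 2 * (a ^+ 2 * P) ^+ 2 = (a ^+ 2 * D) ^+ 2 * P ^+ 2 by ring.
  by rewrite -H -[RHS]exprMn -H2; ring.
have H := etrans (esym (det_congruence (jac phi x) (c' *: hess c' (phi x) - t *: metric c' (phi x)))) (congr1 determinant E).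
exact: (key _ _ _ _ _ _ _ _ (det_jac x) (det_pencil c'0 (phi x) t) (det_pencil c0 x (a * t)) H
  (jdet_density x) (density_gt0 x c0)).
Qed.

End Homothety.
End Rigidity.

Section Distinctness.
Variable R : realType.
Notation V := 'rV[R]_4.
Notation J := (@Jmx R).
Implicit Types (c : R) (x y : V) (i j k : 'I_4).

Opaque partial smooth Jmx sol_u sol_v quot1 quot2 width_sum prim profile dprofile pencil_root metric hess.

(** For c, c' > 0 one root of each pencil is negative and the other positive, so
    they correspond in order, and the ratio of the two roots is - (1 + c w). *)
Lemma width_sum_pullback c c' a (phi : V -> V) x : 0 <= c -> 0 <= c' -> 0 < a -> smooth_map phi ->
  (forall x, jac phi x *m J = J *m jac phi x) ->
  (forall x, jac phi x *m metric c' (phi x) *m (jac phi x)^T = a *: metric c x) ->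
  c' * width_sum c' (phi x) = c * width_sum c x.
Proof.
move=> c0 c'0 a0 sphi phiJ phig; have E := root_pullback c0 c'0 a0 sphi phiJ phig x.
have r0 := pencil_root_ge0 c0 x; have r'0 := pencil_root_ge0 c'0 (phi x).
have w0 := width_sum_gt0 c0 x; have w'0 := width_sum_gt0 c'0 (phi x).
have cw0 : 0 <= c * width_sum c x by rewrite mulr_ge0 // ltW.
have cw'0 : 0 <= c' * width_sum c' (phi x) by rewrite mulr_ge0 // ltW.
have E1 := E (- pencil_root c' (phi x)); have E2 := E (pencil_root c' (phi x) * (1 + c' * width_sum c' (phi x))).
case: (eqVneq c 0) => [cz|c1].
  suff -> : c' = 0 by rewrite cz !mul0r.
  apply: (pencil_root_eq0 c'0 (x := phi x)); move: E1; rewrite addNr mul0r mulr0 expr0n /=.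
  have -> : pencil_root c x = 0 by rewrite cz pencil_root_param0.
  rewrite mul0r subr0 addr0 => /esym/eqP; rewrite sqrf_eq0 mulf_eq0 orbb mulf_eq0 (gt_eqF a0) /=.
  by rewrite oppr_eq0 => /eqP.
have rp : 0 < pencil_root c x by apply: pencil_root_gt0; rewrite // lt_neqAle eq_sym c1.
move: E1 E2 rp r'0 cw0 cw'0; move: (c * _) (c' * _) (pencil_root c x) (pencil_root c' (phi x)) => m m' r r'.
rewrite addNr mul0r mulr0 subrr !mulr0 expr0n /= => /esym/eqP E1 /esym/eqP E2 rp r'0 m0 m'0.
have ar' : a * r' = r.
  move: E1; rewrite sqrf_eq0 mulf_eq0 => /orP[|] /eqP E1; first lra.
  have := mulr_ge0 (ltW a0) r'0; have := mulr_ge0 (ltW rp) m0; move: E1; rewrite mulrN mulrDr mulr1; lra.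
move: E2; rewrite mulrA ar' sqrf_eq0 mulf_eq0 => /orP[|] /eqP E2.
  by have := mulr_ge0 (ltW rp) m'0; move: E2; rewrite mulrDr mulr1; lra.
by move: E2; rewrite -mulrBr => /eqP; rewrite mulf_eq0 (gt_eqF rp) /= => /eqP; lra.
Qed.

(** As w >= 1 with equality at the origin, comparing at the origin and at its
    preimage bounds each parameter by the other. *)
Lemma metric_not_homothetic c c' : 0 <= c -> 0 <= c' -> c <> c' ->
  ~ kahler_homothetic (metric c) (metric c').
Proof.
move=> c0 c'0 cc' [phi [a [a0 sphi [psi _ psiK] phiJ phig]]].
have W x := width_sum_pullback x c0 c'0 a0 sphi phiJ phig.
apply: cc'; apply/eqP; rewrite eq_le; apply/andP; split; last first.
  have := W 0; rewrite (width_sum_origin c0) mulr1 => <-.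
  by rewrite ler_peMr // width_sum_ge1.
have := W (psi 0); rewrite psiK (width_sum_origin c'0) mulr1 => ->.
by rewrite ler_peMr // width_sum_ge1.
Qed.

End Distinctness.

Theorem corollary1p5 (R : realType) :
  exists (I : set R) (g : R -> 'rV[R]_4 -> 'M[R]_4)
         (X : R -> 'rV[R]_4 -> 'rV[R]_4),
    (is_interval I /\ exists s t, [/\ I s, I t & s < t]) /\
    [/\ forall t, I t ->
          [/\ steady_gkrs (g t) (X t), complete_metric (g t) &
              torus_invariant (g t) (X t)],
        (forall i j, continuous_family I (fun t x => g t x i j)) /\
        (forall j, continuous_family I (fun t x => X t x 0 j)),
        forall s t, I s -> I t -> s <> t -> ~ kahler_homothetic (g s) (g t) &
        exists t, [/\ I t, taub_nut (g t) & forall x, ricci (g t) x = 0]].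
Proof.
exists (@nonneg R), (@metric R), (@soliton_field R); split; first split.
- by move=> s t s0 _ r /andP[sr _]; exact: le_trans s0 sr.
- by exists 0, 1; split; [exact: lexx|exact: ler01|exact: ltr01].
split.
- move=> t t0; split; [exact: metric_soliton|exact: metric_complete|exact: metric_torus_invariant].
- by split; [exact: metric_continuous_family|exact: soliton_field_continuous_family].
- by move=> s t; exact: metric_not_homothetic.
- exists 0; split; [exact: lexx|exact: metric0_taub_nut|exact: metric0_ricci_flat].
Qed.
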